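(* Let $r\in\mathbb N$ and let $\underline m=(m_1,m_2)$, $\underline n=(n_1,n_2)$ with $m_i,n_i\in(\mathbb Z/r)^\times$ for $i=1,2$. The following are equivalent: (i) $(C(L_q^3(r;\underline m)),\gamma)\simeq (C(L_q^3(r;\underline n)),\gamma)$, i.e. there is a $*$-isomorphism between the two quantum lens spaces which intertwines the circle actions $\gamma$; (ii) $\gcd(m_2-m_1,r)=\gcd(n_2-n_1,r)$; (iii) $\overline{\mathcal W}(r;\underline m)=\overline{\mathcal W}(r;\underline n)$ as multisets.
   Context: Graph $C^*$-algebras: for a directed graph $E=(E^0,E^1,r,s)$ (range map $r$, source map $s$), $C^*(E)$ is the universal $C^*$-algebra generated by mutually orthogonal projections $P_v$ ($v\in E^0$) and partial isometries $S_e$ ($e\in E^1$) with mutually orthogonal ranges such that $S_e^*S_e=P_{r(e)}$, $S_eS_e^*\le P_{s(e)}$, and $P_v=\sum_{s(e)=v}S_eS_e^*$ whenever $\{e:s(e)=v\}$ is finite and nonempty. The gauge action of $\mathbb T$ is $\gamma_z(P_v)=P_v$, $\gamma_z(S_e)=zS_e$. $L_3$ is the graph with vertices $v_1,v_2$ and edges $e_{11},e_{12},e_{22}$, where $e_{ij}$ goes from $v_i$ to $v_j$. The Vaksman–Soibelman sphere $C(S_q^3)$, $q\in(0,1)$, is identified with $C^*(L_3)$ (its natural circle action being the gauge action). For a positive integer $r$ and $\underline m=(m_1,m_2)$ with $\gcd(m_i,r)=1$, let $\theta=e^{2\pi i/r}$ and let $\mathbb Z/r$ act on $C^*(L_3)$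 through $\rho^r_{\underline m}:S_{e_{ij}}\mapsto\theta^{m_i}S_{e_{ij}},\ P_{v_i}\mapsto P_{v_i}$. The quantum lens space is $C(L_q^3(r;\underline m))=C^*(L_3)^{\rho^r_{\underline m}}$, with circle action $\gamma$ obtained by restricting the gauge action of $C^*(L_3)$. $\overline{\mathcal W}(r;(m_1,m_2))$ is the multiset in $\mathbb Z/r$ of the values $t_1+t_2+1 \bmod r$ (the lengths mod $r$ of the paths $e_{11}^{t_1}e_{12}e_{22}^{t_2}$), where $(t_1,t_2)$ ranges over the pairs in $\{0,1,\dots,r-1\}^2$ with $m_1(t_1+1)+m_2t_2\equiv 0\pmod r$. *)

(* Defs.v *)
From HB Require Import structures.
From mathcomp Require Import all_boot all_order all_algebra.
From mathcomp Require Import finmap multiset.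
From mathcomp Require Import all_classical all_reals all_analysis.
From mathcomp Require Import complex.

Set Implicit Arguments.
Unset Strict Implicit.
Unset Printing Implicit Defensive.

Import Order.TTheory GRing.Theory Num.Theory.
Import numFieldNormedType.Exports.

Local Open Scope classical_set_scope.
Local Open Scope ring_scope.
Local Open Scope complex_scope.

(* Complex C*-algebras, not assumed unital; hence the product is a new
   operation rather than the one of a MathComp ring structure.  The norm of a
   normed module over R[i] takes its values in R[i] (in fact in the nonnegative
   reals). *)
HB.mixin Record isCStarAlgebra (R : realType) A
    of CompleteNormedModule R[i] A := {
  cmul : A -> A -> A;
  star : A -> A;
  cmulA : forall x y z, cmul x (cmul y z) = cmul (cmul x y) z;
  cmulDl : forall x y z, cmul (x + y) z = cmul x z + cmul y z;
  cmulDr : forall x y z, cmul x (y + z) = cmul x y + cmul x z;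
  cmulZl : forall (c : R[i]) x y, cmul (c *: x) y = c *: cmul x y;
  cmulZr : forall (c : R[i]) x y, cmul x (c *: y) = c *: cmul x y;
  starK : forall x, star (star x) = x;
  starD : forall x y, star (x + y) = star x + star y;
  starZ : forall (c : R[i]) x, star (c *: x) = Num.conj c *: star x;
  starM : forall x y, star (cmul x y) = cmul (star y) (star x);
  cnormM : forall x y, `|cmul x y| <= `|x| * `|y|;
  cnorm_star : forall x, `|cmul (star x) x| = `|x| ^+ 2
}.

#[short(type="cstarAlgType")]
HB.structure Definition CStarAlgebra (R : realType) :=
  {A of isCStarAlgebra R A & CompleteNormedModule R[i] A}.

Notation "x ** y" := (cmul x y) (at level 40, left associativity) : ring_scope.

(* f is only required to be a *-homomorphism on X (meant to be a *-subalgebra);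
   its values outside X are irrelevant. *)
Definition star_hom_on (R : realType) (A B : cstarAlgType R)
    (X : set A) (f : A -> B) : Prop :=
  [/\ forall (c : R[i]) x y, X x -> X y -> f (c *: x + y) = c *: f x + f y,
      forall x y, X x -> X y -> f (x ** y) = f x ** f y &
      forall x, X x -> f (star x) = star (f x)].

Definition star_hom (R : realType) (A B : cstarAlgType R) (f : A -> B) : Prop :=
  star_hom_on setT f.

Definition closed_star_subalgebra (R : realType) (A : cstarAlgType R)
    (X : set A) : Prop :=
  [/\ closed X,
      X 0,
      forall (c : R[i]) x y, X x -> X y -> X (c *: x + y),
      forall x y, X x -> X y -> X (x ** y) &
      forall x, X x -> X (star x)].

Section Projections.
Variables (R : realType) (A : cstarAlgType R).

Definition is_projection (p : A) : Prop := p ** p = p /\ star p = p.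

Definition proj_le (p q : A) : Prop := p ** q = p /\ q ** p = p.

Definition partial_isometry (s : A) : Prop := s ** star s ** s = s.

Definition range_proj (s : A) : A := s ** star s.

Definition source_proj (s : A) : A := star s ** s.

End Projections.

Record digraph := Digraph {
  vertex : Type;
  edge : choiceType;
  esource : edge -> vertex;
  erange : edge -> vertex
}.

(* Cuntz-Krieger families, with the convention S_e^* S_e = P_(r(e)). *)
Definition ck_family (R : realType) (E : digraph) (A : cstarAlgType R)
    (P : vertex E -> A) (S : edge E -> A) : Prop :=
  [/\ (forall v, is_projection (P v)) /\
      (forall v w, v <> w -> P v ** P w = 0),
      (forall e, partial_isometry (S e)) /\
      (forall e f, e <> f -> range_proj (S e) ** range_proj (S f) = 0),
      forall e, source_proj (S e) = P (erange e),
      forall e, proj_le (range_proj (S e)) (P (esource e)) &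
      forall v, finite_set [set e | esource e = v] ->
        [set e | esource e = v] !=set0 ->
        P v = \sum_(e \in [set e | esource e = v]) range_proj (S e)].

(* (A, P, S) is C^*(E): A is generated by the Cuntz-Krieger family (P, S), and
   this family is universal. *)
Definition is_graph_cstar (R : realType) (E : digraph) (A : cstarAlgType R)
    (P : vertex E -> A) (S : edge E -> A) : Prop :=
  [/\ ck_family P S,
      forall X : set A, closed_star_subalgebra X ->
        (forall v, X (P v)) -> (forall e, X (S e)) -> X = setT &
      forall (B : cstarAlgType R) (Q : vertex E -> B) (T : edge E -> B),
        ck_family Q T ->
        exists! phi : A -> B,
          [/\ star_hom phi, forall v, phi (P v) = Q v
            & forall e, phi (S e) = T e]].

(* phi is the endomorphism P_v |-> P_v, S_e |-> c_e S_e. *)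
Definition rescales (R : realType) (E : digraph) (A : cstarAlgType R)
    (P : vertex E -> A) (S : edge E -> A) (c : edge E -> R[i])
    (phi : A -> A) : Prop :=
  [/\ star_hom phi, forall v, phi (P v) = P v
    & forall e, phi (S e) = c e *: S e].

(* In particular, the gauge action and the Z/r-action below exist and are unique. *)
Lemma rescales_exists (R : realType) (E : digraph) (A : cstarAlgType R)
    (P : vertex E -> A) (S : edge E -> A) (c : edge E -> R[i]) :
  is_graph_cstar P S -> (forall e, `|c e| = 1) ->
  exists! phi : A -> A, rescales P S c phi.
Proof.
move=> [[[Pp Po] [Si So] SP SPl PS] _ U] c1.
have cc e : Num.conj (c e) * c e = 1 by rewrite mulrC -normCK c1 expr1n.
have rS e : range_proj (c e *: S e) = range_proj (S e).
  by rewrite /range_proj starZ cmulZl cmulZr scalerA mulrC cc scale1r.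
have sS e : source_proj (c e *: S e) = source_proj (S e).
  by rewrite /source_proj starZ cmulZl cmulZr scalerA cc scale1r.
apply: U; split=> [//||e|e|v fv nv].
- split=> [e|e f ef]; last by rewrite !rS; exact: So.
  by rewrite /partial_isometry -/(range_proj _) rS cmulZr /range_proj Si.
- by rewrite sS.
- by rewrite rS.
- by rewrite PS//; apply: eq_fsbigr => e _; rewrite rS.
Qed.

(* The circle group is the set of z : R[i] with `|z| = 1; the values of gamma
   at other z are irrelevant. *)
Definition is_gauge_action (R : realType) (E : digraph) (A : cstarAlgType R)
    (P : vertex E -> A) (S : edge E -> A) (gamma : R[i] -> A -> A) : Prop :=
  forall z : R[i], `|z| = 1 -> rescales P S (fun=> z) (gamma z).

(* The vertices v_1, v_2 are the elements 0, 1 of 'I_2, and the edge e_ij, for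
   i <= j, is the pair (i, j). *)
Definition L3 : digraph :=
  @Digraph 'I_2 {ij : 'I_2 * 'I_2 | (ij.1 <= ij.2)%N}
    (fun e => (val e).1) (fun e => (val e).2).

Definition theta (R : realType) (r : nat) : R[i] :=
  cos (2 * pi / r%:R) +i* sin (2 * pi / r%:R).

Lemma norm_theta (R : realType) r : `|theta R r| = 1.
Proof. by rewrite normc_def /= cos2Dsin2 sqrtr1. Qed.

(* rho is the automorphism by which the generator 1 of Z/r acts. *)
Definition is_lens_generator (R : realType) (A : cstarAlgType R)
    (P : vertex L3 -> A) (S : edge L3 -> A) (r : nat) (m : 'I_2 -> int)
    (rho : A -> A) : Prop :=
  rescales P S (fun e => theta R r ^ m (esource e)) rho.

(* The fixed-point algebra of the cyclic group generated by rho. *)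
Definition fixed_points (A : Type) (rho : A -> A) : set A :=
  [set a | forall k : nat, iter k rho a = a].

Definition equivariantly_isomorphic (R : realType) (A : cstarAlgType R)
    (gamma : R[i] -> A -> A) (X Y : set A) : Prop :=
  exists f : A -> A,
    [/\ set_bij X Y f, star_hom_on X f &
        forall (z : R[i]) a, `|z| = 1 -> X a -> f (gamma z a) = gamma z (f a)].

(* Residues mod r are represented by naturals smaller than r. *)
Definition path_lengths (r : nat) (m : 'I_2 -> int) : {mset nat}%mset :=
  seq_mset [seq ((t.1 + t.2 + 1) %% r)%N | t : 'I_r * 'I_r <- enum {: 'I_r * 'I_r}
    & (m ord0 * (t.1.+1)%:Z + m ord_max * (t.2 : nat)%:Z == 0 %[mod r])%Z].

(* Main.v *)
(* Write [w 0 = P_(v_2)], [w i.+1 = S_(e_11)^i S_(e_12)] and [u = S_(e_22)], so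
   that [star (w i) ** w j] is [P_(v_2)] if [i = j] and [0] otherwise.  The
   matrix of an element [x] has the entries [star (w i) ** x ** w j], which lie
   in the closure of the Laurent polynomials in the unitary [u], and the norm of
   [x] is the supremum of the norms of its finite corners: on elements of degree
   at most [D] (powers of [S_(e_11)] plus a corner) this holds up to a factor
   linear in [D], which the powers of [star y ** y] remove.  Hence [x] is
   determined by its matrix, also in any other system [w (pi i) ** u^(al i)]
   with [pi] a bijection, and an element whose matrix is realised by a limit of
   elements in a second system is itself realised.

   (ii) -> (i): let [v] be a unit modulo [r] with
   [m_1 (n_1 - n_0) v = n_1 (m_1 - m_0)], where [m_0], [m_1] are the weights of
   [v_1], [v_2], and let [sigma] permute each block of [r] consecutive integers
   by multiplication by [v].  Two elements correspond if they have the same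
   matrix in the systems [w i ** u^(sigma i)] and [w (sigma i) ** u^i]
   respectively.  Both systems have gauge degree [i + sigma i], the choice of
   [v] makes invariance under one action of [Z/r] correspond to invariance under
   the other, and the powers of [S_(e_11)^r] have the same matrix in both.

   (i) -> (ii): the gauge-invariant elements fixed by the action of weights [m]
   have entries [l *: (star u^i ** u^j)], zero unless
   [i = j %[mod r / gcd (m_1 - m_0, r)]].  The projections [w a ** star (w a)]
   with [a < r / gcd (m_1 - m_0, r)] therefore have no gauge-invariant elements
   between them; by pigeonhole this bounds [r / gcd (m_1 - m_0, r)] by
   [r / gcd (n_1 - n_0, r)].

   (ii) <-> (iii): the unit [v] gives a bijection of the paths that preserves
   the lengths modulo [r]; conversely, the length [gcd (m_1 - m_0, r)] occurs,
   and every length is a multiple of it. *)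

Require Import Defs.
From HB Require Import structures.
From mathcomp Require Import all_boot all_order all_algebra.
From mathcomp Require Import multiset.
From mathcomp Require Import all_classical all_reals all_analysis.
From mathcomp Require Import complex.
From mathcomp Require Import zify ring lra.

Set Implicit Arguments.
Unset Strict Implicit.
Unset Printing Implicit Defensive.

Import Order.TTheory GRing.Theory Num.Theory.
Import numFieldNormedType.Exports.

Local Open Scope classical_set_scope.
Local Open Scope ring_scope.
Local Open Scope complex_scope.

(** * Real-valued norms and limits of sequences *)

(** The lens spaces are given as fixed-point algebras, not by generators, so the universal property
    yields no isomorphism between them; hence the detour through matrices. An intertwiner of the two
    systems would be an infinite sum without a norm limit in the algebra, so every comparison uses
    finite pieces of it.

    The congruence for [v] comes from weights. On the powers of [u] the second action is the power
    [q] of the first, where [q m_1 = n_1] modulo [r]. The vector of index [i] has weight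
    [m_0 i + m_1 sigma i] in the first system and [n_0 sigma i + n_1 i] in the second; [q] times the
    former is the latter exactly if [m_1 (n_1 - n_0) sigma i = n_1 (m_1 - m_0) i]. Averaging over
    [Z/r] leaves only the powers of [S_(e_11)] with exponent divisible by [r], since [m_0] is a
    unit; this is why [sigma] need only respect blocks of length [r].

    Averages over roots of unity of growing order replace integration over the circle. The universal
    property alone does not exclude [P_(v_2) = 0]; a concrete representation by bounded matrices
    does. *)

Section RealNorm.
Variable R : realType.
Implicit Types V : normedZmodType R[i].

(** Norms take their values in [R[i]]; the real part loses nothing, by [nrmE], and makes the order
    of [R] and [lra] available. *)
Definition nrm V (x : V) : R := complex.Re `|x|.

Lemma nrmE V (x : V) : `|x| = (nrm x)%:C.
Proof.
by rewrite /nrm; have := normr_ge0 x; case: `|x| => a b; rewrite lecE /= => /andP[/eqP-> _].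
Qed.

Lemma nrm_le V (x : V) (M : R) : (`|x| <= M%:C) = (nrm x <= M).
Proof. by rewrite nrmE lecR. Qed.

Lemma nrm_lt V (x : V) (M : R) : (`|x| < M%:C) = (nrm x < M).
Proof. by rewrite nrmE ltcR. Qed.

Lemma nrm_ge0 V (x : V) : 0 <= nrm x.
Proof. by rewrite -ler0c -nrmE. Qed.

Lemma nrm0 V : nrm (0 : V) = 0.
Proof. by rewrite /nrm normr0. Qed.

Lemma nrm0_eq0 V (x : V) : nrm x = 0 -> x = 0.
Proof. by move=> x0; apply/eqP; rewrite -normr_eq0 nrmE x0. Qed.

Lemma nrmN V (x : V) : nrm (- x) = nrm x.
Proof. by rewrite /nrm normrN. Qed.

Lemma nrmBC V (x y : V) : nrm (x - y) = nrm (y - x).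
Proof. by rewrite /nrm distrC. Qed.

Lemma nrmD V (x y : V) : nrm (x + y) <= nrm x + nrm y.
Proof. by rewrite -lecR raddfD /= -!nrmE ler_normD. Qed.

Lemma nrmB V (x y : V) : nrm (x - y) <= nrm x + nrm y.
Proof. by rewrite -[nrm y]nrmN nrmD. Qed.

Lemma nrm_tri V (y x z : V) : nrm (x - z) <= nrm (x - y) + nrm (y - z).
Proof. by rewrite -lecR raddfD /= -!nrmE ler_distD. Qed.

Lemma nrm_sum V I (s : seq I) (Q : pred I) (F : I -> V) :
  nrm (\sum_(i <- s | Q i) F i) <= \sum_(i <- s | Q i) nrm (F i).
Proof.
elim/big_rec2: _ => [|i y x _ IH]; first by rewrite nrm0.
by apply: le_trans (nrmD _ _) _; rewrite lerD2l.
Qed.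

Lemma nrm_eps V (x : V) : (forall e, 0 < e -> nrm x <= e) -> x = 0.
Proof.
move=> h; apply: nrm0_eq0; apply/eqP; rewrite eq_le nrm_ge0 andbT.
by apply/ler_addgt0Pl => e e0; rewrite addr0 h.
Qed.

Lemma nrmM (x y : R[i]) : nrm (x * y) = nrm x * nrm y.
Proof. by apply: (@complexI R); rewrite rmorphM /= -!nrmE normrM. Qed.

Lemma nrm1 : nrm (1 : R[i]) = 1.
Proof. by rewrite /nrm normr1. Qed.

Lemma nrm_conj (x : R[i]) : nrm (Num.conj x) = nrm x.
Proof. by rewrite /nrm norm_conjC. Qed.

Lemma conj_real (x : R) : Num.conj x%:C = x%:C.
Proof. exact: conjc_real. Qed.

Lemma mulconj_nrm (x : R[i]) : Num.conj x * x = (nrm x ^+ 2)%:C.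
Proof. by rewrite rmorphXn /= -nrmE normCK mulrC. Qed.

Lemma nrmZ (V : normedModType R[i]) (a : R[i]) (x : V) :
  nrm (a *: x) = nrm a * nrm x.
Proof. by apply: (@complexI R); rewrite rmorphM /= -!nrmE normrZ. Qed.

Lemma nrm_real (x : R) : nrm x%:C = `|x|.
Proof. by rewrite /nrm normc_def /= expr0n addr0 sqrtr_sqr. Qed.

Lemma nrm_Re (z : R[i]) : `|complex.Re z| <= nrm z.
Proof. by rewrite -lecR -nrmE normc_ge_Re. Qed.

Lemma nrm_Im (z : R[i]) : `|complex.Im z| <= nrm z.
Proof.
rewrite /nrm normc_def /= -sqrtr_sqr ler_sqrt ?addr_ge0 ?sqr_ge0//.
by rewrite lerDr sqr_ge0.
Qed.

Lemma nrm_ReIm (z : R[i]) : nrm z <= `|complex.Re z| + `|complex.Im z|.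
Proof.
case: z => a b /=; rewrite -[leLHS](_ : nrm (a%:C + 'i%C * b%:C) = _); last first.
  by congr nrm; rewrite [RHS]complexE.
apply: le_trans (nrmD _ _) _; rewrite nrmM !nrm_real.
by rewrite [nrm _](_ : _ = 1) ?mul1r// /nrm normc_def /= expr0n expr1n add0r sqrtr1.
Qed.

Lemma gt0_realC (e : R[i]) : 0 < e -> exists2 e', 0 < e' & e = e'%:C.
Proof.
by case: e => a b; rewrite ltcE /= => /andP[/eqP-> a0]; exists a.
Qed.

Lemma archi_inv (e : R) : 0 < e -> exists N, forall n, (N <= n)%N -> n.+1%:R^-1 <= e.
Proof.
move=> e0; exists (Num.bound e^-1) => n Nn.
rewrite -[leRHS]invrK lef_pV2 ?posrE ?ltr0n ?invr_gt0//.
apply: le_trans (ltW (archi_boundP _)) _; first by rewrite invr_ge0 ltW.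
by rewrite ler_nat ltnW.
Qed.

(** Limits of plain sequences suffice throughout; filters enter only where completeness or
    closedness in the topology is used or proved. *)
Definition tends V (u : nat -> V) (l : V) :=
  forall e, 0 < e -> exists N, forall n, (N <= n)%N -> nrm (u n - l) <= e.

Definition cauchy_seq V (u : nat -> V) :=
  forall e, 0 < e -> exists N, forall m n, (N <= m)%N -> (N <= n)%N ->
    nrm (u m - u n) <= e.

Lemma tends_uniq V (u : nat -> V) (l l' : V) : tends u l -> tends u l' -> l = l'.
Proof.
move=> ul ul'; apply/eqP; rewrite -subr_eq0; apply/eqP/nrm_eps => e e0.
have e2 : 0 < e / 2 by lra.
have [N HN] := ul _ e2; have [N' HN'] := ul' _ e2.
apply: le_trans (nrm_tri (u (maxn N N')) _ _) _.
have := HN _ (leq_maxl N N'); have := HN' _ (leq_maxr N N').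
by rewrite (nrmBC l); lra.
Qed.

Lemma tends_cst V (l : V) : tends (fun=> l) l.
Proof. by move=> e e0; exists 0%N => n _; rewrite subrr nrm0 ltW. Qed.

Lemma tends_eventually V (u v : nat -> V) l :
  (exists N, forall n, (N <= n)%N -> u n = v n) -> tends u l -> tends v l.
Proof.
move=> [M uv] ul e e0; have [N HN] := ul e e0; exists (maxn M N) => n.
by rewrite geq_max => /andP[Mn Nn]; rewrite -uv// HN.
Qed.

Lemma tendsD V (u v : nat -> V) l l' :
  tends u l -> tends v l' -> tends (fun n => u n + v n) (l + l').
Proof.
move=> ul vl' e e0; have e2 : 0 < e / 2 by lra.
have [N HN] := ul _ e2; have [N' HN'] := vl' _ e2.
exists (maxn N N') => n; rewrite geq_max => /andP[Nn N'n].
have := HN _ Nn; have := HN' _ N'n; have := nrmD (u n - l) (v n - l').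
by rewrite addrACA -opprD; lra.
Qed.

Lemma tends_sum V I (s : seq I) (u : I -> nat -> V) (l : I -> V) :
  (forall i, tends (u i) (l i)) ->
  tends (fun n => \sum_(i <- s) u i n) (\sum_(i <- s) l i).
Proof.
move=> ul; elim: s => [|i s IH].
  under [X in tends X]eq_fun => n do rewrite big_nil.
  by rewrite big_nil; exact: tends_cst.
under [X in tends X]eq_fun => n do rewrite big_cons.
by rewrite big_cons; exact: tendsD.
Qed.

Lemma tends_lip V V' (f : V -> V') (c : R) (u : nat -> V) l :
  (forall x y, nrm (f x - f y) <= c * nrm (x - y)) ->
  tends u l -> tends (fun n => f (u n)) (f l).
Proof.
move=> fc ul e e0; have c0 : 0 < `|c| + 1 by rewrite ltr_wpDl.
have [|N HN] := ul (e / (`|c| + 1)); first by rewrite divr_gt0.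
exists N => n /HN le_e; apply: le_trans (fc _ _) _.
apply: (@le_trans _ _ ((`|c| + 1) * nrm (u n - l))).
  by rewrite ler_wpM2r ?nrm_ge0// (le_trans (ler_norm c))// lerDl.
by rewrite -ler_pdivlMl// mulrC.
Qed.

Lemma tends_le V (u : nat -> V) l M :
  (forall n, nrm (u n) <= M) -> tends u l -> nrm l <= M.
Proof.
move=> uM ul; apply/ler_addgt0Pl => e e0; have [N HN] := ul e e0.
have := nrmD (l - u N) (u N); rewrite subrK nrmBC.
by have := HN N (leqnn N); have := uM N; lra.
Qed.

Lemma tends_cauchy V (u : nat -> V) l : tends u l -> cauchy_seq u.
Proof.
move=> ul e e0; have e2 : 0 < e / 2 by lra.
have [N HN] := ul _ e2; exists N => m n Nm Nn.
have := nrm_tri l (u m) (u n); rewrite (nrmBC l).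
by have := HN m Nm; have := HN n Nn; lra.
Qed.

Lemma Rcauchy_tends (u : nat -> R) :
  (forall e, 0 < e -> exists N, forall m n, (N <= m)%N -> (N <= n)%N ->
    `|u m - u n| <= e) ->
  exists l, forall e, 0 < e -> exists N, forall n, (N <= n)%N -> `|u n - l| <= e.
Proof.
move=> uc.
have /cvg_ex[/= l ul] : cvg (u @ \oo).
  apply/cauchy_cvgP/cauchy_ballP => e e0.
  have e2 : 0 < e / 2 by lra.
  have [N HN] := uc _ e2; near_simpl; near=> m n => /=.
  rewrite /ball/= (le_lt_trans (HN _ _ _ _))//; try lra.
    by near: m; exists N.
  by near: n; exists N.
exists l => e e0; have /cvgrPdist_le/(_ _ e0)[N _ HN] := ul.
by exists N => n /HN; rewrite distrC.
Unshelve. all: by end_near. Qed.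

Lemma Ccauchy_tends (u : nat -> R[i]) : cauchy_seq u -> exists l, tends u l.
Proof.
move=> uc.
have [|a Ha] := @Rcauchy_tends (fun n => complex.Re (u n)).
  move=> e /uc[N HN]; exists N => m n Nm Nn.
  by apply: le_trans (HN m n Nm Nn); rewrite -raddfB nrm_Re.
have [|b Hb] := @Rcauchy_tends (fun n => complex.Im (u n)).
  move=> e /uc[N HN]; exists N => m n Nm Nn.
  by apply: le_trans (HN m n Nm Nn); rewrite -raddfB nrm_Im.
exists (a +i* b) => e e0; have e2 : 0 < e / 2 by lra.
have [N HN] := Ha _ e2; have [N' HN'] := Hb _ e2.
exists (maxn N N') => n; rewrite geq_max => /andP[/HN ha /HN' hb].
apply: le_trans (nrm_ReIm _) _; case: (u n) ha hb => x y /=; lra.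
Qed.

(** A Cauchy filter contains balls of radius [1 / (n + 1)]. Their centres form a Cauchy sequence
    because two members of a proper filter meet, and its limit is the limit of the filter. *)
Lemma seq_complete (V : normedModType R[i]) :
  (forall u : nat -> V, cauchy_seq u -> exists l, tends u l) ->
  forall F : set_system V, ProperFilter F -> cauchy F -> cvg F.
Proof.
move=> Vc F FF Fc.
pose d n : R := n.+1%:R^-1.
have d0 n : 0 < d n by rewrite invr_gt0 ltr0n.
have /choice[u Hu] n : exists x, F (ball x (d n)%:C).
  by have /cauchyP := Fc; apply; rewrite ltcR.
have uB n x : ball (u n) (d n)%:C x -> nrm (u n - x) < d n.
  by rewrite -ball_normE /= nrm_lt.
have uc : cauchy_seq u.
  move=> e e0; have [|N HN] := @archi_inv (e / 2); first lra.
  exists N => m n Nm Nn.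
  have /filter_ex[x [/uB xm /uB xn]] : F (ball (u m) (d m)%:C `&` ball (u n) (d n)%:C).
    exact: filterI.
  have := nrm_tri x (u m) (u n); rewrite (nrmBC x).
  have := HN _ Nm; have := HN _ Nn; rewrite -/(d n) -/(d m).
  by move: xm xn; move: (d m) (d n) => dm dn; lra.
have [l ul] := Vc _ uc; apply/cvg_ex; exists l.
apply/cvgrPdist_le => /= e e0.
have [e' e'0 Ee] := gt0_realC e0; rewrite {}Ee {e e0}.
have e2 : 0 < e' / 2 by lra.
have [N HN] := archi_inv e2; have [N' HN'] := ul _ e2.
pose M := maxn N N'; apply: filterS (Hu M) => x /uB xM.
rewrite nrm_le; have := nrm_tri (u M) l x; rewrite (nrmBC l (u M)).
by have := HN' M (leq_maxr _ _); have := HN M (leq_maxl _ _); rewrite -/(d M); lra.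
Qed.

Lemma cauchy_tends (V : completeNormedModType R[i]) (u : nat -> V) :
  cauchy_seq u -> exists l, tends u l.
Proof.
move=> uc.
have /cvg_ex[/= l ul] : cvg (u @ \oo).
  apply/cauchy_cvgP/cauchy_ballP => e e0.
  have [e' e'0 Ee] := gt0_realC e0; rewrite {}Ee {e e0}.
  have e2 : 0 < e' / 2 by lra.
  have [N HN] := uc _ e2; near_simpl; near=> m n => /=.
  rewrite -ball_normE /= nrm_lt (le_lt_trans (HN _ _ _ _))//; try lra.
    by near: m; exists N.
  by near: n; exists N.
exists l => e e0; have /cvgrPdist_le/(_ e%:C)[|N _ HN] := ul; first by rewrite ltcR.
by exists N => n /HN /=; rewrite nrm_le nrmBC.
Unshelve. all: by end_near. Qed.

Definition adherent V (X : set V) (x : V) :=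
  forall e, 0 < e -> exists2 y, X y & nrm (x - y) <= e.

Lemma adherent_closed (V : normedModType R[i]) (X : set V) :
  (forall x, adherent X x -> X x) -> closed X.
Proof.
move=> h x xX; apply: h => e e0.
have /xX[y [Xy]] : nbhs x (ball x e%:C) by apply: nbhsx_ballx; rewrite ltcR.
by rewrite -ball_normE /= nrm_lt => /ltW; exists y.
Qed.

Lemma adherent_tends V (X : set V) x :
  adherent X x -> exists2 u, forall n, X (u n) & tends u x.
Proof.
move=> xX; pose d n : R := n.+1%:R^-1.
have /choice[u Hu] n : exists y, X y /\ nrm (x - y) <= d n.
  by have [|y Xy xy] := xX (d n); [rewrite invr_gt0 ltr0n|exists y].
exists u => [n|e e0]; first by case: (Hu n).
have [N HN] := archi_inv e0; exists N => n /HN; rewrite nrmBC.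
by apply: le_trans; case: (Hu n).
Qed.

Lemma tends_adherent V (X : set V) u x :
  (forall n, X (u n)) -> tends u x -> adherent X x.
Proof.
move=> Xu ux e e0; have [N HN] := ux e e0; exists (u N) => //.
by rewrite nrmBC HN.
Qed.

End RealNorm.

(** * Bounded infinite matrices *)

Section InfiniteMatrices.
Variable R : realType.
Local Notation C := R[i].
Implicit Types (x y : nat -> C) (a b : nat -> nat -> C) (M : R).

(** Vectors are arbitrary sequences cut off at [N]; belonging to l^2 is a bound uniform in [N], so
    that no infinite sum of squares has to be formed. *)
Definition l2 N x : R := Num.sqrt (\sum_(i < N) nrm (x i) ^+ 2).

Lemma sum_nrm2_ge0 N x : 0 <= \sum_(i < N) nrm (x i) ^+ 2.
Proof. by apply: sumr_ge0 => i _; exact: sqr_ge0. Qed.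

Lemma l2_ge0 N x : 0 <= l2 N x.
Proof. exact: sqrtr_ge0. Qed.

Lemma sqr_l2 N x : l2 N x ^+ 2 = \sum_(i < N) nrm (x i) ^+ 2.
Proof. by rewrite sqr_sqrtr// sum_nrm2_ge0. Qed.

Lemma l2_conj N x : l2 N (fun i => Num.conj (x i)) = l2 N x.
Proof. by rewrite /l2; under eq_bigr => i _ do rewrite nrm_conj. Qed.

Lemma l2_mono N N' x : (N <= N')%N -> l2 N x <= l2 N' x.
Proof.
move=> NN; rewrite ler_sqrt ?sum_nrm2_ge0// -(subnKC NN) big_split_ord /=.
by rewrite lerDl sumr_ge0// => i _; exact: sqr_ge0.
Qed.

Definition delta j : nat -> C := fun i => (i == j)%:R.

Lemma sum_delta N j (f : nat -> C) : (j < N)%N ->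
  \sum_(i < N) delta j i * f i = f j.
Proof.
move=> jN; rewrite (bigD1 (Ordinal jN))//= /delta eqxx mul1r big1 ?addr0//.
by move=> i; rewrite -val_eqE /= => /negPf->; rewrite mul0r.
Qed.

Lemma sum_deltar N j (f : nat -> C) : (j < N)%N ->
  \sum_(i < N) f i * delta j i = f j.
Proof. by move=> jN; under eq_bigr => i _ do rewrite mulrC; rewrite sum_delta. Qed.

Lemma l2_delta N j : l2 N (delta j) <= 1.
Proof.
rewrite -sqrtr1 ler_sqrt//; case: (ltnP j N) => jN.
  rewrite (bigD1 (Ordinal jN))//= /delta eqxx nrm1 expr1n big1 ?addr0//.
  by move=> i; rewrite -val_eqE /= => /negPf->; rewrite nrm0 expr0n.
rewrite big1// => i _; rewrite /delta.
by rewrite (ltn_eqF (leq_trans (ltn_ord i) jN)) nrm0 expr0n.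
Qed.

Lemma cauchy_schwarz N x y : nrm (\sum_(i < N) x i * y i) <= l2 N x * l2 N y.
Proof.
suff /(le_trans _) : \sum_(i < N) nrm (x i) * nrm (y i) <= l2 N x * l2 N y.
  apply; apply: le_trans (nrm_sum _ _ _) _.
  by under eq_bigr => i _ do rewrite nrmM.
have h (M : nat) : (\sum_(i < M) nrm (x i) * nrm (y i)) ^+ 2 <=
    (\sum_(i < M) nrm (x i) ^+ 2) * (\sum_(i < M) nrm (y i) ^+ 2).
  elim: M => [|M IH]; first by rewrite !big_ord0 expr0n mul0r.
  rewrite !big_ord_recr /=.
  have X0 := sum_nrm2_ge0 M x; have Y0 := sum_nrm2_ge0 M y.
  have : 0 <= \sum_(i < M) nrm (x i) * nrm (y i).
    by apply: sumr_ge0 => i _; rewrite mulr_ge0 ?nrm_ge0.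
  move: IH X0 Y0 (nrm_ge0 (x M)) (nrm_ge0 (y M)).
  move: (\sum_(i < M) _ * _) (\sum_(i < M) nrm (x i) ^+ 2) => S X.
  move: (\sum_(i < M) _ ^+ 2) (nrm _) (nrm _) => Y q p IH X0 Y0 p0 q0 S0.
  (* The cross terms: since [S ^+ 2 <= X * Y] by induction, squaring reduces the claim to
     [4 X Y (p q)^2 <= (X q^2 + Y p^2)^2]. *)
  have h1 : (2 * S * (p * q)) <= X * q ^+ 2 + Y * p ^+ 2.
    have h2 : 0 <= X * q ^+ 2 + Y * p ^+ 2.
      by rewrite addr_ge0 ?mulr_ge0 ?sqr_ge0.
    rewrite -(@ler_pXn2r _ 2)// ?nnegrE ?mulr_ge0//.
    have -> : (2 * S * (p * q)) ^+ 2 = 4 * (S ^+ 2 * (p * q) ^+ 2) by ring.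
    apply: (@le_trans _ _ (4 * (X * Y * (p * q) ^+ 2))).
      by rewrite ler_wpM2l// ler_wpM2r// sqr_ge0.
    rewrite -subr_ge0.
    have -> : (X * q ^+ 2 + Y * p ^+ 2) ^+ 2 - 4 * (X * Y * (p * q) ^+ 2) =
      (X * q ^+ 2 - Y * p ^+ 2) ^+ 2 by ring.
    exact: sqr_ge0.
  have -> : (S + p * q) ^+ 2 = S ^+ 2 + 2 * S * (p * q) + (p * q) ^+ 2 by ring.
  have -> : (X + p ^+ 2) * (Y + q ^+ 2) =
    X * Y + (X * q ^+ 2 + Y * p ^+ 2) + (p * q) ^+ 2 by ring.
  by rewrite lerD2r lerD.
rewrite -(@ler_pXn2r _ 2)// ?nnegrE ?mulr_ge0 ?l2_ge0//; last first.
  by apply: sumr_ge0 => i _; rewrite mulr_ge0 ?nrm_ge0.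
by rewrite exprMn !sqr_l2.
Qed.

Definition app a K x i : C := \sum_(j < K) a i j * x j.

Definition bform a N K y x : C := \sum_(i < N) y i * app a K x i.

Definition tr a i j : C := a j i.

Lemma bform_tr a N K y x : bform (tr a) N K y x = bform a K N x y.
Proof.
rewrite /bform /app; under eq_bigr => i _ do rewrite mulr_sumr.
rewrite exchange_big /=; apply: eq_bigr => j _; rewrite mulr_sumr.
by apply: eq_bigr => i _; rewrite /tr; ring.
Qed.

(* The sesquilinear forms are replaced by bilinear ones, as the bound is
   insensitive to conjugating the vectors. *)
Definition bounded_by a M :=
  0 <= M /\ forall N K y x, nrm (bform a N K y x) <= M * l2 N y * l2 K x.

(** Testing the form against the conjugate of [v], the image itself, produces the squared norm of
    [v], and one factor cancels. *)
Lemma bounded_app a M N K x : bounded_by a M -> l2 N (app a K x) <= M * l2 K x.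
Proof.
move=> [M0 aM]; set v := app a K x.
have := aM N K (fun i => Num.conj (v i)) x; rewrite l2_conj.
rewrite [bform _ _ _ _ _](_ : _ = (l2 N v ^+ 2)%:C); last first.
  by rewrite sqr_l2 rmorph_sum; apply: eq_bigr => i _; rewrite mulconj_nrm.
rewrite nrm_real ger0_norm ?sqr_ge0//.
have := l2_ge0 N v; rewrite le_eqVlt => /predU1P[<- _|v0].
  by rewrite mulr_ge0 ?l2_ge0.
by rewrite expr2 -mulrA mulrCA ler_pM2l.
Qed.

Lemma app_bounded a M : 0 <= M ->
  (forall N K x, l2 N (app a K x) <= M * l2 K x) -> bounded_by a M.
Proof.
move=> M0 aM; split=> // N K y x; apply: le_trans (cauchy_schwarz _ _ _) _.
by rewrite mulrAC [leRHS]mulrC ler_wpM2l ?l2_ge0.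
Qed.

Lemma bounded_tr a M : bounded_by a M -> bounded_by (tr a) M.
Proof. by move=> [M0 aM]; split=> // N K y x; rewrite bform_tr mulrAC. Qed.

Lemma bounded_le a M M' : bounded_by a M -> M <= M' -> bounded_by a M'.
Proof.
move=> [M0 aM] MM; split=> [|N K y x]; first exact: le_trans MM.
by apply: le_trans (aM _ _ _ _) _; rewrite !ler_wpM2r ?l2_ge0.
Qed.

Lemma bounded_col a M j N : bounded_by a M -> l2 N (fun i => a i j) <= M.
Proof.
move=> aM; have := @bounded_app a M N j.+1 (delta j) aM.
rewrite [app _ _ _](_ : _ = fun i => a i j); last first.
  by apply/funext => i; rewrite /app sum_deltar.
by move=> /le_trans; apply; rewrite ler_piMr ?l2_delta//; case: aM.
Qed.

Lemma bounded_row a M i N : bounded_by a M -> l2 N (a i) <= M.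
Proof. by move=> /bounded_tr/bounded_col; apply. Qed.

Lemma bounded_entry a M i j : bounded_by a M -> nrm (a i j) <= M.
Proof.
move=> /bounded_row => /(_ i j.+1); apply: le_trans.
rewrite -[leLHS]ger0_norm ?nrm_ge0// -sqrtr_sqr ler_sqrt ?sum_nrm2_ge0//.
by rewrite big_ord_recr lerDr sum_nrm2_ge0.
Qed.

Lemma nondecreasing_bounded_cauchy (u : nat -> R) B :
  (forall m n, (m <= n)%N -> u m <= u n) -> (forall n, u n <= B) ->
  forall e, 0 < e -> exists N, forall m n, (N <= m)%N -> (m <= n)%N ->
    u n - u m <= e.
Proof.
move=> um uB e e0.
have hs : has_sup (range u) by split; [exists (u 0%N), 0%N|exists B => _ [n _ <-]].
have [_ [N _ <-] hN] := sup_adherent e0 hs.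
exists N => m n Nm mn.
have := um _ _ Nm; have : u n <= sup (range u).
  by apply: sup_upper_bound => //; exists n.
lra.
Qed.

Definition mask K x i : C := if (i < K)%N then 0 else x i.

Lemma sum_mask K N (f : nat -> C) : (K <= N)%N ->
  \sum_(i < N) mask K f i = \sum_(i < N) f i - \sum_(i < K) f i.
Proof.
move=> KN; rewrite -(subnKC KN) !big_split_ord /=.
rewrite [X in X + _ = _]big1 ?add0r => [|i _]; last by rewrite /mask ltn_ord.
rewrite addrAC subrr add0r; apply: eq_bigr => i _.
by rewrite /mask ltnNge leq_addr.
Qed.

(** The partial sums of squares increase and are bounded, hence Cauchy; the resulting [K0] serves
    every cut-off [N] at once. *)
Lemma mask_tail x B : (forall N, l2 N x <= B) ->
  forall e, 0 < e -> exists K0, forall K N, (K0 <= K)%N -> l2 N (mask K x) <= e.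
Proof.
move=> xB e e0; pose u n := \sum_(i < n) nrm (x i) ^+ 2.
have um m n : (m <= n)%N -> u m <= u n.
  move=> mn; rewrite /u -(subnKC mn) big_split_ord lerDl /=.
  by rewrite sumr_ge0// => i _; exact: sqr_ge0.
have [||K0 HK] := @nondecreasing_bounded_cauchy u (B ^+ 2) um _ (e ^+ 2).
- move=> n; rewrite /u -sqr_l2 ler_pXn2r// nnegrE ?l2_ge0//.
  exact: le_trans (l2_ge0 n x) (xB n).
- exact: exprn_gt0.
exists K0 => K N K0K; apply: le_trans (l2_mono _ (leq_maxr K N)) _.
rewrite -[leRHS]ger0_norm ?(ltW e0)// -sqrtr_sqr ler_sqrt ?sqr_ge0//.
apply: le_trans (HK K (maxn K N) K0K (leq_maxl _ _)).
rewrite /u -(subnKC (leq_maxl K N)) !big_split_ord /= [X in _ <= X + _ - _](_ : _ = u K)//.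
rewrite addrAC subrr add0r big1 ?add0r => [|i _].
  by apply: ler_sum => i _; rewrite /mask ltnNge leq_addr.
by rewrite /mask ltn_ord nrm0 expr0n.
Qed.

Lemma app_mask a K L x i : (K <= L)%N ->
  app a L (mask K x) i = app a L x i - app a K x i.
Proof.
move=> KL; rewrite -(@sum_mask K L (fun j => a i j * x j))//.
by apply: eq_bigr => j _; rewrite /mask; case: ifP; rewrite ?mulr0.
Qed.

Lemma l2_summable_tends x y B B' :
  (forall N, l2 N x <= B) -> (forall N, l2 N y <= B') ->
  exists l, tends (fun K => \sum_(k < K) x k * y k) l.
Proof.
move=> xB yB; apply: Ccauchy_tends => e e0.
have B'0 : 0 <= B' by apply: le_trans (l2_ge0 0 y) (yB _).
have [|K0 HK] := @mask_tail x B xB (e / (B' + 1)).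
  by rewrite divr_gt0// ltr_wpDl.
exists K0; suff h m n : (K0 <= m)%N -> (m <= n)%N ->
    nrm (\sum_(k < n) x k * y k - \sum_(k < m) x k * y k) <= e.
  move=> m n Km Kn; case: (leqP m n) => mn; last by apply: h => //; exact: ltnW.
  by rewrite nrmBC; exact: h.
move=> Km mn; rewrite -(@sum_mask m n (fun k => x k * y k))//.
rewrite [X in nrm X](_ : _ = \sum_(k < n) mask m x k * y k); last first.
  by apply: eq_bigr => k _; rewrite /mask; case: ifP; rewrite ?mul0r.
apply: le_trans (cauchy_schwarz _ _ _) _.
apply: (@le_trans _ _ (e / (B' + 1) * B')).
  by apply: ler_pM; rewrite ?l2_ge0 ?HK.
by rewrite mulrAC ler_pdivrMr ?ltr_wpDl// ler_wpM2l ?ltW// ltrDl.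
Qed.

(** The [0] of [xget] is a default for divergent sums. Bounded factors never meet it: their rows and
    columns are square-summable, see [mulmatP]. *)
Definition mulmat a b i j : C :=
  xget 0 [set l | tends (fun K => \sum_(k < K) a i k * b k j) l].

Lemma mulmatP a b M M' i j : bounded_by a M -> bounded_by b M' ->
  tends (fun K => \sum_(k < K) a i k * b k j) (mulmat a b i j).
Proof.
move=> aM bM; have [|N|l hl] := @l2_summable_tends (a i) (fun k => b k j) M M'.
- by move=> N; exact: bounded_row aM.
- exact: bounded_col bM.
- by have := @xgetI C 0 [set l | tends _ l] l hl; apply.
Qed.

Lemma mulmat_eq a b M M' i j l : bounded_by a M -> bounded_by b M' ->
  tends (fun K => \sum_(k < K) a i k * b k j) l -> mulmat a b i j = l.
Proof. by move=> aM bM; apply: tends_uniq; exact: mulmatP aM bM. Qed.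

Lemma tendsMl (u : nat -> C) l c : tends u l -> tends (fun n => c * u n) (c * l).
Proof.
by apply: (@tends_lip _ _ _ _ (nrm c)) => s t; rewrite -mulrBr nrmM.
Qed.

Lemma tends_bform (u : nat -> nat -> nat -> C) a N K y x :
  (forall i j, tends (fun n => u n i j) (a i j)) ->
  tends (fun n => bform (u n) N K y x) (bform a N K y x).
Proof.
move=> ua; apply: tends_sum => i; apply: tendsMl; apply: tends_sum => j.
by under [X in tends X]eq_fun => n do rewrite mulrC; rewrite mulrC; exact: tendsMl.
Qed.

Lemma bounded_lim (u : nat -> nat -> nat -> C) a M :
  (forall i j, tends (fun n => u n i j) (a i j)) ->
  (forall n, bounded_by (u n) M) -> bounded_by a M.
Proof.
move=> ua uM; have [M0 _] := uM 0%N; split=> // N K y x.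
by apply: tends_le (tends_bform N K y x ua) => n; have [_] := uM n.
Qed.

Lemma bounded_mul a b M M' : bounded_by a M -> bounded_by b M' ->
  bounded_by (mulmat a b) (M * M').
Proof.
move=> aM bM; apply: (@bounded_lim (fun L i j => \sum_(l < L) a i l * b l j)).
  by move=> i j; exact: mulmatP aM bM.
have [M0 _] := aM; have [M'0 _] := bM.
move=> L; apply: app_bounded => [|N K x]; first exact: mulr_ge0.
rewrite [X in l2 N X](_ : _ = app a L (app b K x)).
  apply: le_trans (bounded_app _ _ _ aM) _.
  by rewrite -mulrA ler_wpM2l ?(bounded_app _ _ _ bM).
apply/funext => i; rewrite /app; under eq_bigr => j _ do rewrite mulr_suml.
rewrite exchange_big /=; apply: eq_bigr => l _; rewrite mulr_sumr.
by apply: eq_bigr => j _; rewrite mulrA.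
Qed.

(* Both sides are limits of the truncated double sums, uniformly so because
   the tails of row [i] of [a] and of column [j] of [c] are small. *)
Lemma mulmatA a b c M M' M'' :
  bounded_by a M -> bounded_by b M' -> bounded_by c M'' ->
  mulmat a (mulmat b c) = mulmat (mulmat a b) c.
Proof.
move=> aM bM cM; have abM := bounded_mul aM bM; have bcM := bounded_mul bM cM.
have [M0 _] := aM; have [M'0 _] := bM; have [M''0 _] := cM.
apply/funext => i; apply/funext => j.
have left : tends (fun K => \sum_(k < K) a i k * mulmat b c k j) (mulmat a (mulmat b c) i j).
  exact: mulmatP aM bcM.
apply: (@tends_uniq _ _ _ _ _ left).
have right : tends (fun K => \sum_(k < K) mulmat a b i k * c k j) (mulmat (mulmat a b) c i j).
  exact: mulmatP abM cM.
pose y := a i; pose x k := c k j.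
(* Tails below [e / 3 / B] absorb either constant, [M * M'] or [M' * M'']; the summand [1] keeps [B]
   positive. *)
pose B := M * M' + M' * M'' + 1.
have B0 : 0 < B by rewrite ltr_wpDl// addr_ge0 ?mulr_ge0.
have sl K : tends (fun L => bform b K L y x) (\sum_(k < K) a i k * mulmat b c k j).
  by apply: tends_sum => k; apply: tendsMl; exact: mulmatP bM cM.
have sr L : tends (fun K => bform b K L y x) (\sum_(l < L) mulmat a b i l * c l j).
  under [X in tends X]eq_fun => K do rewrite -bform_tr.
  apply: tends_sum => l; rewrite mulrC; apply: tendsMl.
  apply: tends_eventually (mulmatP i l aM bM); exists 0%N => K _.
  by apply: eq_bigr => k _; rewrite mulrC.
move=> e e0; have e3 : 0 < e / 3 / B by rewrite !divr_gt0.
have [K1 HK1] := @mask_tail y M (fun N => bounded_row i N aM) _ e3.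
have [K2 HK2] := @mask_tail x M'' (fun N => bounded_col j N cM) _ e3.
have [|K3 HK3] := right (e / 3); first by rewrite divr_gt0.
exists (maxn K1 (maxn K2 K3)) => n; rewrite !geq_max => /and3P[n1 n2 n3].
have tl : nrm (\sum_(k < n) a i k * mulmat b c k j - bform b n n y x) <= e / 3.
  apply: (@tends_le _ _ (fun L => bform b n (n + L) y x - bform b n n y x)) => [L|].
    rewrite /bform -sumrB; under eq_bigr => k _ do rewrite -mulrBr -app_mask ?leq_addr//.
    apply: le_trans (proj2 bM _ _ _ _) _.
    apply: (@le_trans _ _ (M' * M * (e / 3 / B))).
      by apply: ler_pM; rewrite ?mulr_ge0 ?l2_ge0 ?HK2// ler_wpM2l// (bounded_row _ _ aM).
    rewrite mulrA ler_pdivrMr// mulrC ler_wpM2l ?divr_ge0 ?(ltW e0)//.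
    by rewrite /B mulrC -addrA lerDl addr_ge0 ?mulr_ge0.
  apply: tendsD; last exact: tends_cst.
  move=> d d0; have [N HN] := sl n d d0; exists N => L NL.
  by apply: HN; rewrite (leq_trans NL)// leq_addl.
have tr' : nrm (\sum_(k < n) mulmat a b i k * c k j - bform b n n y x) <= e / 3.
  apply: (@tends_le _ _ (fun K => bform b (n + K) n y x - bform b n n y x)) => [K|].
    rewrite -!(bform_tr b) /bform -sumrB.
    under eq_bigr => k _ do rewrite -mulrBr -app_mask ?leq_addr//.
    apply: le_trans (proj2 (bounded_tr bM) _ _ _ _) _.
    apply: (@le_trans _ _ (M' * M'' * (e / 3 / B))).
      by apply: ler_pM; rewrite ?mulr_ge0 ?l2_ge0 ?HK1// ler_wpM2l// (bounded_col _ _ cM).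
    rewrite mulrA ler_pdivrMr// mulrC ler_wpM2l ?divr_ge0 ?(ltW e0)//.
    by rewrite /B addrAC lerDr addr_ge0 ?mulr_ge0.
  apply: tendsD; last exact: tends_cst.
  move=> d d0; have [N HN] := sr n d d0; exists N => L NL.
  by apply: HN; rewrite (leq_trans NL)// leq_addl.
have := HK3 n n3.
set f := \sum_(k < n) _; set g := \sum_(k < n) _ => hg.
have := nrm_tri f (bform b n n y x) (mulmat (mulmat a b) c i j).
have := nrm_tri (bform b n n y x) g (mulmat (mulmat a b) c i j).
have := nrmBC (bform b n n y x) g; have := nrmBC (bform b n n y x) f.
by move: tl tr' hg; rewrite -/f -/g; lra.
Qed.

Definition adj a i j : C := Num.conj (a j i).

Lemma bounded_adj a M : bounded_by a M -> bounded_by (adj a) M.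
Proof.
move=> /bounded_tr[M0 aM]; split=> // N K y x.
rewrite -nrm_conj -(l2_conj N) -(l2_conj K).
rewrite [X in nrm X](_ : _ =
  bform (tr a) N K (fun i => Num.conj (y i)) (fun j => Num.conj (x j)))//.
rewrite rmorph_sum; apply: eq_bigr => i _; rewrite rmorphM rmorph_sum.
by congr (_ * _); apply: eq_bigr => j _; rewrite /adj /tr rmorphM /= conjCK.
Qed.

Lemma tends_conj (u : nat -> C) l :
  tends u l -> tends (fun n => Num.conj (u n)) (Num.conj l).
Proof.
apply: (@tends_lip _ _ _ _ 1) => s t.
by rewrite -rmorphB nrm_conj mul1r.
Qed.

Lemma adj_mul a b M M' : bounded_by a M -> bounded_by b M' ->
  adj (mulmat a b) = mulmat (adj b) (adj a).
Proof.
move=> aM bM; apply/funext => i; apply/funext => j; apply/esym.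
apply: (mulmat_eq (bounded_adj bM) (bounded_adj aM)).
have := tends_conj (mulmatP j i aM bM); apply: tends_eventually.
exists 0%N => n _; rewrite rmorph_sum; apply: eq_bigr => k _.
by rewrite rmorphM mulrC.
Qed.

(** The hard half of the identity for the norm of [star a ** a]: the form of [mulmat (adj a) a] at
    the conjugate of [x] and [x] is the squared norm of [a] applied to [x]. Cutting the inner sum of
    the product off at [L] makes this exact, and [L] then tends to infinity. *)
Lemma bounded_adj_mul a M M' : bounded_by a M' ->
  bounded_by (mulmat (adj a) a) M -> bounded_by a (Num.sqrt M).
Proof.
move=> aM' [M0 aaM]; apply: app_bounded => [|N K x]; first exact: sqrtr_ge0.
rewrite -[l2 K x]ger0_norm ?l2_ge0// -sqrtr_sqr -sqrtrM//.
rewrite -[leLHS]ger0_norm ?l2_ge0// -sqrtr_sqr ler_sqrt ?mulr_ge0 ?sqr_ge0//.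
have := aaM K K (fun i => Num.conj (x i)) x; rewrite l2_conj -mulrA -expr2.
apply: le_trans.
pose u L : nat -> nat -> C := fun i j => \sum_(k < L) adj a i k * a k j.
have uL L : bform (u L) K K (fun i => Num.conj (x i)) x = (l2 L (app a K x) ^+ 2)%:C.
  rewrite sqr_l2 rmorph_sum /=; under [RHS]eq_bigr => k _ do rewrite -mulconj_nrm.
  rewrite /bform /app /u.
  under [LHS]eq_bigr => i _ do rewrite mulr_sumr.
  under [LHS]eq_bigr => i _ do under eq_bigr => j _ do rewrite mulr_suml mulr_sumr.
  under [RHS]eq_bigr => k _ do rewrite rmorph_sum big_distrlr /=.
  rewrite [RHS]exchange_big /=; apply: eq_bigr => i _.
  rewrite [RHS]exchange_big /=; apply: eq_bigr => j _.
  by apply: eq_bigr => k _; rewrite rmorphM /adj; ring.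
have ut : tends (fun L => bform (u L) K K (fun i => Num.conj (x i)) x)
    (bform (mulmat (adj a) a) K K (fun i => Num.conj (x i)) x).
  by apply: tends_bform => i j; exact: mulmatP (bounded_adj aM') aM'.
apply/ler_addgt0Pr => e e0; have [L HL] := ut e e0.
have NL := HL (maxn N L) (leq_maxr _ _).
have := nrmD (bform (mulmat (adj a) a) K K (fun i => Num.conj (x i)) x)
  (bform (u (maxn N L)) K K (fun i => Num.conj (x i)) x -
   bform (mulmat (adj a) a) K K (fun i => Num.conj (x i)) x).
rewrite [X in nrm X <= _]addrC subrK uL nrm_real ger0_norm ?sqr_ge0//.
rewrite -uL => h; have : l2 N (app a K x) ^+ 2 <= l2 (maxn N L) (app a K x) ^+ 2.
  by rewrite ler_pXn2r ?nnegrE ?l2_ge0// l2_mono// leq_maxl.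
by lra.
all: exact: l2_ge0.
Qed.

End InfiniteMatrices.

(** * Bounded matrices as a C*-algebra *)

Section MatrixAlgebra.
Variable R : realType.
Local Notation C := R[i].

(* The bounded operators on l^2, given by their matrices. *)
Record bmat := Bmat {
  bmat_val :> nat -> nat -> C;
  bmat_bounded : exists M, bounded_by bmat_val M
}.

HB.instance Definition _ := gen_eqMixin bmat.
HB.instance Definition _ := gen_choiceMixin bmat.

Lemma bmat_inj (a b : bmat) : (forall i j, a i j = b i j) -> a = b.
Proof.
case: a b => a ha [b hb] /= ab.
have E : a = b by apply/funext => i; apply/funext => j.
by rewrite {}E in ha *; congr Bmat; exact: Prop_irrelevance.
Qed.

Lemma bounded_add (a b : nat -> nat -> C) M M' :
  bounded_by a M -> bounded_by b M' -> bounded_by (fun i j => a i j + b i j) (M + M').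
Proof.
move=> [M0 aM] [M'0 bM]; split=> [|N K y x]; first exact: addr_ge0.
rewrite [X in nrm X](_ : _ = bform a N K y x + bform b N K y x).
  by apply: le_trans (nrmD _ _) _; rewrite !mulrDl lerD.
rewrite /bform -big_split /=; apply: eq_bigr => i _.
rewrite -mulrDr /app -big_split /=; congr (_ * _).
by apply: eq_bigr => j _; rewrite mulrDl.
Qed.

Lemma bounded_scale (a : nat -> nat -> C) c M :
  bounded_by a M -> bounded_by (fun i j => c * a i j) (nrm c * M).
Proof.
move=> [M0 aM]; split=> [|N K y x]; first by rewrite mulr_ge0 ?nrm_ge0.
rewrite [X in nrm X](_ : _ = c * bform a N K y x).
  by rewrite nrmM -!mulrA ler_wpM2l ?nrm_ge0// mulrA.
rewrite /bform mulr_sumr; apply: eq_bigr => i _.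
rewrite [RHS]mulrCA; congr (y i * _); rewrite /app mulr_sumr.
by apply: eq_bigr => j _; rewrite mulrA.
Qed.

Lemma bounded_zero : bounded_by (fun _ _ => 0 : C) 0.
Proof.
split=> // N K y x; rewrite [bform _ _ _ _ _]big1 ?nrm0 ?mul0r// => i _.
by rewrite [app _ _ _ _]big1 ?mulr0// => j _; rewrite mul0r.
Qed.

Definition bmat0 := Bmat (ex_intro _ 0 bounded_zero).

Lemma bmat_add_subproof (a b : bmat) : exists M, bounded_by (fun i j => a i j + b i j) M.
Proof.
have [M aM] := bmat_bounded a; have [M' bM] := bmat_bounded b.
by exists (M + M'); exact: bounded_add.
Qed.
Definition bmat_add (a b : bmat) := Bmat (bmat_add_subproof a b).

Lemma bmat_scale_subproof c (a : bmat) : exists M, bounded_by (fun i j => c * a i j) M.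
Proof.
by have [M aM] := bmat_bounded a; exists (nrm c * M); exact: bounded_scale.
Qed.
Definition bmat_scale c (a : bmat) := Bmat (bmat_scale_subproof c a).

Definition bmat_opp (a : bmat) := bmat_scale (-1) a.

Lemma bmat_mul_subproof (a b : bmat) : exists M, bounded_by (mulmat a b) M.
Proof.
have [M aM] := bmat_bounded a; have [M' bM] := bmat_bounded b.
by exists (M * M'); exact: bounded_mul.
Qed.
Definition bmat_mul (a b : bmat) := Bmat (bmat_mul_subproof a b).

Lemma bmat_adj_subproof (a : bmat) : exists M, bounded_by (adj a) M.
Proof.
by have [M aM] := bmat_bounded a; exists M; exact: bounded_adj.
Qed.
Definition bmat_adj (a : bmat) := Bmat (bmat_adj_subproof a).

Lemma bmat_addA : associative bmat_add.
Proof. by move=> a b c; apply: bmat_inj => i j /=; rewrite addrA. Qed.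

Lemma bmat_addC : commutative bmat_add.
Proof. by move=> a b; apply: bmat_inj => i j /=; rewrite addrC. Qed.

Lemma bmat_add0 : left_id bmat0 bmat_add.
Proof. by move=> a; apply: bmat_inj => i j /=; rewrite add0r. Qed.

Lemma bmat_addN : left_inverse bmat0 bmat_opp bmat_add.
Proof. by move=> a; apply: bmat_inj => i j /=; rewrite mulN1r addNr. Qed.

HB.instance Definition _ :=
  GRing.isZmodule.Build bmat bmat_addA bmat_addC bmat_add0 bmat_addN.

Lemma bmat_scaleA (c d : C) (a : bmat) : bmat_scale c (bmat_scale d a) = bmat_scale (c * d) a.
Proof. by apply: bmat_inj => i j /=; rewrite mulrA. Qed.

Lemma bmat_scale1 : left_id 1 bmat_scale.
Proof. by move=> a; apply: bmat_inj => i j /=; rewrite mul1r. Qed.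

Lemma bmat_scaleDr : right_distributive bmat_scale +%R.
Proof. by move=> c a b; apply: bmat_inj => i j /=; rewrite mulrDr. Qed.

Lemma bmat_scaleDl (a : bmat) : {morph (fun c => bmat_scale c a) : c d / c + d}.
Proof. by move=> c d; apply: bmat_inj => i j /=; rewrite mulrDl. Qed.

HB.instance Definition _ := GRing.Zmodule_isLmodule.Build C bmat
  bmat_scaleA bmat_scale1 bmat_scaleDr bmat_scaleDl.

Definition bmat_norm (a : bmat) : R := inf [set M | bounded_by a M].

Lemma bmat_has_inf (a : bmat) : has_inf [set M | bounded_by a M].
Proof.
split; first by have [M aM] := bmat_bounded a; exists M.
by exists 0 => M [].
Qed.

Lemma bmat_norm_le (a : bmat) M : bounded_by a M -> bmat_norm a <= M.
Proof. by move=> aM; apply: ge_inf => //; case: (bmat_has_inf a). Qed.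

Lemma bmat_norm_bounded (a : bmat) : bounded_by a (bmat_norm a).
Proof.
have [ne lb] := bmat_has_inf a.
split=> [|N K y x]; first by apply: lb_le_inf => // M [].
rewrite -mulrA; set t := l2 N y * l2 K x.
have t0 : 0 <= t by rewrite mulr_ge0 ?l2_ge0.
have aM M : bounded_by a M -> nrm (bform a N K y x) <= M * t.
  by case=> _ /(_ N K y x); rewrite -mulrA.
apply/ler_addgt0Pr => e e0.
(* The slack is divided by [t + 1] because [t] may vanish. *)
have [|M aM' Me] := @inf_adherent _ _ (e / (t + 1)) _ (bmat_has_inf a).
  by rewrite divr_gt0// ltr_wpDl.
apply: le_trans (aM _ aM') _; apply: (@le_trans _ _ ((bmat_norm a + e / (t + 1)) * t)).
  by rewrite ler_wpM2r// ltW.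
rewrite mulrDl lerD2l mulrAC ler_pdivrMr ?ltr_wpDl//.
by rewrite ler_wpM2l ?ltW// ltrDl.
Qed.

Lemma bmat_norm_ge0 a : 0 <= bmat_norm a.
Proof. by case: (bmat_norm_bounded a). Qed.

Lemma bmat_normD (a b : bmat) :
  (bmat_norm (a + b))%:C <= (bmat_norm a)%:C + (bmat_norm b)%:C.
Proof.
rewrite -rmorphD lecR; apply: bmat_norm_le.
by apply: bounded_add; exact: bmat_norm_bounded.
Qed.

Lemma bmat_norm0 : bmat_norm 0 = 0.
Proof.
by apply/eqP; rewrite eq_le bmat_norm_ge0 andbT; exact/bmat_norm_le/bounded_zero.
Qed.

Lemma bmat_norm_scale_le c a : bmat_norm (c *: a) <= nrm c * bmat_norm a.
Proof. exact/bmat_norm_le/bounded_scale/bmat_norm_bounded. Qed.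

Lemma bmat_normZ (c : C) (a : bmat) :
  (bmat_norm (c *: a))%:C = `|c| * (bmat_norm a)%:C.
Proof.
rewrite nrmE -rmorphM; congr _%:C.
have [->|c0] := eqVneq c 0; first by rewrite scale0r nrm0 mul0r bmat_norm0.
apply/eqP; rewrite eq_le bmat_norm_scale_le /=.
have c0' : 0 < nrm c.
  rewrite lt_def nrm_ge0 andbT; apply: contraNneq c0 => c0.
  by apply/eqP/nrm0_eq0.
rewrite -ler_pdivlMl//; apply: le_trans (_ : bmat_norm (c^-1 *: (c *: a)) <= _).
  by rewrite scalerA mulVf// scale1r.
apply: le_trans (bmat_norm_scale_le _ _) _.
suff -> : nrm c^-1 = (nrm c)^-1 by [].
by apply: (mulfI (lt0r_neq0 c0')); rewrite -nrmM !divff ?nrm1// lt0r_neq0.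
Qed.

Lemma bmat_norm_eq0 (a : bmat) : (bmat_norm a)%:C = 0 :> C -> a = 0.
Proof.
move=> /complexI a0; apply: bmat_inj => i j /=; apply: nrm0_eq0.
apply/eqP; rewrite eq_le nrm_ge0 andbT -a0.
exact/bounded_entry/bmat_norm_bounded.
Qed.

HB.instance Definition _ := Lmodule_isNormed.Build C bmat
  bmat_normD bmat_normZ bmat_norm_eq0.

Lemma bmat_nrm (a : bmat) : nrm a = bmat_norm a.
Proof. by []. Qed.

(** Entries are dominated by the norm, so they converge. The uniform bounds on the differences
    survive entrywise limits by [bounded_lim], which gives both boundedness of the limit and
    convergence in norm. *)
Lemma bmat_seq_complete (u : nat -> bmat) : cauchy_seq u -> exists l, tends u l.
Proof.
move=> uc.
have ent (a b : bmat) i j : nrm (a i j - b i j) <= nrm (a - b).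
  rewrite bmat_nrm -[X in nrm X](_ : (a - b) i j = _) /=; last by rewrite mulN1r.
  exact: (bounded_entry i j (bmat_norm_bounded (a - b))).
have /choice[l0 Hl0] ij : exists l, tends (fun n => u n ij.1 ij.2) l.
  apply: Ccauchy_tends => e /uc[N HN]; exists N => m n Nm Nn.
  by apply: le_trans (HN m n Nm Nn); exact: ent.
pose l i j := l0 (i, j).
have Hl i j : tends (fun n => u n i j) (l i j) := Hl0 (i, j).
have bl n e N : (forall m, (N <= m)%N -> nrm (u n - u m) <= e) ->
    bounded_by (fun i j => u n i j + - 1 * l i j) e.
  move=> He.
  apply: (@bounded_lim _ (fun m i j => u n i j + -1 * u (m + N)%N i j)) => [i j|m].
    apply: tendsD; first exact: tends_cst.
    have sh : tends (fun m => u (m + N)%N i j) (l i j).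
      move=> d d0; have [M HM] := Hl i j d d0; exists M => k Mk.
      by apply: HM; rewrite (leq_trans Mk)// leq_addr.
    exact: (tendsMl (-1) sh).
  apply: bounded_le (He (m + N)%N (leq_addl _ _)).
  exact: (bmat_norm_bounded (u n - u (m + N)%N)).
have lb : exists M, bounded_by l M.
  have [N HN] := uc 1 ltr01; have [M uM] := bmat_bounded (u N).
  have := bl N 1 N (fun m => HN N m (leqnn N)) => /(bounded_scale (-1)) dM.
  exists (M + nrm (-1 : C) * 1).
  rewrite [l](_ : _ = fun i j => u N i j + -1 * (u N i j + -1 * l i j)).
    exact: bounded_add.
  by apply/funext => i; apply/funext => j; ring.
exists (Bmat lb) => e /uc[N HN]; exists N => n Nn.
by apply/bmat_norm_le/bl => m; exact: HN.
Qed.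

HB.instance Definition _ :=
  Uniform_isComplete.Build bmat (@seq_complete R bmat bmat_seq_complete).

Lemma bmat_mulA (a b c : bmat) : bmat_mul a (bmat_mul b c) = bmat_mul (bmat_mul a b) c.
Proof.
have [M aM] := bmat_bounded a; have [M' bM] := bmat_bounded b.
have [M'' cM] := bmat_bounded c.
by apply: bmat_inj => i j /=; rewrite (mulmatA aM bM cM).
Qed.

Lemma bmat_mulP (a b : bmat) i j :
  tends (fun K => \sum_(k < K) a i k * b k j) (bmat_mul a b i j).
Proof.
have [M aM] := bmat_bounded a; have [M' bM] := bmat_bounded b.
exact: mulmatP aM bM.
Qed.

Lemma bmat_mul_eq (a b c : bmat) :
  (forall i j, tends (fun K => \sum_(k < K) a i k * b k j) (c i j)) ->
  bmat_mul a b = c.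
Proof.
by move=> h; apply: bmat_inj => i j; apply: tends_uniq (h i j); exact: bmat_mulP.
Qed.

Lemma bmat_mulDl (a b c : bmat) : bmat_mul (a + b) c = bmat_mul a c + bmat_mul b c.
Proof.
apply: bmat_mul_eq => i j.
apply: tends_eventually (tendsD (bmat_mulP a c i j) (bmat_mulP b c i j)).
exists 0%N => n _; rewrite -big_split /=; apply: eq_bigr => k _.
by rewrite mulrDl.
Qed.

Lemma bmat_mulDr (a b c : bmat) : bmat_mul a (b + c) = bmat_mul a b + bmat_mul a c.
Proof.
apply: bmat_mul_eq => i j.
apply: tends_eventually (tendsD (bmat_mulP a b i j) (bmat_mulP a c i j)).
exists 0%N => n _; rewrite -big_split /=; apply: eq_bigr => k _.
by rewrite mulrDr.
Qed.

Lemma bmat_mulZl (c : C) (a b : bmat) : bmat_mul (c *: a) b = c *: bmat_mul a b.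
Proof.
apply: bmat_mul_eq => i j.
apply: tends_eventually (tendsMl c (bmat_mulP a b i j)).
exists 0%N => n _; rewrite mulr_sumr; apply: eq_bigr => k _.
by rewrite mulrA.
Qed.

Lemma bmat_mulZr (c : C) (a b : bmat) : bmat_mul a (c *: b) = c *: bmat_mul a b.
Proof.
apply: bmat_mul_eq => i j.
apply: tends_eventually (tendsMl c (bmat_mulP a b i j)).
exists 0%N => n _; rewrite mulr_sumr; apply: eq_bigr => k _.
by rewrite mulrCA.
Qed.

Lemma bmat_adjK (a : bmat) : bmat_adj (bmat_adj a) = a.
Proof. by apply: bmat_inj => i j; rewrite /= /adj conjCK. Qed.

Lemma bmat_adjD (a b : bmat) : bmat_adj (a + b) = bmat_adj a + bmat_adj b.
Proof. by apply: bmat_inj => i j; rewrite /= /adj /= rmorphD. Qed.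

Lemma bmat_adjZ (c : C) (a : bmat) : bmat_adj (c *: a) = Num.conj c *: bmat_adj a.
Proof. by apply: bmat_inj => i j; rewrite /= /adj /= rmorphM. Qed.

Lemma bmat_adjM (a b : bmat) : bmat_adj (bmat_mul a b) = bmat_mul (bmat_adj b) (bmat_adj a).
Proof.
have [M aM] := bmat_bounded a; have [M' bM] := bmat_bounded b.
by apply: bmat_inj => i j; rewrite /= (adj_mul aM bM).
Qed.

Lemma bmat_normM (a b : bmat) : `|bmat_mul a b| <= `|a| * `|b|.
Proof.
rewrite !nrmE -rmorphM lecR; apply: bmat_norm_le.
by apply: bounded_mul; exact: bmat_norm_bounded.
Qed.

Lemma bmat_norm_adj (a : bmat) : bmat_norm (bmat_adj a) = bmat_norm a.
Proof.
have le b : bmat_norm (bmat_adj b) <= bmat_norm b.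
  exact/bmat_norm_le/bounded_adj/bmat_norm_bounded.
by apply/eqP; rewrite eq_le le -{1}[a]bmat_adjK le.
Qed.

Lemma bmat_cstar (a : bmat) : `|bmat_mul (bmat_adj a) a| = `|a| ^+ 2.
Proof.
rewrite !nrmE -rmorphXn; congr _%:C; apply/eqP; rewrite eq_le; apply/andP; split.
  have := bmat_normM (bmat_adj a) a; rewrite !nrmE -rmorphM lecR !bmat_nrm.
  by rewrite bmat_norm_adj expr2.
rewrite !bmat_nrm -[leRHS]sqr_sqrtr ?bmat_norm_ge0//.
rewrite ler_pXn2r ?nnegrE ?sqrtr_ge0 ?bmat_norm_ge0//.
apply/bmat_norm_le/(bounded_adj_mul (bmat_norm_bounded a)).
exact: (bmat_norm_bounded (bmat_mul _ _)).
Qed.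

HB.instance Definition _ := isCStarAlgebra.Build R bmat
  bmat_mulA bmat_mulDl bmat_mulDr bmat_mulZl bmat_mulZr
  bmat_adjK bmat_adjD bmat_adjZ bmat_adjM bmat_normM bmat_cstar.

End MatrixAlgebra.

(** * C*-algebras *)

Section CStarBasics.
Variables (R : realType) (A : cstarAlgType R).
Implicit Types x y z : A.

Lemma cmul0l x : 0 ** x = 0.
Proof. by apply: (addrI (0 ** x)); rewrite -cmulDl !addr0. Qed.

Lemma cmul0r x : x ** 0 = 0.
Proof. by apply: (addrI (x ** 0)); rewrite -cmulDr !addr0. Qed.

Lemma cmulNl x y : (- x) ** y = - (x ** y).
Proof. by apply/eqP; rewrite -addr_eq0 -cmulDl addNr cmul0l. Qed.

Lemma cmulNr x y : x ** (- y) = - (x ** y).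
Proof. by apply/eqP; rewrite -addr_eq0 -cmulDr addNr cmul0r. Qed.

Lemma cmulBl x y z : (x - y) ** z = x ** z - y ** z.
Proof. by rewrite cmulDl cmulNl. Qed.

Lemma cmulBr x y z : x ** (y - z) = x ** y - x ** z.
Proof. by rewrite cmulDr cmulNr. Qed.

Lemma star0 : star (0 : A) = 0.
Proof. by apply: (addrI (star (0 : A))); rewrite -starD !addr0. Qed.

Lemma starN x : star (- x) = - star x.
Proof. by rewrite -scaleN1r starZ rmorphN1 scaleN1r. Qed.

Lemma starB x y : star (x - y) = star x - star y.
Proof. by rewrite starD starN. Qed.

Lemma cmul_suml I (s : seq I) (Q : pred I) (F : I -> A) x :
  (\sum_(i <- s | Q i) F i) ** x = \sum_(i <- s | Q i) F i ** x.
Proof.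
by elim/big_rec2: _ => [|i y z _ <-]; [rewrite cmul0l|rewrite cmulDl].
Qed.

Lemma cmul_sumr I (s : seq I) (Q : pred I) (F : I -> A) x :
  x ** (\sum_(i <- s | Q i) F i) = \sum_(i <- s | Q i) x ** F i.
Proof.
by elim/big_rec2: _ => [|i y z _ <-]; [rewrite cmul0r|rewrite cmulDr].
Qed.

Lemma star_sum I (s : seq I) (Q : pred I) (F : I -> A) :
  star (\sum_(i <- s | Q i) F i) = \sum_(i <- s | Q i) star (F i).
Proof. by elim/big_rec2: _ => [|i y z _ <-]; [rewrite star0|rewrite starD]. Qed.

Lemma nrm_cmul x y : nrm (x ** y) <= nrm x * nrm y.
Proof. by rewrite -lecR rmorphM /= -!nrmE cnormM. Qed.

Lemma nrm_star_mul x : nrm (star x ** x) = nrm x ^+ 2.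
Proof. by apply: (@complexI R); rewrite rmorphXn /= -!nrmE cnorm_star. Qed.

Lemma nrm_star x : nrm (star x) = nrm x.
Proof.
have le y : nrm y <= nrm (star y).
  have := nrm_ge0 y; rewrite le_eqVlt => /predU1P[<-|y0]; first exact: nrm_ge0.
  by rewrite -(ler_pM2r y0) -expr2 -nrm_star_mul nrm_cmul.
apply/eqP; rewrite eq_le le andbT.
by have := le (star x); rewrite starK.
Qed.

Lemma nrm_mul_star x : nrm (x ** star x) = nrm x ^+ 2.
Proof. by rewrite -nrm_star -[nrm x]nrm_star -nrm_star_mul starM starK. Qed.

Lemma star_mul_eq0 x : star x ** x = 0 -> x = 0.
Proof.
move=> x0; apply: nrm0_eq0; have := nrm_star_mul x.
by rewrite x0 nrm0 => /esym/eqP; rewrite expf_eq0 => /eqP.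
Qed.

Lemma nrm_projection x : is_projection x -> nrm x <= 1.
Proof.
move=> [xx sx]; have := nrm_star_mul x; rewrite sx xx => E.
have := nrm_ge0 x; rewrite le_eqVlt => /predU1P[<-//|x0].
by rewrite -(ler_pM2r x0) -expr2 -E mul1r.
Qed.

Lemma tends_cmull (u : nat -> A) l x :
  tends u l -> tends (fun n => x ** u n) (x ** l).
Proof.
by apply: (@tends_lip _ _ _ _ (nrm x)) => s t; rewrite -cmulBr nrm_cmul.
Qed.

Lemma tends_cmulr (u : nat -> A) l x :
  tends u l -> tends (fun n => u n ** x) (l ** x).
Proof.
by apply: (@tends_lip _ _ _ (fun y => y ** x) (nrm x)) => s t; rewrite -cmulBl mulrC nrm_cmul.
Qed.

Lemma tends_star (u : nat -> A) l :
  tends u l -> tends (fun n => star (u n)) (star l).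
Proof.
by apply: (@tends_lip _ _ _ _ 1) => s t; rewrite -starB nrm_star mul1r.
Qed.

Lemma tends_scale (u : nat -> A) l (c : R[i]) :
  tends u l -> tends (fun n => c *: u n) (c *: l).
Proof.
by apply: (@tends_lip _ _ _ _ (nrm c)) => s t; rewrite -scalerBr nrmZ.
Qed.

(* With [b = 1 - sqrt (1 - a^2)], the fixed point of a contraction. *)
Lemma one_minus_sqrt (a : A) : star a = a -> nrm a < 1 ->
  exists b : A, [/\ star b = b, a ** b = b ** a & a ** a = b + b - b ** b].
Proof.
move=> sa a1; pose t := nrm a ^+ 2; pose rho := 1 - Num.sqrt (1 - t).
have t0 : 0 <= t by exact: sqr_ge0.
have t1 : 0 < 1 - t by rewrite subr_gt0 expr_lt1// nrm_ge0.
have s0 : 0 < Num.sqrt (1 - t) by rewrite sqrtr_gt0.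
have s2 : Num.sqrt (1 - t) ^+ 2 = 1 - t by rewrite sqr_sqrtr// ltW.
have s1 : Num.sqrt (1 - t) <= 1.
  by rewrite -[leRHS]sqrtr1 ler_sqrt// gerBl.
have rho0 : 0 <= rho by rewrite subr_ge0.
have rho1 : rho < 1 by rewrite gtrBl.
(* [rho] is the smaller root of [s = (t + s^2) / 2]: the map [f] below preserves the ball of radius
   [rho] and contracts it by the factor [rho < 1]. *)
have rhoE : 2^-1 * (t + rho ^+ 2) = rho.
  by rewrite /rho sqrrB s2; field.
pose f x : A := (2^-1)%:C *: (a ** a + x ** x).
have half0 : nrm ((2^-1)%:C : R[i]) = 2^-1 by rewrite nrm_real ger0_norm.
have fball x : nrm x <= rho -> nrm (f x) <= rho.
  move=> xr; rewrite nrmZ half0 -[leRHS]rhoE ler_wpM2l//.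
  apply: le_trans (nrmD _ _) _; apply: lerD.
    by rewrite -{1}sa nrm_star_mul.
  by apply: le_trans (nrm_cmul _ _) _; rewrite expr2 ler_pM ?nrm_ge0.
have flip x y : nrm x <= rho -> nrm y <= rho -> nrm (f x - f y) <= rho * nrm (x - y).
  move=> xr yr; rewrite -scalerBr nrmZ half0.
  have -> : a ** a + x ** x - (a ** a + y ** y) = x ** (x - y) + (x - y) ** y.
    rewrite cmulBr cmulBl opprD addrACA subrr add0r.
    by rewrite addrA subrK.
  rewrite ler_pdivrMl//; apply: le_trans (nrmD _ _) _.
  have := nrm_cmul x (x - y); have := nrm_cmul (x - y) y.
  have := ler_wpM2r (nrm_ge0 (x - y)) xr; have := ler_wpM2r (nrm_ge0 (x - y)) yr.
  by rewrite (mulrC _ (nrm y)); lra.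
pose u n : A := iter n f 0.
have ur n : nrm (u n) <= rho.
  by elim: n => [|n IH]; [rewrite /u /= nrm0|exact: fball].
have dist n k : nrm (u (n + k)%N - u n) <= rho ^+ n.
  elim: n => [|n IH]; first by rewrite add0n subr0 expr0 (le_trans (ur _))// ltW.
  rewrite addSn exprS; apply: le_trans (flip _ _ (ur _) (ur _)) _.
  exact: ler_wpM2l.
have small e : 0 < e -> exists N, rho ^+ N <= e.
  move=> e0; have /cvgrPdist_le : rho ^+ n @[n --> \oo] --> (0 : R).
    by apply: cvg_expr; rewrite ger0_norm.
  move=> /(_ e e0)[N _ /(_ N (leqnn N))]; rewrite /= sub0r normrN.
  by rewrite ger0_norm ?exprn_ge0//; exists N.
have uc : cauchy_seq u.
  move=> e e0; have [|N HN] := small (e / 2); first lra.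
  exists N => m n Nm Nn; have := dist N (m - N)%N; have := dist N (n - N)%N.
  rewrite !subnKC//; have := nrm_tri (u N) (u m) (u n).
  by rewrite (nrmBC (u N) (u n)); lra.
have [b ub] := cauchy_tends uc.
have br : nrm b <= rho by exact: tends_le ub.
have ub1 : tends (fun n => u n.+1) b.
  by move=> e /ub[N HN]; exists N => n Nn; apply: HN; rewrite leqW.
have fb : f b = b.
  apply: tends_uniq ub1 => e /ub[N HN]; exists N => n /HN; apply: le_trans.
  by apply: le_trans (flip _ _ (ur _) br) _; rewrite ler_piMl ?nrm_ge0// ltW.
exists b; split.
- apply: (tends_uniq (tends_star ub)); apply: tends_eventually ub.
  exists 0%N => n _; elim: n => [|n IH]; first by rewrite /u /= star0.
  by rewrite /u iterS -/(u n) {2}/f starZ starD !starM sa -IH conj_real.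
- apply: (tends_uniq (tends_cmull a ub)); apply: tends_eventually (tends_cmulr a ub).
  exists 0%N => n _; elim: n => [|n IH]; first by rewrite /u /= cmul0l cmul0r.
  rewrite /u /= -/(u n) /f cmulZl cmulZr cmulDl cmulDr.
  rewrite [a ** (a ** a)]cmulA; congr (_ *: (_ + _)).
  by rewrite -[LHS]cmulA IH cmulA IH -cmulA.
- rewrite -{1 2}fb /f -scalerDl -rmorphD /=.
  have -> : 2^-1 + 2^-1 = 1 :> R by lra.
  by rewrite scale1r addrK.
Qed.

End CStarBasics.

(** * Contractivity of star-homomorphisms *)

Section Contractive.
Variables (R : realType) (A B : cstarAlgType R) (phi : A -> B).
Hypothesis hphi : star_hom phi.

Lemma star_homD x y : phi (x + y) = phi x + phi y.
Proof. by case: hphi => /(_ 1 x y I I); rewrite !scale1r. Qed.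

Lemma star_hom0 : phi 0 = 0.
Proof. by apply: (addrI (phi 0)); rewrite -star_homD !addr0. Qed.

Lemma star_homZ c x : phi (c *: x) = c *: phi x.
Proof. by case: hphi => /(_ c x 0 I I); rewrite star_hom0 !addr0. Qed.

Lemma star_homN x : phi (- x) = - phi x.
Proof. by rewrite -scaleN1r star_homZ scaleN1r. Qed.

Lemma star_homB x y : phi (x - y) = phi x - phi y.
Proof. by rewrite star_homD star_homN. Qed.

Lemma star_homM x y : phi (x ** y) = phi x ** phi y.
Proof. by case: hphi => _ /(_ x y I I). Qed.

Lemma star_hom_star x : phi (star x) = star (phi x).
Proof. by case: hphi => _ _ /(_ x I). Qed.

Lemma star_hom_sum I (s : seq I) (Q : pred I) (F : I -> A) :
  phi (\sum_(i <- s | Q i) F i) = \sum_(i <- s | Q i) phi (F i).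
Proof.
by elim/big_rec2: _ => [|i y z _ <-]; [rewrite star_hom0|rewrite star_homD].
Qed.

(* [al + c (1 - be)] is a unitary of the unitization; it acts on [B] as an
   isometry. *)
Lemma unitary_action (c : R[i]) (al be y : B) :
  Num.conj c = - c -> c * c = -1 -> star al = al -> star be = be ->
  al ** be = be ** al -> al ** al = be + be - be ** be ->
  nrm (al ** y + c *: (y - be ** y)) = nrm y.
Proof.
move=> cc c2 sal sbe comm sq; set X := _ + _.
suff E : star X ** X = star y ** y.
  apply/eqP; rewrite -(@eqrXn2 _ 2) ?nrm_ge0//.
  by rewrite -!nrm_star_mul E.
set z := y - be ** y in X *.
have sz : star z = star y - star y ** be by rewrite starB starM sbe.
have -> : star X = star y ** al - c *: star z.
  by rewrite starD starZ starM sal cc scaleNr.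
have h1 : star z ** (al ** y) = star y ** al ** z.
  rewrite sz cmulBl /z cmulBr !cmulA; congr (_ - _).
  by rewrite -[star y ** be ** al]cmulA -comm !cmulA.
have h2 : star y ** al ** (al ** y) + star z ** z = star y ** y.
  have -> : star y ** al ** (al ** y) = star y ** (al ** al) ** y by rewrite !cmulA.
  have -> : star y ** (al ** al) ** y =
      star y ** be ** y + (star y ** be ** y - star y ** be ** be ** y).
    by rewrite sq cmulBr cmulDr cmulBl cmulDl !cmulA addrA.
  have -> : star z ** z =
      star y ** y - (star y ** be ** y + (star y ** be ** y - star y ** be ** be ** y)).
    by rewrite sz /z cmulBl !cmulBr !cmulA -addrA -opprD.
  by rewrite addrC subrK.
rewrite /X cmulDr !cmulBl !cmulZl !cmulZr scalerA c2 h1.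
by rewrite addrA subrK scaleN1r opprK h2.
Qed.

(** No spectral theory is needed: a self-adjoint [a] of norm below 1 is half the sum of the
    unitaries [a + i sqrt (1 - a^2)] and [a - i sqrt (1 - a^2)], and [phi] carries the relations
    between [a] and [b = 1 - sqrt (1 - a^2)] to its target. Multiplication by [phi a] is therefore
    contractive, and applying it to [phi a] itself bounds its norm by 1. Scaling and the identity
    for [star x ** x] give the general case. *)
Lemma star_hom_contractive x : nrm (phi x) <= nrm x.
Proof.
have unit_ball a : star a = a -> nrm a < 1 -> nrm (phi a) <= 1.
  move=> sa a1; have [b [sb comm sq]] := one_minus_sqrt sa a1.
  have sal : star (phi a) = phi a by rewrite -star_hom_star sa.
  have sbe : star (phi b) = phi b by rewrite -star_hom_star sb.
  have comm' : phi a ** phi b = phi b ** phi a by rewrite -!star_homM comm.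
  have sq' : phi a ** phi a = phi b + phi b - phi b ** phi b.
    by rewrite -!star_homM sq star_homB star_homD.
  have ii : 'i%C * 'i%C = -1 :> R[i] by rewrite -expr2 sqr_i.
  have ci : Num.conj 'i%C = - 'i%C :> R[i].
    by apply/eqP; rewrite eq_complex /= oppr0 !eqxx.
  have act y : nrm (phi a ** y) <= nrm y.
    have cN : Num.conj (- 'i%C) = - - 'i%C :> R[i].
      by apply/eqP; rewrite eq_complex /= ?oppr0 ?opprK !eqxx.
    have iN : - 'i%C * - 'i%C = -1 :> R[i] by rewrite mulrNN.
    have hp := unitary_action y ci ii sal sbe comm' sq'.
    have hm := unitary_action y cN iN sal sbe comm' sq'.
    have := nrmD (phi a ** y + 'i%C *: (y - phi b ** y))
      (phi a ** y + (- 'i%C) *: (y - phi b ** y)).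
    rewrite hp hm addrACA -scalerDl subrr scale0r addr0.
    rewrite -[X in nrm (X + _)]scale1r -[X in nrm (_ + X)]scale1r -scalerDl.
    by rewrite nrmZ -(rmorphD (real_complex R) 1 1) nrm_real ger0_norm; lra.
  have := act (phi a); rewrite -{1}sal nrm_star_mul.
  have := nrm_ge0 (phi a); rewrite le_eqVlt => /predU1P[<-//|a0].
  by rewrite expr2 ger_pMl.
have selfadj a : star a = a -> nrm (phi a) <= nrm a.
  move=> sa; apply/ler_addgt0Pr => e e0.
  have s0 : 0 < nrm a + e by rewrite ltr_wpDl ?nrm_ge0.
  have := unit_ball ((nrm a + e)^-1%:C *: a).
  rewrite starZ sa conj_real star_homZ !nrmZ nrm_real.
  rewrite gtr0_norm ?invr_gt0// ltr_pdivrMl// ler_pdivrMl// mulr1.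
  by apply=> //; rewrite ltrDl.
rewrite -(@ler_pXn2r _ 2) ?nnegrE ?nrm_ge0//.
by rewrite -!nrm_star_mul -star_hom_star -star_homM selfadj// starM starK.
Qed.

Lemma tends_star_hom (u : nat -> A) l :
  tends u l -> tends (fun n => phi (u n)) (phi l).
Proof.
apply: (@tends_lip _ _ _ _ 1) => s t.
by rewrite -star_homB mul1r star_hom_contractive.
Qed.

End Contractive.

(** * The graph L3 *)

Section L3Edges.

Definition e11 : edge L3 := exist _ (ord0, ord0) isT.
Definition e12 : edge L3 := exist _ (ord0, ord_max) isT.
Definition e22 : edge L3 := exist _ (ord_max, ord_max) isT.

Lemma ord2P (v : 'I_2) : v = ord0 \/ v = ord_max.
Proof.
by case: v => [[|[|//]] h]; [left|right]; exact: val_inj.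
Qed.

Lemma edgeP (e : edge L3) : [\/ e = e11, e = e12 | e = e22].
Proof.
case: e => -[i j] h; move: (h) => /=.
case: (ord2P i) => Ei; case: (ord2P j) => Ej; rewrite Ei Ej => h' //.
- by apply: Or31; exact: val_inj.
- by apply: Or32; exact: val_inj.
- by apply: Or33; exact: val_inj.
Qed.

Lemma edges_v1 : [set e : edge L3 | esource e = ord0] = [set` [:: e11; e12]].
Proof.
apply/seteqP; split=> e /=; rewrite !inE.
  by case: (edgeP e) => -> //= _; rewrite eqxx ?orbT.
by case/orP => /eqP->.
Qed.

Lemma edges_v2 : [set e : edge L3 | esource e = ord_max] = [set` [:: e22]].
Proof.
apply/seteqP; split=> e /=; rewrite !inE; last by move/eqP->.
by case: (edgeP e) => -> //=; rewrite eqxx.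
Qed.

Lemma sum_edges_v1 (V : nmodType) (F : edge L3 -> V) :
  \sum_(e \in [set e : edge L3 | esource e = ord0]) F e = F e11 + F e12.
Proof. by rewrite edges_v1 -fsbig_seq//= !big_cons big_nil addr0. Qed.

Lemma sum_edges_v2 (V : nmodType) (F : edge L3 -> V) :
  \sum_(e \in [set e : edge L3 | esource e = ord_max]) F e = F e22.
Proof. by rewrite edges_v2 -fsbig_seq//= big_cons big_nil addr0. Qed.

Lemma finite_edges (v : vertex L3) : finite_set [set e | esource e = v].
Proof.
by case: (ord2P v) => ->; rewrite ?edges_v1 ?edges_v2; exact: finite_seq.
Qed.

Lemma nonempty_edges (v : vertex L3) : [set e | esource e = v] !=set0.
Proof. by case: (ord2P v) => ->; [exists e11|exists e22]. Qed.

End L3Edges.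

(** * A concrete Cuntz-Krieger family with nonzero projection at the second vertex *)

Section RelationMatrices.
Variable R : realType.
Local Notation C := R[i].
Implicit Types r s t : nat -> nat -> bool.

Definition partial_bij r :=
  (forall i j j', r i j -> r i j' -> j = j') /\
  (forall i i' j, r i j -> r i' j -> i = i').

Definition relmat r i j : C := (r i j)%:R.

Lemma relmat_bounded r : partial_bij r -> exists M, bounded_by (relmat r) M.
Proof.
move=> [r1 r2]; exists 1; apply: app_bounded => // N K x; rewrite mul1r.
rewrite ler_sqrt ?sum_nrm2_ge0//.
apply: (@le_trans _ _ (\sum_(i < N) \sum_(j < K) (r i j)%:R * nrm (x j) ^+ 2)).
  apply: ler_sum => i _; rewrite /app.
  have [/existsP[j rij]|/existsPn h] := boolP [exists j : 'I_K, r i j].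
    rewrite (bigD1 j)//= /relmat rij mul1r big1 ?addr0; last first.
      move=> k kj; rewrite (_ : r i k = false) ?mul0r//.
      by apply: contra_neqF kj => /(r1 _ _ _ rij) jk; exact: val_inj.
    rewrite (bigD1 j)//= rij mul1r lerDl.
    by apply: sumr_ge0 => k _; rewrite mulr_ge0 ?ler0n ?sqr_ge0.
  rewrite big1 => [|j _]; last by rewrite /relmat (negPf (h j)) mul0r.
  rewrite nrm0 expr0n; apply: sumr_ge0 => k _.
  by rewrite mulr_ge0 ?ler0n ?sqr_ge0.
rewrite exchange_big /=; apply: ler_sum => j _; rewrite -mulr_suml.
rewrite -[leRHS]mul1r ler_wpM2r ?sqr_ge0//.
have [/existsP[i rij]|/existsPn h] := boolP [exists i : 'I_N, r i j].
  rewrite (bigD1 i)//= rij big1 ?addr0// => k ki.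
  rewrite (_ : r k j = false)//; apply: contra_neqF ki => /r2/(_ rij) ik.
  exact: val_inj.
by rewrite big1// => i _; rewrite (negPf (h i)).
Qed.

Definition relb r (h : partial_bij r) : bmat R := Bmat (relmat_bounded h).

Lemma relb_mul r s t (hr : partial_bij r) (hs : partial_bij s) (ht : partial_bij t) :
  (forall i j k, r i k -> s k j -> t i j) ->
  (forall i j, t i j -> exists k, r i k && s k j) ->
  relb hr ** relb hs = relb ht.
Proof.
move=> rst trs; apply: bmat_mul_eq => i j.
apply: tends_eventually (@tends_cst _ _ _).
rewrite /= /relmat; have [tij|ntij] := boolP (t i j); last first.
  exists 0%N => n _; rewrite big1// => k _.
  rewrite -natrM mulnb (_ : _ && _ = false)//.
  by apply: contraNF ntij => /andP[/rst]; apply.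
have [k /andP[rik skj]] := trs i j tij.
exists k.+1 => n kn; rewrite (bigD1 (Ordinal kn))//= rik skj mulr1 big1 ?addr0//.
move=> l; rewrite -val_eqE /= => lk; rewrite (_ : r i l = false) ?mul0r//.
by apply: contra_neqF lk => ril; exact: (proj1 hr _ _ _ ril rik).
Qed.

Lemma relb_star r s (hr : partial_bij r) (hs : partial_bij s) :
  (forall i j, s i j = r j i) -> star (relb hr) = relb hs.
Proof.
by move=> rs; apply: bmat_inj => i j /=; rewrite /adj /= /relmat rs conjC_nat.
Qed.

Lemma relb_eq0 r (hr : partial_bij r) : (forall i j, r i j = false) -> relb hr = 0.
Proof. by move=> r0; apply: bmat_inj => i j /=; rewrite /relmat r0. Qed.

Lemma relb_neq0 r (hr : partial_bij r) i j : r i j -> relb hr <> 0.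
Proof.
move=> rij /(congr1 (fun a : bmat R => a i j)) /=; rewrite /relmat rij.
by apply/eqP; rewrite oner_eq0.
Qed.

(* The representation of C^*(L3) on l^2 in which P_(v_2) is the projection on
   the first basis vector, S_(e_11) the shift on the others, and S_(e_22) is
   P_(v_2). *)
Let rP (v : 'I_2) i j := (i == j) && ((i == 0%N) == (v == ord_max)).

Let rS (e : edge L3) i j :=
  if (val e).2 == ord0 then (i == j.+1) && (0 < j)%N
  else (i == (if (val e).1 == ord0 then 1%N else 0%N)) && (j == 0%N).

Lemma rP_bij v : partial_bij (rP v).
Proof. by split=> i j k; rewrite /rP => /andP[/eqP + _] /andP[/eqP + _]; lia. Qed.

Lemma rS_bij e : partial_bij (rS e).
Proof. by split=> i j k; rewrite /rS; case: ifP => _; lia. Qed.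

Let rV e i j := rS e j i.

Lemma rV_bij e : partial_bij (rV e).
Proof. by split=> i j k; rewrite /rV /rS; case: ifP => _; lia. Qed.

(** The range projection of [rS e]; that of the shift omits the basis vectors 0 and 1, the latter
    being the range of [S_(e_12)]. *)
Let rR (e : edge L3) i j := (i == j) &&
  if (val e).2 == ord0 then (1 < i)%N else i == (if (val e).1 == ord0 then 1%N else 0%N).

Lemma rR_bij e : partial_bij (rR e).
Proof. by split=> i j k; rewrite /rR => /andP[/eqP + _] /andP[/eqP + _]; lia. Qed.

Let Q v := relb (rP_bij v).
Let T e := relb (rS_bij e).

Lemma relb_range e : range_proj (T e) = relb (rR_bij e).
Proof.
rewrite /range_proj (@relb_star _ _ (rS_bij e) (rV_bij e))//.
apply: relb_mul => [i j k|i j]; rewrite /rV /rS /rR; case: ifP => _.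
- by lia.
- by lia.
- by move=> ij; exists i.-1; lia.
- by move=> ij; exists 0%N; lia.
Qed.

Lemma partial_bij0 : partial_bij (fun _ _ => false).
Proof. by []. Qed.

Lemma relb_mul0 r s (hr : partial_bij r) (hs : partial_bij s) :
  (forall i j k, r i k -> s k j -> False) -> relb hr ** relb hs = 0.
Proof.
move=> rs0; rewrite (@relb_mul _ _ _ hr hs partial_bij0)//; last first.
  by move=> i j k rik skj; have := rs0 _ _ _ rik skj.
exact: relb_eq0.
Qed.

Lemma exists_ck_family : exists (B : cstarAlgType R) (P : vertex L3 -> B)
  (S : edge L3 -> B), ck_family P S /\ P ord_max <> 0.
Proof.
exists (bmat R), Q, T; split; last by apply: (@relb_neq0 _ _ 0%N 0%N).
have ends : ((ord0 == ord_max :> 'I_2) = false) * ((ord_max == ord0 :> 'I_2) = false)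
    * ((ord0 == ord0 :> 'I_2) = true) * ((ord_max == ord_max :> 'I_2) = true) by [].
split.
- split=> [v|v w vw].
    split; last by apply: relb_star => i j; rewrite /rP eq_sym; case: eqP => // ->.
    apply: relb_mul => [i j k|i j]; rewrite /rP; first by lia.
    by move=> ij; exists i; lia.
  apply: relb_mul0 => i j k; rewrite /rP.
  have : (v == ord_max :> 'I_2) != (w == ord_max :> 'I_2).
    by case: (ord2P v) vw => ->; case: (ord2P w) => ->.
  lia.
- split=> [e|e f ef].
    rewrite /partial_isometry -/(range_proj _) relb_range.
    apply: relb_mul => [i j k|i j]; rewrite /rR /rS; case: ifP => _; try lia.
      by move=> ij; exists i; lia.
    by move=> ij; exists i; lia.
  rewrite !relb_range; apply: relb_mul0 => i j k; rewrite /rR.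
  by case: (edgeP e) ef => ->; case: (edgeP f) => -> //= _; rewrite ?ends; lia.
- move=> e; rewrite /source_proj (@relb_star _ _ (rS_bij e) (rV_bij e))//.
  apply: relb_mul => [i j k|i j]; rewrite /rV /rS /rP.
    by case: (edgeP e) => -> /=; rewrite ?ends; lia.
  case: (edgeP e) => -> /=; rewrite ?ends => ij.
  + by exists i.+1; lia.
  + by exists 1%N; lia.
  + by exists 0%N; lia.
- move=> e; rewrite relb_range; split; apply: relb_mul => [i j k|i j]; rewrite /rR /rP.
  + by case: (edgeP e) => -> /=; rewrite ?ends; lia.
  + by move=> ij; exists i; move: ij; case: (edgeP e) => -> /=; rewrite ?ends; lia.
  + by case: (edgeP e) => -> /=; rewrite ?ends; lia.
  + by move=> ij; exists i; move: ij; case: (edgeP e) => -> /=; rewrite ?ends; lia.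
- move=> v _ _; case: (ord2P v) => ->.
    rewrite sum_edges_v1 !relb_range; apply: bmat_inj => i j /=.
    rewrite /relmat /rP /rR /= ?ends -natrD; congr _%:R; lia.
  rewrite sum_edges_v2 !relb_range; apply: bmat_inj => i j /=.
  by rewrite /relmat /rP /rR /= ?ends; congr (nat_of_bool _)%:R; lia.
Qed.

(** Universality maps [P_(v_2)] to a nonzero projection of the concrete family. Without this the
    norms of [w i] and [upow n] could all be zero. *)
Lemma graph_cstar_P2_neq0 (A : cstarAlgType R) (P : vertex L3 -> A) (S : edge L3 -> A) :
  is_graph_cstar P S -> P ord_max <> 0.
Proof.
move=> [_ _ U] P0; have [B [Q' [T' [ck]]]] := exists_ck_family; apply.
have [phi [[hphi hP _] _]] := U B Q' T' ck.
by rewrite -hP P0 (star_hom0 hphi).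
Qed.

End RelationMatrices.

(** * Roots of unity and averages *)

Section Theta.
Variable R : realType.

Lemma cis_exp (x : R) n :
  (cos x +i* sin x) ^+ n = cos (n%:R * x) +i* sin (n%:R * x) :> R[i].
Proof.
elim: n => [|n IH]; first by rewrite expr0 mul0r cos0 sin0.
rewrite exprS IH -natr1 mulrDl mul1r addrC cosD sinD.
by apply/eqP; rewrite eq_complex /=; apply/andP; split; apply/eqP; ring.
Qed.

(** For [0 < n < r] half of the angle lies strictly between [0] and [pi], where the sine is
    positive, so the cosine of the angle is less than 1. *)
Lemma theta_expn r n : (0 < r)%N -> (n < r)%N -> theta R r ^+ n = 1 -> n = 0%N.
Proof.
move=> r0 nr; rewrite cis_exp => /eqP; rewrite eq_complex /= => /andP[/eqP h _].
apply/eqP; apply: contraPT h; rewrite -lt0n => n0.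
pose y : R := pi * (n%:R / r%:R).
have r0' : 0 < r%:R :> R by rewrite ltr0n.
have -> : n%:R * (2 * pi / r%:R) = y *+ 2 by rewrite /y mulr2n; field; exact: lt0r_neq0.
have y0 : 0 < sin y.
  apply: sin_gt0_pi; rewrite mulr_gt0 ?pi_gt0 ?divr_gt0 ?ltr0n//=.
  by rewrite -[ltRHS]mulr1 ltr_pM2l ?pi_gt0// ltr_pdivrMr// mul1r ltr_nat.
rewrite cos_mulr2n => h; have := cos2Dsin2 y.
by move: (exprn_gt0 2 y0) h; rewrite mulr2n; lra.
Qed.

Lemma theta_exp_order r : (0 < r)%N -> theta R r ^+ r = 1.
Proof.
move=> r0; rewrite cis_exp (_ : r%:R * _ = pi *+ 2) ?cos2pi ?sin2pi//.
by rewrite mulr2n; field; rewrite pnatr_eq0 -lt0n.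
Qed.

Lemma theta_neq0 r : theta R r != 0.
Proof. by rewrite -normr_eq0 norm_theta oner_eq0. Qed.

Lemma theta_exp_eq1 r (k : int) : (0 < r)%N -> theta R r ^ k = 1 <-> (r %| k)%Z.
Proof.
move=> r0; rewrite [in theta R r ^ k](divz_eq k r) expfzDr ?theta_neq0//.
rewrite mulrC mulrC [(_ * r%:Z)%R]mulrC -exprz_exp -[theta R r ^ r%:Z]/(theta R r ^+ r).
rewrite theta_exp_order// exp1rz mul1r.
have rn0 : r%:Z != 0 by rewrite -lt0n.
have := modz_ge0 k rn0; have := ltz_pmod k (r0 : 0 < r%:Z).
rewrite (sameP dvdz_mod0P eqP); case: (k %% r)%Z => // n nr _.
split=> [/(theta_expn r0 nr)->//|/eqP->]; exact: expr0z.
Qed.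

Lemma theta_pow r (k : int) n : (theta R r ^ k) ^+ n = theta R r ^ (k * n%:Z).
Proof. exact: (exprz_exp _ k n). Qed.

Lemma theta_add r (k l : int) : theta R r ^ k * theta R r ^ l = theta R r ^ (k + l).
Proof. by rewrite expfzDr// theta_neq0. Qed.

Lemma theta_inv r (k : int) : (theta R r ^ k)^-1 = theta R r ^ (- k).
Proof. exact: invr_expz. Qed.

Lemma theta_eq_mod r (k l : int) : (0 < r)%N -> (r %| k - l)%Z -> theta R r ^ k = theta R r ^ l.
Proof.
by move=> r0 /(theta_exp_eq1 _ r0) h; rewrite -[k](subrK l) -theta_add h mul1r.
Qed.

Lemma norm_exprz (a : R[i]) (k : int) : `|a| = 1 -> `|a ^ k| = 1.
Proof.
move=> a1; case: k => n; rewrite /exprz ?normfV normrX a1 expr1n //.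
exact: invr1.
Qed.

Lemma exprz_sub (a : R[i]) (i j : nat) : a != 0 ->
  a ^ (j%:Z - i%:Z) = (a ^+ i)^-1 * a ^+ j.
Proof.
move=> a0; rewrite expfzDr// mulrC; congr (_ * _).
exact: (esym (exprnN a i)).
Qed.

Lemma unit_neq0 (a : R[i]) : `|a| = 1 -> a != 0.
Proof. by move=> a1; rewrite -normr_eq0 a1 oner_eq0. Qed.

Lemma conj_unit (a : R[i]) : `|a| = 1 -> Num.conj a = a^-1.
Proof. by move=> a1; rewrite invC_norm a1 expr1n invr1 mul1r. Qed.

End Theta.

Section Average.
Variables (R : realType) (A : cstarAlgType R) (phi : A -> A).
Hypothesis hphi : star_hom phi.

Lemma star_hom_iter k : star_hom (iter k phi).
Proof.
elim: k => [|k IH]; first by split.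
split=> [c x y _ _|x y _ _|x _] /=.
- by rewrite (star_homD IH) (star_homZ IH) (star_homD hphi) (star_homZ hphi).
- by rewrite (star_homM IH) (star_homM hphi).
- by rewrite (star_hom_star IH) (star_hom_star hphi).
Qed.

Lemma iter_fixed x k : phi x = x -> iter k phi x = x.
Proof. by move=> px; elim: k => //= k ->. Qed.

Lemma fixed_pointsP x : fixed_points phi x <-> phi x = x.
Proof. by split=> [/(_ 1%N)//|px k]; exact: iter_fixed. Qed.

Lemma iter_eigen (z : R[i]) x k : phi x = z *: x -> iter k phi x = z ^+ k *: x.
Proof.
move=> px; elim: k => [|k IH]; first by rewrite expr0 scale1r.
by rewrite iterS IH (star_homZ hphi) px scalerA exprSr.
Qed.

(** Stands in for the conditional expectation onto the fixed points: used with [N = r] for the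
    action of [Z/r], and with [phi = gamma (theta R N)] for large [N] in place of an integral over
    the circle. *)
Definition avg N (x : A) : A := (N%:R^-1 : R[i]) *: \sum_(k < N) iter k phi x.

Lemma avg_lin N c x y : avg N (c *: x + y) = c *: avg N x + avg N y.
Proof.
rewrite /avg scalerA mulrC -scalerA -scalerDr; congr (_ *: _).
rewrite scaler_sumr -big_split /=; apply: eq_bigr => k _.
by rewrite (star_homD (star_hom_iter k)) (star_homZ (star_hom_iter k)).
Qed.

Lemma avg0 N : avg N 0 = 0.
Proof.
by rewrite /avg big1 ?scaler0// => k _; rewrite (star_hom0 (star_hom_iter k)).
Qed.

Lemma avgB N x y : avg N (x - y) = avg N x - avg N y.
Proof. by rewrite addrC -scaleN1r avg_lin scaleN1r addrC. Qed.

Lemma sumr_const_scale N (x : A) : (0 < N)%N ->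
  (N%:R^-1 : R[i]) *: \sum_(k < N) x = x.
Proof.
move=> N0; rewrite sumr_const card_ord.
have -> : x *+ N = (N%:R : R[i]) *: x by rewrite scaler_nat.
by rewrite scalerA mulVf ?scale1r// pnatr_eq0 -lt0n.
Qed.

Lemma nrm_avg N x : nrm (avg N x) <= nrm x.
Proof.
have [->|N0] := posnP N.
  by rewrite /avg big_ord0 scaler0 nrm0 nrm_ge0.
rewrite nrmZ -(rmorph_nat (real_complex R)) -fmorphV nrm_real.
rewrite ger0_norm ?invr_ge0// ler_pdivrMl ?ltr0n//.
apply: le_trans (nrm_sum _ _ _) _; apply: (@le_trans _ _ (\sum_(k < N) nrm x)).
  by apply: ler_sum => k _; exact: star_hom_contractive (star_hom_iter k) x.
by rewrite sumr_const card_ord mulr_natl lexx.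
Qed.

Lemma avg_eigen N (z : R[i]) x : (0 < N)%N -> phi x = z *: x -> z ^+ N = 1 ->
  avg N x = if z == 1 then x else 0.
Proof.
move=> N0 px zN.
rewrite /avg; under eq_bigr => k _ do rewrite (iter_eigen _ px).
have [->|z1] := eqVneq z 1.
  by under eq_bigr => k _ do rewrite expr1n scale1r; rewrite sumr_const_scale.
rewrite -scaler_suml (_ : \sum_(k < N) z ^+ k = 0) ?scale0r ?scaler0//.
apply: (@mulfI _ (z - 1)); first by rewrite subr_eq0.
by rewrite -subrX1 zN subrr mulr0.
Qed.

Lemma avg_fixed N x : (0 < N)%N -> phi x = x -> avg N x = x.
Proof.
by move=> N0 px; rewrite (@avg_eigen N 1) ?eqxx ?scale1r ?expr1n.
Qed.

Lemma avg_sandwich N e x : phi e = e -> avg N (e ** x ** e) = e ** avg N x ** e.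
Proof.
move=> pe; rewrite /avg cmulZr cmulZl cmul_sumr cmul_suml; congr (_ *: _).
apply: eq_bigr => k _; have hk := star_hom_iter k.
by rewrite !(star_homM hk) iter_fixed.
Qed.

End Average.

(** * Residues modulo r *)

Lemma dvdz_mul_gcd (r : nat) (k x : int) : (0 < r)%N ->
  (r %| k * x)%Z = ((r %/ gcdn `|k| r)%N %| x)%Z.
Proof.
move=> r0; have g0 : (0 < gcdn `|k| r)%N by rewrite gcdn_gt0 r0 orbT.
rewrite !dvdzE abszM /=.
have hk := divnK (dvdn_gcdl `|k| r); have hr := divnK (dvdn_gcdr `|k| r).
set g := gcdn `|k| r in g0 hk hr *.
rewrite -[X in (X %| _)%N = _]hr -[X in (_ %| X * _)%N = _]hk mulnAC dvdn_pmul2r//.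
rewrite Gauss_dvdr// /coprime -(eqn_pmul2r g0) mul1n muln_gcdl hr hk.
by rewrite gcdnC.
Qed.

Lemma coprimez_inv (r : nat) (a : int) : coprimez a r ->
  exists b : int, (r %| a * b - 1)%Z.
Proof.
move=> /eqP ar; have [u [v E]] := Bezoutz a r; rewrite ar in E.
by exists u; apply/dvdzP; exists (- v); rewrite -E; ring.
Qed.

(* A unit modulo a divisor [d] of [r] lifts to a unit modulo [r]: add to it
   [d] times the largest divisor of [r] coprime to it. *)
Lemma lift_unit (r d : nat) (v : nat) : (0 < r)%N -> (0 < v)%N -> (d %| r)%N -> coprime v d ->
  exists v', coprime v' r /\ v' = v %[mod d].
Proof.
move=> r0 v0 dr vd; pose t := (r`_(\pi(v)^'))%N.
exists (v + d * t)%N; split; last by rewrite -modnDmr modnMr addn0.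
rewrite coprime_sym coprime_has_primes//; last by rewrite addn_gt0 v0.
apply/hasPn => p; rewrite !mem_primes => /and3P[pp _ pvt].
rewrite r0 pp /=; apply/negP => pr.
have [pv|npv] := boolP (p %| v)%N.
  have : (p %| d * t)%N by rewrite -(dvdn_addr _ pv).
  rewrite Euclid_dvdM// => /orP[pd|pt].
    have := coprime_dvdl pv (coprime_dvdr pd vd).
    by rewrite /coprime gcdnn => /eqP E; rewrite E in pp.
  have /pnatP : (\pi(v)^'.-nat t)%N by exact: part_pnat.
  move=> /(_ (part_gt0 _ _) p pp pt); rewrite inE/= mem_primes pp v0 pv//.
have pt : (p %| t)%N.
  have : (p %| t * r`_\pi(v))%N by rewrite mulnC partnC.
  rewrite Euclid_dvdM// => /orP[//|pt].
  have /pnatP : (\pi(v).-nat r`_\pi(v))%N by exact: part_pnat.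
  by move=> /(_ (part_gt0 _ _) p pp pt); rewrite mem_primes (negPf npv) !andbF.
by move/negP: npv; apply; rewrite -(dvdn_addl _ (dvdn_mull d pt)).
Qed.

(** After division by the common gcd [g], both [a'] and [b'] are units modulo [d = r / g]; their
    quotient is a unit modulo [d], and [lift_unit] turns it into a unit modulo [r] without changing
    its class modulo [d]. *)
Lemma associated_mod (r : nat) (a b : int) : (0 < r)%N -> gcdn `|a| r = gcdn `|b| r ->
  exists v : nat, coprime v r /\ (r %| a * v%:Z - b)%Z.
Proof.
move=> r0 ab; pose g := gcdn `|a| r; pose d := (r %/ g)%N.
have g0 : (0 < g)%N by rewrite gcdn_gt0 r0 orbT.
have gr : (g %| r)%N by exact: dvdn_gcdr.
have rE : r = (d * g)%N by rewrite divnK.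
have d0 : (0 < d)%N by rewrite divn_gt0// dvdn_leq.
have quo (c : int) : gcdn `|c| r = g -> exists c' : int, c = c' * g%:Z /\ coprimez c' d.
  move=> cg; have /dvdzP[c' cE] : (g%:Z %| c)%Z by rewrite dvdzE /= -cg dvdn_gcdl.
  exists c'; split=> //; rewrite coprimezE /= /coprime -(eqn_pmul2r g0) mul1n muln_gcdl.
  by rewrite -rE -{2}cg cE abszM.
have [a' [aE a'd]] := quo a erefl; have [b' [bE b'd]] := quo b (esym ab).
have [c hc] := coprimez_inv a'd.
pose v0 := `|((b' * c) %% d%:Z)%Z|%N.
have dn0 : d%:Z != 0 by rewrite -lt0n.
have v0E : v0%:Z = ((b' * c) %% d%:Z)%Z by rewrite /v0 gez0_abs// modz_ge0.
have hv0 : (d %| a' * v0%:Z - b')%Z.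
  rewrite v0E; have E := divz_eq (b' * c) d%:Z.
  have mE : ((b' * c) %% d%:Z)%Z = b' * c - ((b' * c) %/ d%:Z)%Z * d%:Z.
    by rewrite {2}E addrAC subrr add0r.
  have -> : a' * ((b' * c) %% d%:Z)%Z - b' =
      b' * (a' * c - 1) - a' * ((b' * c) %/ d%:Z)%Z * d%:Z.
    by rewrite mE; ring.
  by rewrite rpredB// ?dvdz_mull.
have cop (x : nat) : (d %| a' * x%:Z - b')%Z -> coprime x d.
  move=> /dvdzP[q hq]; move: b'd; rewrite (_ : b' = a' * x%:Z - q * d%:Z); last by rewrite -hq; ring.
  rewrite coprimezE /= => h; rewrite /coprime.
  have := dvdn_gcd (gcdn x d) (absz (a' * x%:Z - q * d%:Z)%R) d.
  rewrite (eqP h) dvdn1 dvdn_gcdr andbT => ->.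
  have : ((gcdn x d)%:Z %| a' * x%:Z - q * d%:Z)%Z.
    by rewrite rpredB// dvdz_mull// dvdzE /= ?dvdn_gcdl ?dvdn_gcdr.
  by rewrite dvdzE.
(* [lift_unit] asks for a positive number, while [v0] is [0] if [d = 1]; adding [d] repairs this
   within the class. *)
have [v [vr vE]] : exists v', coprime v' r /\ v' = (v0 + d)%N %[mod d].
  apply: lift_unit => //; rewrite ?addn_gt0 ?d0 ?orbT//; first by rewrite rE dvdn_mulr.
  by rewrite coprime_sym /coprime gcdnDr gcdnC; exact: cop.
exists v; split=> //.
have hv : (d %| a' * v%:Z - b')%Z.
  have : (d%:Z %| v%:Z - v0%:Z)%Z.
    by rewrite -eqz_mod_dvd; move: vE; rewrite modnDr => E; rewrite !modz_nat E.
  move=> hd; have -> : a' * v%:Z - b' = (a' * v0%:Z - b') + a' * (v%:Z - v0%:Z) by ring.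
  by rewrite rpredD// dvdz_mull.
rewrite aE bE (_ : _ - _ = (a' * v%:Z - b') * g%:Z); last by ring.
by rewrite rE PoszM dvdz_mul.
Qed.

(** * Block permutations and path lengths *)

Section Residues.
Variable r : nat.
Hypothesis r0 : (0 < r)%N.

Let rn0 : r%:Z != 0. Proof. by rewrite -lt0n. Qed.

Lemma dvdz_cancel (a k : int) : coprimez a r -> (r %| a * k)%Z = (r %| k)%Z.
Proof. by move=> ar; rewrite Gauss_dvdzr// coprimez_sym. Qed.

Lemma gcdn_unit_mul (a b : int) : coprimez a r -> gcdn `|a * b| r = gcdn `|b| r.
Proof.
move=> ar; rewrite abszM gcdnC Gauss_gcdr; first by rewrite gcdnC.
by rewrite coprime_sym.
Qed.

Definition residue (k : int) : 'I_r :=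
  Ordinal (ltn_pmod `|(k %% r)%Z| r0).

Lemma residueP k : (r %| (residue k : nat)%:Z - k)%Z.
Proof.
rewrite -eqz_mod_dvd /= -modz_nat gez0_abs ?modz_ge0//.
by rewrite !modz_mod.
Qed.

Lemma ord_eq_mod (i j : 'I_r) : (r %| (i : nat)%:Z - (j : nat)%:Z)%Z -> i = j.
Proof.
rewrite -eqz_mod_dvd !modz_nat !modn_small// => /eqP[] h.
exact: val_inj.
Qed.

Lemma modn_dvdz (i j : nat) : (r %| i%:Z - j%:Z)%Z -> i = j %[mod r].
Proof. by rewrite -eqz_mod_dvd !modz_nat => /eqP[]. Qed.

Definition block_perm v i := (r * (i %/ r) + (v * i) %% r)%N.

Lemma block_perm_shift v i n : block_perm v (i + r * n) = (block_perm v i + r * n)%N.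
Proof.
rewrite /block_perm.
have -> : (v * (i + r * n) = v * n * r + v * i)%N by ring.
have -> : (i + r * n = n * r + i)%N by ring.
by rewrite modnMDl divnMDl//; ring.
Qed.

Lemma block_perm0 v : block_perm v 0 = 0%N.
Proof. by rewrite /block_perm div0n !muln0 mod0n. Qed.

Lemma block_perm_div v i : (block_perm v i %/ r = i %/ r)%N.
Proof. by rewrite /block_perm mulnC divnMDl// (divn_small (ltn_pmod _ r0)) addn0. Qed.

Lemma block_perm_mod v i : block_perm v i = v * i %[mod r].
Proof. by rewrite /block_perm mulnC modnMDl modn_mod. Qed.

Lemma block_permK v v' : (v * v' = 1 %[mod r])%N -> cancel (block_perm v) (block_perm v').
Proof.
move=> vv i; rewrite {1}/block_perm block_perm_div -modnMmr block_perm_mod modnMmr.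
by rewrite mulnA [(v' * v)%N]mulnC -modnMml vv modnMml mul1n mulnC -divn_eq.
Qed.

Lemma unit_inverse v : coprime v r -> exists v', (v * v' = 1 %[mod r])%N.
Proof.
move=> vr; have [c hc] : exists c : int, (r %| v%:Z * c - 1)%Z by exact: coprimez_inv.
exists (residue c); apply: modn_dvdz; rewrite PoszM.
rewrite (_ : _ - _ = v%:Z * ((residue c : nat)%:Z - c) + (v%:Z * c - 1)); last by ring.
by rewrite rpredD// dvdz_mull// residueP.
Qed.

Variables m n : 'I_2 -> int.
Hypotheses (hm : forall i, coprimez (m i) r) (hn : forall i, coprimez (n i) r).
Local Notation m0 := (m ord0).
Local Notation m1 := (m ord_max).
Local Notation n0 := (n ord0).
Local Notation n1 := (n ord_max).

(** The factors [m1] and [n1] are units, so [m1 * (n1 - n0)] and [n1 * (m1 - m0)] have the same gcd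
    with [r] and differ by a unit. *)
Lemma lens_unit : gcdn `|m1 - m0| r = gcdn `|n1 - n0| r ->
  exists v, coprime v r /\ (r %| m1 * (n1 - n0) * v%:Z - n1 * (m1 - m0))%Z.
Proof. by move=> E; apply: associated_mod => //; rewrite !gcdn_unit_mul. Qed.

Definition path_pred (k : 'I_2 -> int) (t : 'I_r * 'I_r) :=
  (k ord0 * (t.1.+1)%:Z + k ord_max * (t.2 : nat)%:Z == 0 %[mod r])%Z.

(** With [L = t1 + t2 + 1] the condition on a path reads [m1 L = (m1 - m0) (t1 + 1)]. The bijection
    multiplies [t1 + 1] by [v] and keeps [L]; by the congruence for [v], [m1] times the left-hand
    side of the condition for [n] becomes [n1] times that for [m], and [m1], [n1] are units. *)
Lemma path_lengths_perm : gcdn `|m1 - m0| r = gcdn `|n1 - n0| r ->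
  path_lengths r m = path_lengths r n.
Proof.
move=> /lens_unit[v [vr hv]].
pose phi (t : 'I_r * 'I_r) : 'I_r * 'I_r :=
  let t1 := residue (v%:Z * (t.1.+1)%:Z - 1) in
  (t1, residue ((t.1 : nat)%:Z + (t.2 : nat)%:Z - (t1 : nat)%:Z)).
have p1 t : (r %| ((phi t).1 : nat)%:Z + 1 - v%:Z * (t.1.+1)%:Z)%Z.
  rewrite (_ : _ - _ = ((phi t).1 : nat)%:Z - (v%:Z * (t.1.+1)%:Z - 1)); last by ring.
  exact: residueP.
have p2 t : (r %| ((phi t).1 : nat)%:Z + ((phi t).2 : nat)%:Z - ((t.1 : nat)%:Z + (t.2 : nat)%:Z))%Z.
  rewrite (_ : _ - _ = ((phi t).2 : nat)%:Z - ((t.1 : nat)%:Z + (t.2 : nat)%:Z - ((phi t).1 : nat)%:Z)); last by ring.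
  exact: residueP.
have phi_inj : injective phi.
  move=> t t' E; have e1 : t.1 = t'.1.
    apply: ord_eq_mod; rewrite -(@dvdz_cancel v%:Z)//.
    have := p1 t; have := p1 t'; rewrite E => h' h.
    have := rpredB h' h; rewrite (_ : _ - _ = v%:Z * ((t.1 : nat)%:Z - (t'.1 : nat)%:Z))//.
    by rewrite !(intS (nat_of_ord _)); ring.
  have e2 : t.2 = t'.2.
    apply: ord_eq_mod; have := p2 t; have := p2 t'; rewrite E e1 => h' h.
    have := rpredB h' h; rewrite (_ : _ - _ = (t.2 : nat)%:Z - (t'.2 : nat)%:Z)//; ring.
  by case: t t' e1 e2 {E} => [a b] [a' b'] /= -> ->.
have len t : (((phi t).1 + (phi t).2 + 1) %% r = (t.1 + t.2 + 1) %% r)%N.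
  apply: modn_dvdz; rewrite !PoszD (_ : _ - _ = ((phi t).1 : nat)%:Z + ((phi t).2 : nat)%:Z -
    ((t.1 : nat)%:Z + (t.2 : nat)%:Z)); [exact: p2|ring].
have pphi t : path_pred n (phi t) = path_pred m t.
  rewrite /path_pred !eqz_mod_dvd !subr0.
  rewrite -(dvdz_cancel _ (hm ord_max)) -[in RHS](dvdz_cancel _ (hn ord_max)).
  set X := (X in (_ %| X)%Z = _); set Y := (X in _ = (_ %| X)%Z).
  suff XY : (r %| X - Y)%Z.
    apply/idP/idP => h; first by rewrite -[Y](subKr X) rpredB.
    by rewrite -[X](subrK Y) rpredD.
  have -> : X - Y =
      m1 * n1 * (((phi t).1 : nat)%:Z + ((phi t).2 : nat)%:Z - ((t.1 : nat)%:Z + (t.2 : nat)%:Z))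
      - m1 * (n1 - n0) * (((phi t).1 : nat)%:Z + 1 - v%:Z * (t.1.+1)%:Z)
      - (m1 * (n1 - n0) * v%:Z - n1 * (m1 - m0)) * (t.1.+1)%:Z.
    by rewrite /X /Y !(intS (nat_of_ord _)); ring.
  by rewrite !rpredB//; [exact/dvdz_mull/p2|exact/dvdz_mull/p1|exact/dvdz_mulr/hv].
rewrite /path_lengths; apply/eq_seq_msetP.
rewrite (_ : [seq _ | t <- _ & _] = [seq ((t.1 + t.2 + 1) %% r)%N | t : 'I_r * 'I_r <-
    [seq x <- enum {: 'I_r * 'I_r} | path_pred m x]])//.
under eq_map => t do rewrite -len.
rewrite (map_comp (fun t : 'I_r * 'I_r => ((t.1 + t.2 + 1) %% r)%N) phi).
apply: perm_map; under eq_filter => t do rewrite -pphi.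
rewrite -filter_map; apply: perm_filter; apply: uniq_perm; rewrite ?enum_uniq//.
  by rewrite (map_inj_uniq phi_inj) enum_uniq.
move=> t; rewrite mem_enum; apply/mapP.
have [psi _ psiK] := injF_bij phi_inj.
by exists (psi t); rewrite ?mem_enum.
Qed.

End Residues.

Lemma mem_path_lengths (r : nat) (n : 'I_2 -> int) x : (x \in path_lengths r n)%N =
  [exists t : 'I_r * 'I_r, path_pred n t && (x == (t.1 + t.2 + 1) %% r)%N].
Proof.
rewrite (perm_mem (perm_eq_seq_mset _)); apply/mapP/existsP => [[t]|[t /andP[nt /eqP->]]].
  by rewrite mem_filter => /andP[nt _] ->; exists t; rewrite /path_pred nt eqxx.
by exists t => //; rewrite mem_filter mem_enum; apply/andP.
Qed.

(** Every length [L] of a path for [n] satisfies [n1 L = (n1 - n0) (t1 + 1)] modulo [r], hence is a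
    multiple of [gn] because [n1] is a unit modulo [gn]. This is applied to the length [gm], which
    occurs for [m]. *)
Lemma path_lengths_gcd (r : nat) (m n : 'I_2 -> int) : (0 < r)%N ->
  (forall i, coprimez (m i) r) -> (forall i, coprimez (n i) r) ->
  path_lengths r m = path_lengths r n ->
  (gcdn `|n ord_max - n ord0| r %| gcdn `|m ord_max - m ord0| r)%N.
Proof.
move=> r0 hm hn E; set gn := gcdn _ _; set gm := gcdn _ _.
have gmr : (gm <= r)%N by rewrite dvdn_leq// dvdn_gcdr.
(* If [gm = r], the length would be recorded as the residue [0]; but then the divisibility is
   immediate. *)
move: gmr; rewrite leq_eqVlt => /predU1P[->|gmr]; first exact: dvdn_gcdr.
have gmin : gm \in path_lengths r m.
  rewrite mem_path_lengths; apply/existsP.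
  have [a [b ab]] := Bezoutz (m ord_max - m ord0) r.
  have {}ab : a * (m ord_max - m ord0) + b * r = gm%:Z by [].
  (* The path with [t1 + 1 = i] and [t2 = gm - i] has length [gm]; its condition is
     [m1 * (gm - a * (m1 - m0)) = m1 * b * r], which vanishes modulo [r]. *)
  pose i := a * m ord_max.
  pose t1 := residue r0 (i - 1); pose t2 := residue r0 (gm%:Z - i).
  have h1 : (r %| (t1 : nat)%:Z - (i - 1))%Z by exact: residueP.
  have h2 : (r %| (t2 : nat)%:Z - (gm%:Z - i))%Z by exact: residueP.
  exists (t1, t2); move: t1 t2 h1 h2 => t1 t2 h1 h2; apply/andP; split.
    rewrite /path_pred eqz_mod_dvd subr0 /=.
    rewrite (_ : _ + _ = m ord0 * ((t1 : nat)%:Z - (i - 1)) +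
       m ord_max * ((t2 : nat)%:Z - (gm%:Z - i)) + m ord_max * b * r%:Z).
      by rewrite !rpredD//; [exact: dvdz_mull|exact: dvdz_mull|exact/dvdz_mull/dvdzz].
    by rewrite -ab (intS t1) /i; ring.
  apply/eqP; rewrite -[LHS](modn_small gmr); apply/esym/modn_dvdz => /=.
  rewrite !PoszD (_ : _ - _ = ((t1 : nat)%:Z - (i - 1)) + ((t2 : nat)%:Z - (gm%:Z - i))).
    by rewrite rpredD.
  by ring.
rewrite E mem_path_lengths in gmin; have /existsP[t /andP[]] := gmin.
rewrite /path_pred eqz_mod_dvd subr0 => nt /eqP gE.
have gnr : (gn %| r)%N by exact: dvdn_gcdr.
have gnd : (gn%:Z %| n ord_max - n ord0)%Z by rewrite dvdzE dvdn_gcdl.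
have lift (z : int) : (r %| z)%Z -> (gn%:Z %| z)%Z.
  by apply: dvdz_trans; rewrite dvdzE.
have cop : coprimez (n ord_max) gn.
  exact: (coprimez_dvdr _ (hn ord_max)).
have : (gn%:Z %| n ord_max * gm%:Z)%Z.
  have h : (r %| (t.1 + t.2 + 1)%N%:Z - gm%:Z)%Z.
    by rewrite -eqz_mod_dvd !modz_nat gE modn_mod.
  rewrite (_ : _ * _ = n ord0 * (t.1.+1)%:Z + n ord_max * (t.2 : nat)%:Z
      + (n ord_max - n ord0) * (t.1.+1)%:Z - n ord_max * ((t.1 + t.2 + 1)%N%:Z - gm%:Z)).
    apply: rpredB; last exact/dvdz_mull/lift.
    by apply: rpredD; [exact: lift|exact: dvdz_mulr].
  by rewrite !PoszD intS; ring.
by rewrite Gauss_dvdzr ?dvdzE// coprimez_sym.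
Qed.

(** * Matrices of the elements of C*(L3) *)

Lemma bernoulli_ineq (R : realType) (h : R) n : 0 <= h -> 1 + n%:R * h <= (1 + h) ^+ n.
Proof.
move=> h0; elim: n => [|n IH]; first by rewrite mul0r addr0 expr0.
rewrite exprS; apply: le_trans (ler_wpM2l _ IH); last lra.
rewrite -natr1 mulrDl mulrDl mul1r mulrDr mulr1.
by rewrite -subr_ge0 (_ : _ - _ = n%:R * h ^+ 2) ?mulr_ge0 ?sqr_ge0//; ring.
Qed.

(** If [a / b = 1 + h] with [h > 0], the Bernoulli inequality at half the exponent, squared, makes
    [(a / b) ^+ (2 ^ k)] grow quadratically in [2 ^ k], which a linear factor cannot match. *)
Lemma le_of_pow2 (R : realType) (a b al be : R) :
  0 <= a -> 0 <= b -> 0 <= al -> 0 <= be ->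
  (forall k, a ^+ (2 ^ k) <= (al + be * (2 ^ k)%:R) * b ^+ (2 ^ k)) -> a <= b.
Proof.
move=> a0 b0 al0 be0 hk; rewrite leNgt; apply/negP => ba.
have b1 : 0 < b.
  rewrite lt_def b0 andbT; apply/eqP => E; have := hk 0%N.
  by rewrite expn0 !expr1 E mulr0; lra.
pose h := a / b - 1.
have h0 : 0 < h by rewrite subr_gt0 ltr_pdivlMr// mul1r.
have grow k : (1 + h) ^+ (2 ^ k) <= al + be * (2 ^ k)%:R.
  rewrite /h addrC subrK expr_div_n ler_pdivrMr ?exprn_gt0//.
pose c := 4 * (al + be) / h ^+ 2.
have h2 : 0 < h ^+ 2 by rewrite exprn_gt0.
have bound k : (2 ^ k.+1)%:R <= c.
  set m : R := (2 ^ k.+1)%:R; have m1 : 1 <= m by rewrite ler1n expn_gt0.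
  have := grow k.+1; rewrite -/m {1}expnS mulnC exprM => g.
  have b2 : (1 + (2 ^ k)%:R * h) ^+ 2 <= ((1 + h) ^+ (2 ^ k)) ^+ 2.
    have b0' : 0 <= 1 + (2 ^ k)%:R * h by rewrite addr_ge0// mulr_ge0// ltW.
    have b3 := bernoulli_ineq (2 ^ k) (ltW h0).
    by rewrite !expr2 ler_pM.
  have mE : m = 2 * (2 ^ k)%:R by rewrite /m expnS natrM.
  have lo : m ^+ 2 * h ^+ 2 / 4 <= (1 + (2 ^ k)%:R * h) ^+ 2.
    rewrite mE -subr_ge0 (_ : _ - _ = 1 + 2 * ((2 ^ k)%:R * h)); last by field.
    by rewrite addr_ge0 ?mulr_ge0 ?(ltW h0).
  have : m ^+ 2 * h ^+ 2 / 4 <= (al + be) * m.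
    apply: le_trans lo (le_trans b2 (le_trans g _)).
    by rewrite mulrDl lerD2r ler_peMr.
  by move=> hm; rewrite /c ler_pdivlMr// -(ler_pM2r (lt_le_trans ltr01 m1)); lra.
have c0 : 0 <= c by apply: divr_ge0 (ltW h2); apply: mulr_ge0 => //; exact: addr_ge0.
have := bound (Num.bound c); apply/negP; rewrite -ltNge.
apply: lt_le_trans (archi_boundP c0) _; rewrite ler_nat.
by rewrite ltnW// (ltn_trans (ltn_expl _ (ltnSn 1)))// ltn_exp2l.
Qed.

Section Span.
Variables (R : realType) (V : lmodType R[i]).

Inductive span (G : set V) : V -> Prop :=
| span0 : span G 0
| spanD c x z : G x -> span G z -> span G (c *: x + z).

Lemma span_add G x y : span G x -> span G y -> span G (x + y).
Proof.
move=> sx sy; elim: sx => [|c g z Gg _ IH]; first by rewrite add0r.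
by rewrite -addrA; exact: spanD.
Qed.

Lemma span_gen G x : G x -> span G x.
Proof. by move=> Gx; rewrite -[x]addr0 -[x]scale1r; apply: spanD => //; exact: span0. Qed.

Lemma span_scale G c x : span G x -> span G (c *: x).
Proof.
elim=> [|d g z Gg _ IH]; first by rewrite scaler0; exact: span0.
by rewrite scalerDr scalerA; exact: spanD.
Qed.

End Span.

Lemma span_map (R : realType) (V V' : lmodType R[i]) (G : set V) (H : set V')
    (f : V -> V') x :
  f 0 = 0 -> (forall c y z, f (c *: y + z) = c *: f y + f z) ->
  (forall y, G y -> span H (f y)) -> span G x -> span H (f x).
Proof.
move=> f0 fD fG; elim=> [|c g z Gg _ IH]; first by rewrite f0; exact: span0.
by rewrite fD; apply: span_add IH; exact/span_scale/fG.
Qed.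

Section Dense.
Variables (R : realType) (A : cstarAlgType R) (E : digraph).
Variables (P : vertex E -> A) (S : edge E -> A).
Hypothesis hA : is_graph_cstar P S.

(** The closure of a star-subalgebra is a closed star-subalgebra, hence everything as soon as it
    contains the generators. *)
Lemma generated_dense (Q : set A) :
  Q 0 -> (forall c x y, Q x -> Q y -> Q (c *: x + y)) ->
  (forall x y, Q x -> Q y -> Q (x ** y)) -> (forall x, Q x -> Q (star x)) ->
  (forall v, Q (P v)) -> (forall e, Q (S e)) -> forall x, adherent Q x.
Proof.
move=> Q0 QD QM Qs QP QS x.
have sub y : Q y -> adherent Q y.
  by move=> Qy e e0; exists y; rewrite // subrr nrm0 ltW.
have [_ gen _] := hA.
suff -> : adherent Q = setT by [].
apply: gen; last 2 first.
- by move=> v; exact/sub/QP.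
- by move=> e; exact/sub/QS.
split.
- apply: adherent_closed => y hy e e0.
  have e2 : 0 < e / 2 by lra.
  have [z Qz yz] := hy _ e2; have [z' Qz' zz'] := Qz _ e2.
  by exists z' => //; have := nrm_tri z y z'; lra.
- exact: sub.
- move=> c y z /adherent_tends[a Qa ya] /adherent_tends[b Qb zb].
  apply: (tends_adherent (u := fun n => c *: a n + b n)).
    by move=> n; exact: QD.
  by apply: tendsD => //; exact: tends_scale.
(* The factors are approximated in turn: the tolerance for [z] depends on the norm of the
   approximant [a N] of [y]. *)
- move=> y z /adherent_tends[a Qa ya] Qz e e0.
  have e2 : 0 < e / 2 by lra.
  have [|N HN] := tends_cmulr z ya (e := e / 2); first exact: e2.
  have [|b Qb zb] := Qz (e / 2 / (nrm (a N) + 1)).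
    by rewrite !divr_gt0// ltr_wpDl ?nrm_ge0.
  exists (a N ** b); first exact: QM.
  have := nrm_tri (a N ** z) (y ** z) (a N ** b).
  have := HN N (leqnn N); rewrite nrmBC.
  have : nrm (a N ** z - a N ** b) <= e / 2.
    rewrite -cmulBr; apply: le_trans (nrm_cmul _ _) _.
    apply: (@le_trans _ _ ((nrm (a N) + 1) * (e / 2 / (nrm (a N) + 1)))).
      by apply: ler_pM; rewrite ?nrm_ge0// lerDl.
    by rewrite mulrC divfK// lt0r_neq0// ltr_wpDl ?nrm_ge0.
  by lra.
- move=> y /adherent_tends[a Qa ya].
  by apply: (tends_adherent (u := fun n => star (a n))) (tends_star ya) => n; exact: Qs.
Qed.

End Dense.

(** * Relations, corners and degrees in the algebra of L3 *)

Section L3Structure.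
Variables (R : realType) (A : cstarAlgType R).
Variables (P : vertex L3 -> A) (S : edge L3 -> A).
Hypothesis hA : is_graph_cstar P S.

Local Notation p1 := (P (ord0 : 'I_2)).
Local Notation p2 := (P (ord_max : 'I_2)).
Local Notation s11 := (S e11).
Local Notation s12 := (S e12).
Local Notation s22 := (S e22).
Implicit Types x y z : A.

Lemma ck : ck_family P S. Proof. by case: hA. Qed.

Lemma P1_proj : is_projection p1. Proof. by case: ck => -[h _] _ _ _ _; exact: h. Qed.
Lemma P2_proj : is_projection p2. Proof. by case: ck => -[h _] _ _ _ _; exact: h. Qed.

Lemma P1P1 : p1 ** p1 = p1. Proof. by case: P1_proj. Qed.
Lemma P2P2 : p2 ** p2 = p2. Proof. by case: P2_proj. Qed.
Lemma starP1 : star p1 = p1. Proof. by case: P1_proj. Qed.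
Lemma starP2 : star p2 = p2. Proof. by case: P2_proj. Qed.

Lemma P1P2 : p1 ** p2 = 0.
Proof. by case: ck => -[_ h] _ _ _ _; exact: h. Qed.
Lemma P2P1 : p2 ** p1 = 0.
Proof. by case: ck => -[_ h] _ _ _ _; exact: h. Qed.

Lemma ss : star s11 ** s11 = p1. Proof. by case: ck => _ _ h _ _; exact: (h e11). Qed.
Lemma tt_ : star s12 ** s12 = p2. Proof. by case: ck => _ _ h _ _; exact: (h e12). Qed.
Lemma uu : star s22 ** s22 = p2. Proof. by case: ck => _ _ h _ _; exact: (h e22). Qed.

Lemma P1E : p1 = s11 ** star s11 + s12 ** star s12.
Proof.
case: ck => _ _ _ _ h; rewrite [LHS](h _ (finite_edges _) (nonempty_edges _)).
by rewrite (sum_edges_v1 (fun e => range_proj (S e))).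
Qed.

Lemma P2E : p2 = s22 ** star s22.
Proof.
case: ck => _ _ _ _ h; rewrite [LHS](h _ (finite_edges _) (nonempty_edges _)).
by rewrite (sum_edges_v2 (fun e => range_proj (S e))).
Qed.

Lemma edge_right e : S e ** P (erange e) = S e.
Proof. by case: ck => _ [h _] <- _ _; rewrite /source_proj cmulA; exact: h. Qed.

Lemma edge_left e : P (esource e) ** S e = S e.
Proof.
case: ck => _ [h _] _ /(_ e)[_ g] _; rewrite -[in LHS](h e).
by rewrite -/(range_proj (S e)) cmulA g h.
Qed.

Lemma s_P1 : s11 ** p1 = s11. Proof. exact: (edge_right e11). Qed.
Lemma P1_s : p1 ** s11 = s11. Proof. exact: (edge_left e11). Qed.
Lemma t_P2 : s12 ** p2 = s12. Proof. exact: (edge_right e12). Qed.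
Lemma P1_t : p1 ** s12 = s12. Proof. exact: (edge_left e12). Qed.
Lemma u_P2 : s22 ** p2 = s22. Proof. exact: (edge_right e22). Qed.
Lemma P2_u : p2 ** s22 = s22. Proof. exact: (edge_left e22). Qed.

Lemma s_P2 : s11 ** p2 = 0. Proof. by rewrite -s_P1 -cmulA P1P2 cmul0r. Qed.
Lemma t_P1 : s12 ** p1 = 0. Proof. by rewrite -t_P2 -cmulA P2P1 cmul0r. Qed.
Lemma u_P1 : s22 ** p1 = 0. Proof. by rewrite -u_P2 -cmulA P2P1 cmul0r. Qed.
Lemma P2_s : p2 ** s11 = 0. Proof. by rewrite -P1_s cmulA P2P1 cmul0l. Qed.
Lemma P2_t : p2 ** s12 = 0. Proof. by rewrite -P1_t cmulA P2P1 cmul0l. Qed.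
Lemma P1_u : p1 ** s22 = 0. Proof. by rewrite -P2_u cmulA P1P2 cmul0l. Qed.

Lemma sst : star s11 ** s12 = 0.
Proof.
case: ck => _ [h g] _ _ _.
have E : s11 ** star s11 ** (s12 ** star s12) = 0 by exact: (g e11 e12).
have hs : star s11 ** (s11 ** star s11) = star s11.
  by rewrite cmulA ss -[in RHS]s_P1 starM starP1.
have ht : (s12 ** star s12) ** s12 = s12 by exact: (h e12).
by rewrite -hs -ht cmulA -(cmulA (star s11)) E cmul0r cmul0l.
Qed.

Lemma sts : star s12 ** s11 = 0.
Proof. by rewrite -[s11]starK -starM sst star0. Qed.

Lemma nrm_P2 : nrm p2 = 1.
Proof.
have := nrm_star_mul p2; rewrite starP2 P2P2 => /eqP; rewrite -subr_eq0.
rewrite -{1}[nrm p2]mulr1 expr2 -mulrBr mulf_eq0 subr_eq0 => /orP[/eqP/nrm0_eq0|/eqP//].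
by move/(graph_cstar_P2_neq0 hA).
Qed.

Definition w k : A := if k is k'.+1 then iter k' (cmul s11) s12 else p2.

Lemma s_w k : s11 ** w k.+1 = w k.+2. Proof. by []. Qed.
Lemma s_w0 : s11 ** w 0 = 0. Proof. exact: s_P2. Qed.
Lemma P1_wS k : p1 ** w k.+1 = w k.+1.
Proof. by case: k => [|k]; rewrite /= ?P1_t// cmulA P1_s. Qed.
Lemma P1_w0 : p1 ** w 0 = 0. Proof. exact: P1P2. Qed.
Lemma P2_wS k : p2 ** w k.+1 = 0. Proof. by rewrite -P1_wS cmulA P2P1 cmul0l. Qed.
Lemma P2_w0 : p2 ** w 0 = w 0. Proof. exact: P2P2. Qed.
Lemma ss_w k : star s11 ** w k.+2 = w k.+1. Proof. by rewrite -s_w cmulA ss P1_wS. Qed.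
Lemma ss_w1 : star s11 ** w 1 = 0. Proof. exact: sst. Qed.
Lemma ss_w0 : star s11 ** w 0 = 0. Proof. by rewrite /= -starP2 -starM P2_s star0. Qed.
Lemma t_w0 : s12 ** w 0 = w 1. Proof. exact: t_P2. Qed.
Lemma t_wS k : s12 ** w k.+1 = 0. Proof. by rewrite -t_P2 -cmulA P2_wS cmul0r. Qed.
Lemma st_w1 : star s12 ** w 1 = w 0. Proof. exact: tt_. Qed.
Lemma st_w0 : star s12 ** w 0 = 0. Proof. by rewrite /= -starP2 -starM P2_t star0. Qed.
Lemma st_wS k : star s12 ** w k.+2 = 0. Proof. by rewrite -s_w cmulA sts cmul0l. Qed.
Lemma u_w0 : s22 ** w 0 = s22. Proof. exact: u_P2. Qed.
Lemma u_wS k : s22 ** w k.+1 = 0. Proof. by rewrite -u_P2 -cmulA P2_wS cmul0r. Qed.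
Lemma su_w0 : star s22 ** w 0 = star s22. Proof. by rewrite /= -{1}starP2 -starM P2_u. Qed.
Lemma su_wS k : star s22 ** w k.+1 = 0.
Proof. by rewrite -P2_u starM starP2 -cmulA P2_wS cmul0r. Qed.

Lemma w_P2 k : w k ** p2 = w k.
Proof. by case: k => [|k]; [exact: P2P2|elim: k => [|k IH]; rewrite /= ?t_P2// -cmulA IH]. Qed.

Lemma ww i j : star (w i) ** w j = if i == j then p2 else 0.
Proof.
elim: i j => [|[|i] IH] j; first by rewrite starP2; case: j => [|j]; rewrite ?P2_wS ?P2_w0.
  by case: j => [|[|j]]; rewrite ?st_w0 ?st_w1 ?st_wS.
rewrite -s_w starM -cmulA; case: j => [|[|j]].
- by rewrite ss_w0 cmul0r.
- by rewrite ss_w1 cmul0r.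
- by rewrite ss_w IH.
Qed.

Arguments w k : simpl never.

Lemma nrm_w i : nrm (w i) = 1.
Proof.
apply/eqP; rewrite -(@eqrXn2 _ 2) ?nrm_ge0//.
by rewrite -nrm_star_mul ww eqxx nrm_P2 expr1n.
Qed.

Definition en N : A := \sum_(i < N) w i ** star (w i).

Lemma en_w N j : en N ** w j = if (j < N)%N then w j else 0.
Proof.
rewrite cmul_suml; under eq_bigr => i _ do rewrite -cmulA ww.
case: ltnP => jN.
  rewrite (bigD1 (Ordinal jN))//= eqxx w_P2 big1 ?addr0// => i.
  by rewrite -val_eqE /= => /negPf->; rewrite cmul0r.
rewrite big1// => i _; rewrite ltn_eqF ?cmul0r//.
exact: leq_trans (ltn_ord i) jN.
Qed.

Lemma star_en N : star (en N) = en N.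
Proof. by rewrite star_sum; apply: eq_bigr => i _; rewrite starM starK. Qed.

Lemma en_le N M : (N <= M)%N -> en M ** en N = en N.
Proof.
move=> NM; rewrite cmul_sumr; apply: eq_bigr => i _.
by rewrite cmulA en_w (leq_trans (ltn_ord i) NM).
Qed.

Lemma en_ge N M : (N <= M)%N -> en N ** en M = en N.
Proof. by move=> NM; rewrite -[LHS]starK starM !star_en en_le// star_en. Qed.

Lemma nrm_en N : nrm (en N) <= 1.
Proof. by apply: nrm_projection; split; [exact: en_le|exact: star_en]. Qed.

Lemma nrm_compress x y z : nrm x <= 1 -> nrm z <= 1 -> nrm (x ** y ** z) <= nrm y.
Proof.
move=> x1 z1; apply: le_trans (nrm_cmul _ _) _.
apply: (@le_trans _ _ (nrm (x ** y) * 1)); first by rewrite ler_wpM2l ?nrm_ge0.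
rewrite mulr1; apply: le_trans (nrm_cmul _ _) _.
by rewrite -[leRHS]mul1r ler_wpM2r ?nrm_ge0.
Qed.

(** Powers of [S_(e_11)]; the zeroth is [P_(v_1)], the unit of the corner in which [S_(e_11)] is an
    isometry. *)
Definition sp n : A := iter n (cmul s11) p1.

Lemma spSr n : sp n.+1 = sp n ** s11.
Proof.
elim: n => [|n IH]; first by rewrite /sp /= s_P1 P1_s.
by rewrite /sp iterS -/(sp n.+1) {1}IH cmulA.
Qed.

Lemma star_spS n : star (sp n.+1) = star s11 ** star (sp n).
Proof. by rewrite spSr starM. Qed.

Lemma sp_w0 n : sp n ** w 0 = 0.
Proof.
by elim: n => [|n IH]; [exact: P1_w0|rewrite /sp iterS -cmulA IH cmul0r].
Qed.

Lemma sp_wS n i : sp n ** w i.+1 = w (i.+1 + n)%N.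
Proof.
elim: n => [|n IH]; first by rewrite addn0 P1_wS.
by rewrite /sp iterS -cmulA IH addSn s_w addnS.
Qed.

Lemma ssp_w n i : (n < i)%N -> star (sp n) ** w i = w (i - n).
Proof.
elim: n i => [|n IH] [|i]//; first by rewrite starP1 P1_wS.
by case: i => [|i]// ni; rewrite /sp iterS starM -cmulA ss_w IH// subSS.
Qed.

Lemma ssp_w0 n i : (i <= n)%N -> star (sp n) ** w i = 0.
Proof.
elim: n i => [|n IH] [|i]//; first by rewrite starP1 P1_w0.
  by rewrite /sp iterS starM -cmulA ss_w0 cmul0r.
case: i => [|i] ni; rewrite /sp iterS starM -cmulA; first by rewrite ss_w1 cmul0r.
by rewrite ss_w IH.
Qed.

Lemma nrm_s : nrm s11 <= 1.
Proof.
have := nrm_star_mul s11; rewrite ss => E.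
rewrite -(@ler_pXn2r _ 2) ?nnegrE ?nrm_ge0// -E expr1n.
exact/nrm_projection/P1_proj.
Qed.

Lemma nrm_sp n : nrm (sp n) <= 1.
Proof.
elim: n => [|n IH]; first exact/nrm_projection/P1_proj.
rewrite /sp iterS; apply: le_trans (nrm_cmul _ _) _.
by rewrite -[leRHS]mulr1 ler_pM ?nrm_ge0 ?nrm_s.
Qed.

Definition one : A := p1 + p2.

(** The graph has finitely many vertices, so the sum of the vertex projections is a unit: this holds
    on the generators and passes to products and limits. *)
Lemma cmul1 x : x ** one = x /\ one ** x = x.
Proof.
pose Q := [set x : A | x ** one = x /\ one ** x = x].
suff /adherent_tends[a Qa ax] : adherent Q x.
  split; [apply: tends_uniq (tends_cmulr _ ax) _|apply: tends_uniq (tends_cmull _ ax) _];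
  apply: tends_eventually ax; exists 0%N => n _; by case: (Qa n).
apply: (generated_dense hA).
- by rewrite /Q /= cmul0l cmul0r.
- move=> c y z [a b] [a' b']; split; first by rewrite cmulDl cmulZl a a'.
  by rewrite (cmulDr one) cmulZr b b'.
- by move=> y z [a b] [a' b']; split; rewrite ?cmulA ?b// -cmulA a'.
- have so : star one = one by rewrite /one starD starP1 starP2.
  by move=> y [a b]; split; rewrite -{1}so -starM ?a ?b.
- move=> v; rewrite /Q /= /one cmulDl cmulDr.
  by case: (ord2P v) => ->; rewrite ?P1P1 ?P2P2 ?P1P2 ?P2P1 ?addr0 ?add0r.
- move=> e; rewrite /Q /= /one cmulDl cmulDr; case: (edgeP e) => ->.
  + by rewrite s_P1 s_P2 P1_s P2_s !addr0.
  + by rewrite t_P1 t_P2 P1_t P2_t addr0 add0r.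
  + by rewrite u_P1 u_P2 P1_u P2_u !add0r.
Qed.

(* [A] is an extension of [C(T)], lifted to the powers of the shift [s11], by the
   ideal generated by [p2], in which the corners are dense. *)
Definition deg D : A -> Prop := span [set x | [\/ en D ** x ** en D = x,
  exists2 n, (n < D)%N & x = sp n | exists2 n, (0 < n < D)%N & x = star (sp n)]].

Lemma en_corner D D' x : (D <= D')%N -> en D ** x ** en D = x -> en D' ** x ** en D' = x.
Proof.
by move=> DD <-; rewrite !cmulA en_le// -[_ ** en D ** en D']cmulA en_ge.
Qed.

Lemma deg_le D D' x : (D <= D')%N -> deg D x -> deg D' x.
Proof.
move=> DD; apply: (@span_map _ _ _ _ _ id) => // y yD; apply: span_gen.
case: yD => [/(en_corner DD) h|[n nD E]|[n /andP[n0 nD] E]].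
- exact: Or31.
- by apply: Or32; exists n; rewrite // (leq_trans nD).
- by apply: Or33; exists n; rewrite // n0 (leq_trans nD).
Qed.

Lemma deg_col D x j : deg D x ->
  forall N, (D + j < N)%N -> en N ** (x ** w j) = x ** w j.
Proof.
move=> dx N jN; elim: dx => [|c y z yD _ IH]; first by rewrite cmul0l cmul0r.
rewrite cmulDl cmulDr cmulZl cmulZr IH; congr (_ *: _ + _).
case: yD => [<-|[n nD ->]|[n /andP[n0 nD] ->]].
- by rewrite !cmulA en_le//; lia.
- by case: j jN {IH} => [|j] jN; rewrite ?sp_w0 ?cmul0r// sp_wS en_w ifT//; lia.
- have [nj|jn] := ltnP n j; last by rewrite ssp_w0// cmul0r.
  by rewrite ssp_w// en_w ifT//; lia.
Qed.

Lemma deg_en D x N M : deg D x -> (D + N <= M)%N -> en M ** (x ** en N) = x ** en N.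
Proof.
move=> dx NM; rewrite !cmul_sumr; apply: eq_bigr => i _.
rewrite !cmulA -(cmulA (en M)) (deg_col dx)//.
by apply: leq_trans NM; rewrite ltn_add2l.
Qed.

(** [b 0 = 0] because [sp 0] is self-adjoint and is already counted by [a]. *)
Lemma deg_repr D z : deg D z -> exists (a b : nat -> R[i]) j, [/\ b 0%N = 0, en D ** j ** en D = j &
  z = j + \sum_(n < D) (a n *: sp n + b n *: star (sp n))].
Proof.
elim=> [|c x {}z xD _ [a [b [j [b0 jD ->]]]]].
  exists (fun=> 0), (fun=> 0), 0; split; rewrite ?cmul0r ?cmul0l//.
  by rewrite big1 ?addr0// => i _; rewrite !scale0r addr0.
case: xD => [h|[n nD ->]|[n /andP[n0 nD] ->]].
- exists a, b, (c *: x + j); split; rewrite ?addrA//.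
  by rewrite cmulDr cmulDl cmulZr cmulZl h jD.
- exists (fun k => a k + (k == n)%:R * c), b, j; split=> //.
  rewrite addrCA; congr (_ + _); rewrite (bigD1 (Ordinal nD))//= [RHS](bigD1 (Ordinal nD))//=.
  rewrite eqxx mul1r [a n + c]addrC scalerDl !addrA; congr (_ + _).
  by apply: eq_bigr => i; rewrite -val_eqE /= => /negPf->; rewrite mul0r addr0.
- exists a, (fun k => b k + (k == n)%:R * c), j; split=> //.
    by rewrite b0 add0r eq_sym (gtn_eqF n0) mul0r.
  rewrite addrCA; congr (_ + _); rewrite (bigD1 (Ordinal nD))//= [RHS](bigD1 (Ordinal nD))//=.
  rewrite eqxx mul1r [b n + c]addrC scalerDl !addrA; congr (_ + _ + _); first by rewrite addrC.
  by apply: eq_bigr => i; rewrite -val_eqE /= => /negPf->; rewrite mul0r addr0.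
Qed.

Lemma nrm_entry x i j N : (i < N)%N -> (j < N)%N ->
  nrm (star (w i) ** x ** w j) <= nrm (en N ** x ** en N).
Proof.
move=> iN jN; have wi : en N ** w i = w i by rewrite en_w iN.
have wj : en N ** w j = w j by rewrite en_w jN.
rewrite (_ : star (w i) ** x ** w j = star (w i) ** (en N ** x ** en N) ** w j).
  by apply: nrm_compress; rewrite ?nrm_star nrm_w.
by rewrite -[in LHS]wj -[in LHS]wi starM star_en !cmulA.
Qed.

(** The corner part [j] does not reach the indices from [D] on, so the coefficients of the powers of
    [S_(e_11)] and of their adjoints appear there as entries of [z], each bounded by [C]. The
    Toeplitz part [T] thus has norm at most [2 D C], the part [j = z - T] at most [C + 2 D C], being
    its own corner. *)
Lemma deg_bound D z C : deg D z -> (forall N, nrm (en N ** z ** en N) <= C) ->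
  nrm z <= (1 + 4 * D%:R) * C.
Proof.
move=> /deg_repr[a [b [j [b0 jD zE]]]] zC.
have C0 : 0 <= C by apply: le_trans (nrm_ge0 _) (zC 0%N).
case: D jD zE => [|D] jD zE.
  rewrite -jD /en !big_ord0 cmul0l cmul0l addr0 in zE.
  by rewrite zE nrm0 mulr_ge0// addr_ge0.
set T := \sum_(n < _) _ in zE.
have jw k : (D < k)%N -> j ** w k = 0.
  by move=> Dk; rewrite -jD -cmulA en_w ltnNge Dk /= cmul0r.
have wj k : (D < k)%N -> star (w k) ** j = 0.
  by move=> Dk; rewrite -jD !cmulA -star_en -starM en_w ltnNge Dk /= star0 !cmul0l.
have coef (c : nat -> R[i]) n (nD : (n < D.+1)%N) x :
    nrm (c n *: p2) <= C -> nrm x <= 1 -> nrm (c n *: x) <= C.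
  rewrite !nrmZ nrm_P2 mulr1 => cC x1; apply: le_trans cC.
  by rewrite ler_piMr ?nrm_ge0.
have aC n : (n < D.+1)%N -> nrm (a n *: sp n) <= C.
  move=> nD; apply: coef => //; last exact: nrm_sp.
  rewrite -[_ *: _](_ : star (w (D.+1 + n)) ** z ** w D.+1 = _).
    by apply: le_trans (zC (D.+1 + n).+1); apply: nrm_entry; rewrite ?ltnS ?leq_addr.
  rewrite zE cmulDr cmulDl wj ?addSn ?leq_addr// cmul0l add0r.
  rewrite -cmulA cmul_suml cmul_sumr (bigD1 (Ordinal nD))//=.
  have sE k : sp k ** w D.+1 = w (D.+1 + k) by exact: sp_wS.
  have ssE k : (0 < k < D.+1)%N -> star (w (D + n).+1) ** (star (sp k) ** w D.+1) = 0.
    by move=> /andP[k0 kD]; rewrite ssp_w// ww ifF//; lia.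
  rewrite big1 ?addr0 => [|k kn].
    rewrite cmulDl !cmulZl sE cmulDr !cmulZr ww eqxx.
    have [n0|n0] := posnP n; first by rewrite n0 b0 scale0r addr0.
    by rewrite ssE ?n0// scaler0 addr0.
  rewrite cmulDl !cmulZl sE cmulDr !cmulZr ww ifF ?scaler0 ?add0r.
    have [k0|k0] := posnP k; first by rewrite k0 b0 scale0r.
    by rewrite ssE ?k0 ?ltn_ord ?scaler0.
  by apply: contraNF kn => /eqP[] /addnI nk; apply/eqP/val_inj; rewrite /= nk.
have bC n : (n < D.+1)%N -> nrm (b n *: star (sp n)) <= C.
  have [->|n0 nD] := posnP n; first by rewrite b0 scale0r nrm0.
  apply: coef => //; last by rewrite nrm_star nrm_sp.
  rewrite -[_ *: _](_ : star (w D.+1) ** z ** w (D.+1 + n) = _).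
    by apply: le_trans (zC (D.+1 + n).+1); apply: nrm_entry; rewrite ?ltnS ?leq_addr.
  rewrite zE cmulDr cmulDl wj// cmul0l add0r.
  rewrite -cmulA cmul_suml cmul_sumr (bigD1 (Ordinal nD))//=.
  have sE k : sp k ** w (D + n).+1 = w ((D + n).+1 + k) by exact: sp_wS.
  have ssE k : (k < D.+1)%N -> star (sp k) ** w (D.+1 + n) = w (D.+1 + n - k).
    by move=> kD; rewrite ssp_w//; lia.
  rewrite big1 ?addr0 => [|k kn].
    rewrite cmulDl !cmulZl ssE// sE cmulDr !cmulZr !ww.
    by rewrite ifF; [rewrite scaler0 add0r ifT//|]; lia.
  rewrite cmulDl !cmulZl ssE// sE cmulDr !cmulZr !ww.
  rewrite ifF ?scaler0 ?add0r; last by lia.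
  rewrite ifF ?scaler0//; apply: contraNF kn => /eqP h; apply/eqP/val_inj => /=.
  by move: h (ltn_ord k); lia.
have TC : nrm T <= 2 * D.+1%:R * C.
  apply: le_trans (nrm_sum _ _ _) _.
  apply: (@le_trans _ _ (\sum_(n < D.+1) 2 * C)).
    apply: ler_sum => n _; apply: le_trans (nrmD _ _) _.
    by have := aC n (ltn_ord n); have := bC n (ltn_ord n); lra.
  by rewrite sumr_const card_ord -[leLHS]mulr_natl; lra.
have jC : nrm j <= C + 2 * D.+1%:R * C.
  rewrite -jD (_ : j = z - T); last by rewrite zE addrK.
  rewrite cmulBr cmulBl; apply: le_trans (nrmB _ _) _; apply: lerD => //.
  by apply: le_trans (nrm_compress _ (nrm_en _) (nrm_en _)) _.
by rewrite zE; apply: le_trans (nrmD _ _) _; lra.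
Qed.

(** Degree measured by the effect of left multiplication on [deg]: products are then immediate, and
    only the generators and their adjoints have to be examined. [mult_deg] returns to [deg] through
    the unit. *)
Definition mult D y := forall E z, deg E z -> deg (E + D) (y ** z).

Lemma mult_le D D' y : (D <= D')%N -> mult D y -> mult D' y.
Proof. by move=> DD my E z /my; apply: deg_le; rewrite leq_add2l. Qed.

Lemma mult_lin D D' c x y : mult D x -> mult D' y -> mult (maxn D D') (c *: x + y).
Proof.
move=> /(mult_le (leq_maxl D D')) mx /(mult_le (leq_maxr D D')) my E z dz.
by rewrite cmulDl cmulZl; apply: span_add; [apply: span_scale; exact: mx|exact: my].
Qed.

Lemma mult_mul D D' x y : mult D x -> mult D' y -> mult (D + D') (x ** y).
Proof. by move=> mx my E z /my/mx; rewrite -cmulA -addnA (addnC D'). Qed.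

Lemma deg_w D i j : (i < D)%N -> (j < D)%N -> deg D (w i ** star (w j)).
Proof.
move=> iD jD; apply: span_gen; apply: Or31.
by rewrite cmulA en_w iD -cmulA -star_en -starM en_w jD.
Qed.

(** The first condition says that [g] raises the index of [w i] by at most one, which takes care of
    all corners at once. *)
Lemma mult_gen g : (forall i, en i.+2 ** (g ** w i) = g ** w i) ->
  (forall n E, (n < E)%N -> deg E.+1 (g ** sp n)) ->
  (forall n E, (0 < n < E)%N -> deg E.+1 (g ** star (sp n))) -> mult 1 g.
Proof.
move=> gw gs gss E z; rewrite addn1; apply: span_map => [|c x y|y].
- exact: cmul0r.
- by rewrite cmulDr cmulZr.
case=> [jE|[n nE ->]|[n nE ->]]; [|exact: gs|exact: gss].
apply: span_gen; apply: Or31.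
have gE : en E.+1 ** (g ** en E) = g ** en E.
  rewrite !cmul_sumr; apply: eq_bigr => i _; rewrite !cmulA -(cmulA (en _)) -gw.
  by rewrite (cmulA (en E.+1)) (en_le (ltn_ord i : (i.+2 <= E.+1)%N)).
rewrite -jE !cmulA; rewrite !cmulA in gE; rewrite gE.
by rewrite -[LHS]cmulA en_ge.
Qed.

Lemma P1_sp n : p1 ** sp n = sp n.
Proof. by case: n => [|n]; rewrite ?P1P1// /sp iterS cmulA P1_s. Qed.

Lemma sp_P1 n : sp n ** p1 = sp n.
Proof. by case: n => [|n]; rewrite ?P1P1// spSr -cmulA s_P1. Qed.

Lemma P1_ssp n : p1 ** star (sp n) = star (sp n).
Proof. by rewrite -[in LHS]starP1 -starM sp_P1. Qed.

Lemma sp_s12 n : sp n ** s12 = w n.+1.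
Proof. exact: (sp_wS n 0). Qed.

Lemma w0E : w 0 = p2. Proof. by []. Qed.

Lemma w0_star_w n : w 0 ** star (w n) = star (w n).
Proof. by rewrite w0E -{1}starP2 -starM w_P2. Qed.

Lemma deg_sp D n : (n < D)%N -> deg D (sp n).
Proof. by move=> nD; apply: span_gen; apply: Or32; exists n. Qed.

Lemma deg_ssp D n : (n < D)%N -> deg D (star (sp n)).
Proof.
case: n => [|n] nD; first by rewrite starP1; exact: (@deg_sp _ 0).
by apply: span_gen; apply: Or33; exists n.+1.
Qed.

Lemma mult_P1 : mult 1 p1.
Proof.
apply: mult_gen => [[|i]|n E nE|n E /andP[_ nE]].
- by rewrite P1_w0 cmul0r.
- by rewrite P1_wS en_w ifT.
- by rewrite P1_sp; apply: deg_sp; rewrite ltnW.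
- by rewrite P1_ssp; apply: deg_ssp; rewrite ltnW.
Qed.

Lemma mult_P2 : mult 1 p2.
Proof.
apply: mult_gen => [[|i]|n E nE|n E /andP[_ nE]].
- by rewrite P2_w0 en_w.
- by rewrite P2_wS cmul0r.
- by rewrite -P1_sp cmulA P2P1 cmul0l; exact: span0.
- by rewrite -P1_ssp cmulA P2P1 cmul0l; exact: span0.
Qed.

Lemma mult_s11 : mult 1 s11.
Proof.
apply: mult_gen => [[|i]|n E nE|[|n] E /andP[// _ nE]].
- by rewrite s_w0 cmul0r.
- by rewrite s_w en_w ifT.
- exact: (@deg_sp _ n.+1).
(* [S_(e_11)] fails to be unitary only by [s12 ** star s12], so the product is the lower adjoint
   power up to an element of a corner. *)
- have -> : s11 ** star (sp n.+1) = (-1) *: (w 1 ** star (w n.+1)) + star (sp n).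
    rewrite star_spS cmulA (_ : s11 ** star s11 = p1 - s12 ** star s12); last first.
      by rewrite P1E addrK.
    by rewrite cmulBl P1_ssp -cmulA -starM sp_s12 scaleN1r addrC.
  apply: span_add; first by apply: span_scale; apply: deg_w; lia.
  by apply: deg_ssp; lia.
Qed.

Lemma mult_star_s11 : mult 1 (star s11).
Proof.
apply: mult_gen => [[|[|i]]|[|n] E nE|n E /andP[_ nE]].
- by rewrite ss_w0 cmul0r.
- by rewrite ss_w1 cmul0r.
- by rewrite ss_w en_w ifT//; lia.
- rewrite (_ : _ ** _ = star (sp 1)); first by apply: deg_ssp; lia.
  by rewrite star_spS starP1.
- by rewrite /sp iterS cmulA ss -/(sp n) P1_sp; apply: deg_sp; lia.
- by rewrite -star_spS; apply: deg_ssp.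
Qed.

Lemma mult_s12 : mult 1 s12.
Proof.
apply: mult_gen => [[|i]|n E nE|n E nE].
- by rewrite t_w0 en_w.
- by rewrite t_wS cmul0r.
- by rewrite -P1_sp cmulA t_P1 cmul0l; exact: span0.
- by rewrite -P1_ssp cmulA t_P1 cmul0l; exact: span0.
Qed.

Lemma mult_star_s12 : mult 1 (star s12).
Proof.
apply: mult_gen => [[|[|i]]|[|n] E nE|n E /andP[_ nE]].
- by rewrite st_w0 cmul0r.
- by rewrite st_w1 en_w.
- by rewrite st_wS cmul0r.
- rewrite (_ : _ ** _ = w 0 ** star (w 1)); first by apply: deg_w; lia.
  by rewrite w0_star_w /sp /= -[in LHS]starP1 -starM P1_t.
- by rewrite /sp iterS cmulA sts cmul0l; exact: span0.
- by rewrite -starM sp_s12 -w0_star_w; apply: deg_w; lia.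
Qed.

Lemma mult_s22 : mult 1 s22.
Proof.
apply: mult_gen => [[|i]|n E nE|n E nE].
- by rewrite u_w0 -{1}P2_u -w0E cmulA en_w w0E P2_u.
- by rewrite u_wS cmul0r.
- by rewrite -P1_sp cmulA u_P1 cmul0l; exact: span0.
- by rewrite -P1_ssp cmulA u_P1 cmul0l; exact: span0.
Qed.

Lemma su_P1 : star s22 ** p1 = 0.
Proof. by rewrite -starP1 -starM P1_u star0. Qed.

Lemma P2_su : p2 ** star s22 = star s22.
Proof. by rewrite -{1}starP2 -starM u_P2. Qed.

Lemma mult_star_s22 : mult 1 (star s22).
Proof.
apply: mult_gen => [[|i]|n E nE|n E nE].
- by rewrite su_w0 -{1}P2_su -w0E cmulA en_w w0E P2_su.
- by rewrite su_wS cmul0r.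
- by rewrite -P1_sp cmulA su_P1 cmul0l; exact: span0.
- by rewrite -P1_ssp cmulA su_P1 cmul0l; exact: span0.
Qed.

Definition finite_deg := [set y | exists D, mult D y /\ mult D (star y)].

Lemma finite_deg_dense x : adherent finite_deg x.
Proof.
apply: (generated_dense hA).
- by exists 0%N; rewrite star0; split=> E z _; rewrite cmul0l; exact: span0.
- move=> c y z [D [m1 m2]] [D' [m1' m2']]; exists (maxn D D').
  by rewrite starD starZ; split; exact: mult_lin.
- move=> y z [D [m1 m2]] [D' [m1' m2']]; exists (D + D')%N; rewrite starM.
  by split; [|rewrite addnC]; exact: mult_mul.
- by move=> y [D [m1 m2]]; exists D; rewrite starK.
- move=> v; exists 1%N; case: (ord2P v) => ->; rewrite ?starP1 ?starP2.
    by split; exact: mult_P1.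
  by split; exact: mult_P2.
- move=> e; exists 1%N; case: (edgeP e) => ->.
  + by split; [exact: mult_s11|exact: mult_star_s11].
  + by split; [exact: mult_s12|exact: mult_star_s12].
  + by split; [exact: mult_s22|exact: mult_star_s22].
Qed.

Lemma mult_deg D y : mult D y -> deg D.+1 y.
Proof.
move=> my; rewrite -[y](proj1 (cmul1 y)) -add1n; apply: my.
apply: span_add; first exact: (@deg_sp 1 0).
by rewrite (_ : p2 = w 0 ** star (w 0)); [exact: deg_w|rewrite w0_star_w starP2].
Qed.

Definition corner_le x (C : R) := forall N, nrm (en N ** x ** en N) <= C.

(** An element [y] of finite degree sends the corner [N] into the corner [M = D + N], so [en M] may
    be inserted between the factors. *)
Lemma corner_le_mul D x y C C' : deg D y -> corner_le x C -> corner_le y C' ->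
  corner_le (x ** y) (C * C').
Proof.
move=> dy hx hy N; set M := (D + N)%N.
have NM : (N <= M)%N by exact: leq_addl.
have -> : en N ** (x ** y) ** en N =
    en N ** ((en M ** x ** en M) ** (en M ** y ** en M)) ** en N.
  have E := deg_en dy (leqnn M).
  rewrite -[en N ** _ ** _]cmulA -[x ** y ** en N]cmulA -E.
  rewrite -{1}(en_ge NM) -[in LHS](en_le (leqnn M)) !cmulA.
  by rewrite -[RHS]cmulA (en_le NM) !(en_ge NM).
apply: le_trans (nrm_compress _ (nrm_en N) (nrm_en N)) _.
by apply: le_trans (nrm_cmul _ _) _; apply: ler_pM; rewrite ?nrm_ge0.
Qed.

Lemma nrm_pow2 x k : star x = x ->
  nrm (iter k (fun y => y ** y) x) = nrm x ^+ (2 ^ k).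
Proof.
move=> sx; elim: k => [|k IH]; first by rewrite expr1.
have sk : star (iter k (fun y => y ** y) x) = iter k (fun y => y ** y) x.
  by elim: k {IH} => [|k IH]//; rewrite iterS starM IH.
by rewrite iterS -{1}sk nrm_star_mul IH -exprM expnSr.
Qed.

(* [deg_bound] loses only a factor linear in the degree, which disappears when
   it is applied to the powers of [star y ** y]. *)
Lemma nrm_le_corners x C : corner_le x C -> nrm x <= C.
Proof.
move=> hx; apply/ler_addgt0Pr => e e0; have e2 : 0 < e / 2 by lra.
have [y [D [my mys]] xy] := finite_deg_dense x e2.
have C0 : 0 <= C by apply: le_trans (nrm_ge0 _) (hx 0%N).
set C' := C + e / 2; have C'0 : 0 <= C' by rewrite addr_ge0// ltW.
suff yC : nrm y <= C'.
  by have := nrmD (x - y) y; rewrite subrK; move: yC; rewrite /C'; lra.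
have hy : corner_le y C'.
  move=> N; rewrite -[y](subKr x) cmulBr cmulBl.
  apply: le_trans (nrmB _ _) _; apply: lerD => //.
  by apply: le_trans (nrm_compress _ (nrm_en _) (nrm_en _)) xy.
have hys : corner_le (star y) C'.
  by move=> N; rewrite -nrm_star !starM starK star_en cmulA.
pose h k := iter k (fun z => z ** z) (star y ** y).
have mh k : mult ((2 * D) * 2 ^ k) (h k).
  elim: k => [|k IH]; first by rewrite muln1 mul2n -addnn; exact: mult_mul.
  by rewrite /h iterS expnS mulnCA mul2n -addnn; exact: mult_mul.
have hh k : corner_le (h k) ((C' ^+ 2) ^+ (2 ^ k)).
  elim: k => [|k IH]; first by rewrite expr1 expr2; apply: corner_le_mul (mult_deg my) _ _.
  rewrite /h iterS expnSr exprM [_ ^+ 2]expr2.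
  exact: corner_le_mul (mult_deg (mh k)) _ _.
rewrite -(@ler_pXn2r _ 2) ?nnegrE ?nrm_ge0// -nrm_star_mul.
(* [h k] has degree [2 D 2^k + 1], and [deg_bound] gives the factor
   [1 + 4 (2 D 2^k + 1) = 5 + 8 D 2^k]. *)
apply: (@le_of_pow2 _ _ _ 5 (8 * D%:R)); rewrite ?nrm_ge0 ?sqr_ge0 ?mulr_ge0//.
move=> k; rewrite -nrm_pow2; last by rewrite starM starK.
apply: le_trans (deg_bound (mult_deg (mh k)) (hh k)) _.
rewrite ler_wpM2r ?exprn_ge0 ?sqr_ge0// le_eqVlt; apply/orP; left; apply/eqP.
by rewrite -[(_ * _ * _).+1]addn1 natrD !natrM; ring.
Qed.

(** For elements of finite degree the sequence is eventually constant; density and the contractions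
    [en N] do the rest. *)
Lemma tends_en x j : tends (fun N => en N ** (x ** w j)) (x ** w j).
Proof.
move=> e e0; have e2 : 0 < e / 2 by lra.
have [y [D [my _]] xy] := finite_deg_dense x e2.
exists (D.+1 + j).+1 => N jN.
have E : en N ** (y ** w j) = y ** w j by exact: deg_col (mult_deg my) _ jN.
have d : nrm (x ** w j - y ** w j) <= e / 2.
  by rewrite -cmulBl; apply: le_trans (nrm_cmul _ _) _; rewrite nrm_w mulr1.
have d' : nrm (en N ** (x ** w j) - en N ** (y ** w j)) <= e / 2.
  rewrite -cmulBr; apply: le_trans (nrm_cmul _ _) _; apply: le_trans d.
  by rewrite ler_piMl ?nrm_ge0// nrm_en.
have := nrm_tri (y ** w j) (en N ** (x ** w j)) (x ** w j).
by move: d'; rewrite E; move: d; rewrite (nrmBC (x ** w j)); lra.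
Qed.

Definition upow n : A := iter n (cmul s22) p2.

Lemma P2_upow n : p2 ** upow n = upow n.
Proof. by case: n => [|n]; [exact: P2P2|rewrite /upow iterS cmulA P2_u]. Qed.

Lemma upow_P2 n : upow n ** p2 = upow n.
Proof. by elim: n => [|n IH]; [exact: P2P2|rewrite /upow iterS -cmulA IH]. Qed.

Lemma upowD m n : upow (m + n) = upow m ** upow n.
Proof.
elim: m => [|m IH]; first by rewrite P2_upow.
by rewrite /upow addSn !iterS -cmulA -/(upow m) -/(upow n) -IH.
Qed.

Lemma upow_star_mul n : star (upow n) ** upow n = p2.
Proof.
elim: n => [|n IH]; first by rewrite starP2 P2P2.
by rewrite /upow iterS starM cmulA -(cmulA _ (star s22)) uu -cmulA P2_upow.
Qed.

Lemma upow_mul_star n : upow n ** star (upow n) = p2.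
Proof.
elim: n => [|n IH]; first by rewrite starP2 P2P2.
by rewrite /upow iterS starM cmulA -(cmulA s22) IH u_P2 -P2E.
Qed.

Lemma nrm_upow n : nrm (upow n) = 1.
Proof.
apply/eqP; rewrite -(@eqrXn2 _ 2) ?nrm_ge0//.
by rewrite -nrm_star_mul upow_star_mul nrm_P2 expr1n.
Qed.

(** * Systems of partial isometries indexed by a permutation and twisted by powers of u *)

Section System.
Variables (pi al : nat -> nat).

Definition om i : A := w (pi i) ** upow (al i).

Definition om_proj M : A := \sum_(i < M) om i ** star (om i).

Lemma om_P2 i : om i ** p2 = om i.
Proof. by rewrite -cmulA upow_P2. Qed.

Hypothesis pi_inj : injective pi.

Lemma om_ortho i j : star (om i) ** om j = if i == j then p2 else 0.
Proof.
rewrite starM cmulA -(cmulA (star (upow _))) ww (inj_eq pi_inj).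
have [->|_] := eqVneq; last by rewrite cmul0r cmul0l.
by rewrite -cmulA P2_upow upow_star_mul.
Qed.

Lemma om_proj_om M j : om_proj M ** om j = if (j < M)%N then om j else 0.
Proof.
rewrite cmul_suml; under eq_bigr => i _ do rewrite -cmulA om_ortho.
case: ltnP => jM.
  rewrite (bigD1 (Ordinal jM))//= eqxx om_P2 big1 ?addr0// => i.
  by rewrite -val_eqE /= => /negPf->; rewrite cmul0r.
rewrite big1// => i _; rewrite ltn_eqF ?cmul0r//.
exact: leq_trans (ltn_ord i) jM.
Qed.

Lemma star_om_proj M : star (om_proj M) = om_proj M.
Proof. by rewrite star_sum; apply: eq_bigr => i _; rewrite starM starK. Qed.

Lemma nrm_om_proj M : nrm (om_proj M) <= 1.
Proof.
apply: nrm_projection; split; last exact: star_om_proj.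
rewrite {2}/om_proj cmul_sumr; apply: eq_bigr => i _.
by rewrite cmulA om_proj_om ltn_ord.
Qed.

(** The shift by [r * n] moves the index and the twist alike; what remains is [star (upow (r * n))],
    which involves neither [pi] nor [al]. This is why these powers have the same matrix in every
    such system, see [same_sp]. *)
Lemma sp_om r n j : pi 0 = 0%N ->
  (forall i n, pi (i + r * n)%N = (pi i + r * n)%N) ->
  (forall i n, al (i + r * n)%N = (al i + r * n)%N) ->
  sp (r * n) ** om j =
  if j == 0%N then 0 else om (j + r * n) ** star (upow (r * n)).
Proof.
move=> pi0 pir alr; rewrite /om cmulA.
case: eqVneq => [->|j0]; first by rewrite pi0 sp_w0 cmul0l.
have : pi j != 0%N by rewrite -pi0 (inj_eq pi_inj).
case E : (pi j) => [|k]// _; rewrite sp_wS pir alr E upowD !cmulA.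
by rewrite -[RHS]cmulA upow_mul_star -cmulA upow_P2.
Qed.

Hypothesis pi_surj : forall k, exists i, pi i = k.

Lemma om_proj_en N : exists M0, forall M, (M0 <= M)%N -> om_proj M ** en N = en N.
Proof.
have cover k : exists M0, forall M, (M0 <= M)%N -> om_proj M ** w k = w k.
  have [i <-] := pi_surj k; exists i.+1 => M iM.
  rewrite -[w (pi i)]w_P2 -(upow_mul_star (al i)) !cmulA -(cmulA (om_proj M)).
  by rewrite om_proj_om iM.
elim: N => [|N [M0 IH]].
  by exists 0%N => M _; rewrite /en big_ord0 cmul0r.
have [M1 H1] := cover N; exists (maxn M0 M1) => M; rewrite geq_max => /andP[h0 h1].
by rewrite /en big_ord_recr cmulDr -/(en N) IH// cmulA H1.
Qed.

Lemma tends_om_proj x j : tends (fun M => om_proj M ** (x ** om j)) (x ** om j).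
Proof.
move=> e e0; have e2 : 0 < e / 2 by lra.
have [N HN] := tends_en x (pi j) e2; have [M0 HM] := om_proj_en N.
exists M0 => M /HM EM; set z := x ** om j.
have d : nrm (en N ** z - z) <= e / 2.
  rewrite /z /om !cmulA -cmulBl; apply: le_trans (nrm_cmul _ _) _.
  by rewrite nrm_upow mulr1 -(cmulA (en N)) HN.
have d' : nrm (om_proj M ** (en N ** z) - om_proj M ** z) <= e / 2.
  rewrite -cmulBr; apply: le_trans (nrm_cmul _ _) _; apply: le_trans d.
  by rewrite ler_piMl ?nrm_ge0// nrm_om_proj.
have := nrm_tri (en N ** z) (om_proj M ** z) z.
by move: d'; rewrite cmulA EM; have := nrmBC (om_proj M ** z) (en N ** z); lra.
Qed.

Lemma nrm_le_om_proj x C :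
  (forall M, nrm (om_proj M ** x ** om_proj M) <= C) -> nrm x <= C.
Proof.
move=> hx; apply: nrm_le_corners => N; have [M HM] := om_proj_en N.
have E := HM M (leqnn M); apply: le_trans (hx M).
have E' : en N ** om_proj M = en N.
  by rewrite -[LHS]starK starM star_om_proj star_en E star_en.
rewrite (_ : en N ** x ** en N = en N ** (om_proj M ** x ** om_proj M) ** en N).
  by apply: nrm_compress; exact: nrm_en.
by rewrite !cmulA E' -[RHS]cmulA E.
Qed.

(** The row-by-column rule for matrices with entries in the algebra: [om_proj M] is inserted between
    the factors and tends to the identity on the column [y ** om j]. *)
Lemma om_entry_mul i j x y :
  tends (fun M => \sum_(k < M) (star (om i) ** x ** om k) ** (star (om k) ** y ** om j))
    (star (om i) ** (x ** y) ** om j).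
Proof.
have := tends_cmull (star (om i) ** x) (tends_om_proj y j).
rewrite !cmulA; apply: tends_eventually; exists 0%N => M _.
rewrite /om_proj cmul_suml cmul_sumr; apply: eq_bigr => k _.
by rewrite !cmulA.
Qed.

End System.

Lemma omE pi al i : om pi al i = w (pi i) ** upow (al i).
Proof. by []. Qed.

(* Otherwise rewriting with [cmulA] or [starM] unfolds [om]. *)
Opaque om.

Lemma star_mul_starr x y : star (x ** star y) = y ** star x.
Proof. by rewrite starM starK. Qed.

Lemma star_sandwich x y z : star (star x ** y ** z) = star z ** star y ** x.
Proof. by rewrite !starM starK cmulA. Qed.

(** * Elements with the same matrix in two systems *)

Section MatrixCoincidence.
Variables (pi1 al1 pi2 al2 : nat -> nat).
Hypotheses (inj1 : injective pi1) (inj2 : injective pi2).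
Hypotheses (surj1 : forall k, exists i, pi1 i = k) (surj2 : forall k, exists i, pi2 i = k).
Local Notation om1 := (om pi1 al1).
Local Notation om2 := (om pi2 al2).

Definition same x y := forall i j,
  star (om1 i) ** x ** om1 j = star (om2 i) ** y ** om2 j.

(** The partial isometry [W] carries the first [M] vectors of the second system to those of the
    first, so the compression of [x] by [om_proj pi1 al1 M] is [W ** y ** star W]. *)
Lemma same_nrm x y : same x y -> nrm x <= nrm y.
Proof.
move=> xy; apply: (nrm_le_om_proj (al := al1) inj1 surj1) => M.
pose W := \sum_(i < M) om1 i ** star (om2 i).
have WW : W ** star W = om_proj pi1 al1 M.
  rewrite /W star_sum cmul_suml; apply: eq_bigr => i _.
  rewrite cmul_sumr (bigD1 i)//= big1 => [|j ji].
    by rewrite star_mul_starr cmulA -(cmulA (om1 i)) (om_ortho _ inj2) eqxx om_P2 addr0.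
  rewrite star_mul_starr cmulA -(cmulA (om1 i)) (om_ortho _ inj2) ifN.
    by rewrite cmul0r cmul0l.
  by rewrite eq_sym.
have W1 : nrm W <= 1.
  rewrite -(@ler_pXn2r _ 2) ?nnegrE ?nrm_ge0// -nrm_mul_star WW expr1n.
  exact: nrm_om_proj.
rewrite (_ : _ ** x ** _ = W ** y ** star W); first by apply: nrm_compress; rewrite ?nrm_star.
rewrite /W star_sum /om_proj !cmul_suml; apply: eq_bigr => i _.
rewrite !cmul_sumr; apply: eq_bigr => j _.
have -> : om1 i ** star (om1 i) ** x ** (om1 j ** star (om1 j)) =
    om1 i ** (star (om1 i) ** x ** om1 j) ** star (om1 j) by rewrite !cmulA.
by rewrite xy star_mul_starr !cmulA.
Qed.

Lemma same_lin c x y x' y' : same x x' -> same y y' -> same (c *: x + y) (c *: x' + y').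
Proof.
move=> h h' i j.
by rewrite !cmulDr !cmulDl !cmulZr !cmulZl h h'.
Qed.

Lemma same0 : same 0 0.
Proof. by move=> i j; rewrite !cmul0r !cmul0l. Qed.

Lemma same_star x y : same x y -> same (star x) (star y).
Proof.
move=> h i j; apply: (can_inj (@starK _ A)).
by rewrite !star_sandwich !starK h.
Qed.

Lemma same_mul x y x' y' : same x x' -> same y y' -> same (x ** y) (x' ** y').
Proof.
move=> h h' i j; apply: tends_uniq (om_entry_mul al1 inj1 surj1 i j x y) _.
apply: tends_eventually (om_entry_mul al2 inj2 surj2 i j x' y').
by exists 0%N => M _; apply: eq_bigr => k _; rewrite h h'.
Qed.

Lemma same_tends u v x y : (forall n, same (u n) (v n)) ->
  tends u x -> tends v y -> same x y.
Proof.
move=> uv ux vy i j.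
have := tends_cmulr (om1 j) (tends_cmull (star (om1 i)) ux); move/tends_uniq; apply.
apply: tends_eventually (tends_cmulr (om2 j) (tends_cmull (star (om2 i)) vy)).
by exists 0%N => n _; rewrite uv.
Qed.

End MatrixCoincidence.

Lemma same_sym pi1 al1 pi2 al2 x y : same pi1 al1 pi2 al2 x y -> same pi2 al2 pi1 al1 y x.
Proof. by move=> h i j; rewrite h. Qed.

Section Transfer.
Variables (pi1 al1 pi2 al2 : nat -> nat).
Hypotheses (inj1 : injective pi1) (inj2 : injective pi2).
Hypotheses (surj1 : forall k, exists i, pi1 i = k) (surj2 : forall k, exists i, pi2 i = k).
Local Notation om1 := (om pi1 al1).
Local Notation om2 := (om pi2 al2).
Local Notation same12 := (same pi1 al1 pi2 al2).

Lemma same_nrm_eq x y : same12 x y -> nrm x = nrm y.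
Proof.
move=> xy; apply/eqP; rewrite eq_le (same_nrm inj1 inj2 surj1 xy).
exact: (same_nrm inj2 inj1 surj2 (same_sym xy)).
Qed.

Lemma same_uniq x y y' : same12 x y -> same12 x y' -> y = y'.
Proof.
move=> h h'; apply/eqP; rewrite -subr_eq0; apply/eqP/nrm0_eq0.
rewrite -[y - y']addrC -scaleN1r -(same_nrm_eq (same_lin (-1) h' h)).
by rewrite scaleN1r addNr nrm0.
Qed.

Lemma same_closed x : adherent [set x | exists y, same12 x y] x -> exists y, same12 x y.
Proof.
move=> /adherent_tends[a /choice[b ab] ax].
have bc : cauchy_seq b.
  move=> e /(tends_cauchy ax)[N HN]; exists N => m n Nm Nn.
  have := same_nrm_eq (same_lin (-1) (ab n) (ab m)).
  by rewrite !scaleN1r ![- _ + _]addrC => <-; exact: HN.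
have [y hy] := cauchy_tends bc; exists y.
exact: same_tends ab ax hy.
Qed.

(** Such an [x] lies under [om_proj] of the first system for some finite [M], so the finite piece
    [W] of the intertwiner moves it exactly. *)
Lemma same_corner N x : en N ** x ** en N = x -> exists y, same12 x y.
Proof.
move=> xN; have [M HM] := om_proj_en al1 inj1 surj1 N.
have E := HM M (leqnn M).
have E' : en N ** om_proj pi1 al1 M = en N.
  by rewrite -[LHS]starK starM star_om_proj star_en E star_en.
pose W := \sum_(i < M) om1 i ** star (om2 i).
have W2 j : W ** om2 j = if (j < M)%N then om1 j else 0.
  rewrite cmul_suml; under eq_bigr => i _ do rewrite -cmulA (om_ortho _ inj2).
  case: ltnP => jM.
    rewrite (bigD1 (Ordinal jM))//= eqxx om_P2 big1 ?addr0// => i.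
    by rewrite -val_eqE /= => /negPf->; rewrite cmul0r.
  rewrite big1// => i _; rewrite ltn_eqF ?cmul0r//.
  exact: leq_trans (ltn_ord i) jM.
have xM : x = om_proj pi1 al1 M ** x ** om_proj pi1 al1 M.
  by rewrite -xN !cmulA E -[RHS]cmulA E'.
exists (star W ** x ** W) => i j.
have -> : star (om2 i) ** (star W ** x ** W) ** om2 j =
    star (W ** om2 i) ** x ** (W ** om2 j) by rewrite starM !cmulA.
have -> : star (om1 i) ** x ** om1 j =
    star (om_proj pi1 al1 M ** om1 i) ** x ** (om_proj pi1 al1 M ** om1 j).
  by rewrite [in LHS]xM starM star_om_proj !cmulA.
by rewrite !W2 !(om_proj_om _ inj1).
Qed.

Variable r : nat.
Hypotheses (pi10 : pi1 0 = 0%N) (pi20 : pi2 0 = 0%N).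
Hypotheses (pi1r : forall i n, pi1 (i + r * n)%N = (pi1 i + r * n)%N).
Hypotheses (pi2r : forall i n, pi2 (i + r * n)%N = (pi2 i + r * n)%N).
Hypotheses (al1r : forall i n, al1 (i + r * n)%N = (al1 i + r * n)%N).
Hypotheses (al2r : forall i n, al2 (i + r * n)%N = (al2 i + r * n)%N).

Lemma same_sp n : same12 (sp (r * n)) (sp (r * n)).
Proof.
move=> i j; rewrite -[LHS]cmulA -[RHS]cmulA.
rewrite !(sp_om inj1)// !(sp_om inj2)//; case: ifP => _; first by rewrite !cmul0r.
by rewrite (cmulA (star (om1 i))) (cmulA (star (om2 i))) (om_ortho _ inj1) (om_ortho _ inj2).
Qed.

End Transfer.

(** * Rescaling endomorphisms *)

Section Rescaling.
Variables (a b : R[i]) (phi : A -> A).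

(** Common form of the gauge action ([a = b = z]) and of a lens generator: [a] on the edges leaving
    [v_1], [b] on the edge leaving [v_2]. All iterates have this form too. *)
Definition resc := [/\ star_hom phi, forall v, phi (P v) = P v,
  phi s11 = a *: s11, phi s12 = a *: s12 & phi s22 = b *: s22].

Hypotheses (a1 : `|a| = 1) (b1 : `|b| = 1).
Hypothesis hphi : resc.

Let hphi' : star_hom phi. Proof. by case: hphi. Qed.

Lemma resc_w i : phi (w i) = a ^+ i *: w i.
Proof.
case: hphi => _ hP h11 h12 _.
case: i => [|i]; first by rewrite expr0 scale1r; exact: hP.
elim: i => [|i IH]; first by rewrite expr1; exact: h12.
by rewrite -s_w (star_homM hphi') h11 IH cmulZl cmulZr scalerA -exprS.
Qed.

Lemma resc_upow n : phi (upow n) = b ^+ n *: upow n.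
Proof.
case: hphi => _ hP _ _ h22.
elim: n => [|n IH]; first by rewrite expr0 scale1r; exact: hP.
rewrite /upow iterS -/(upow n) (star_homM hphi') h22 IH.
by rewrite cmulZl cmulZr scalerA -exprS.
Qed.

Lemma resc_sp n : phi (sp n) = a ^+ n *: sp n.
Proof.
case: hphi => _ hP h11 _ _.
elim: n => [|n IH]; first by rewrite expr0 scale1r; exact: hP.
rewrite /sp iterS -/(sp n) (star_homM hphi') h11 IH.
by rewrite cmulZl cmulZr scalerA -exprS.
Qed.

Lemma resc_om pi al i : phi (om pi al i) = (a ^+ pi i * b ^+ al i) *: om pi al i.
Proof.
by rewrite omE (star_homM hphi') resc_w resc_upow cmulZl cmulZr scalerA.
Qed.

Lemma unit_conjX (z : R[i]) n : `|z| = 1 -> Num.conj (z ^+ n) * z ^+ n = 1.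
Proof. by move=> z1; rewrite mulrC -normCK normrX z1 !expr1n. Qed.

Lemma resc_en N : phi (en N) = en N.
Proof.
rewrite (star_hom_sum hphi'); apply: eq_bigr => i _.
rewrite (star_homM hphi') (star_hom_star hphi') resc_w starZ cmulZl cmulZr scalerA.
by rewrite mulrC unit_conjX// scale1r.
Qed.

Lemma star_hom_sandwich (c d : R[i]) x y z : phi x = c *: x -> phi z = d *: z ->
  phi (star x ** y ** z) = (Num.conj c * d) *: (star x ** phi y ** z).
Proof.
move=> px pz; rewrite !(star_homM hphi') (star_hom_star hphi') px pz.
by rewrite starZ !cmulZl cmulZr scalerA.
Qed.

Lemma resc_entry_w x i j :
  phi (star (w i) ** x ** w j) = a ^ (j%:Z - i%:Z) *: (star (w i) ** phi x ** w j).
Proof.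
rewrite (star_hom_sandwich x (resc_w i) (resc_w j)).
congr (_ *: _); rewrite conj_unit; last by rewrite normrX a1 expr1n.
by rewrite exprz_sub// unit_neq0.
Qed.

Lemma resc_entry_om pi al x i j (c := fun k => a ^+ pi k * b ^+ al k) :
  phi (star (om pi al i) ** x ** om pi al j) =
  ((c i)^-1 * c j) *: (star (om pi al i) ** phi x ** om pi al j).
Proof.
rewrite (star_hom_sandwich x (resc_om pi al i) (resc_om pi al j)).
by congr ((_ * _) *: _); rewrite conj_unit// normrM !normrX a1 b1 !expr1n mulr1.
Qed.

End Rescaling.

Lemma resc_iter a b phi k : resc a b phi -> resc (a ^+ k) (b ^+ k) (iter k phi).
Proof.
move=> [h hP h11 h12 h22]; split.
- exact: star_hom_iter.
- by move=> v; exact: iter_fixed.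
- exact: iter_eigen.
- exact: iter_eigen.
- exact: iter_eigen.
Qed.

(** * Matrix entries as limits of Laurent polynomials *)

Definition laurent : set A := span [set x | exists n, x = upow n \/ x = star (upow n)].

Lemma laurent_upow n : laurent (upow n).
Proof. by apply: span_gen; exists n; left. Qed.

Lemma laurent_star_upow n : laurent (star (upow n)).
Proof. by apply: span_gen; exists n; right. Qed.

Lemma upowSr n : upow n.+1 = upow n ** s22.
Proof. by rewrite -addn1 upowD /upow /= u_P2. Qed.

Lemma star_upowS n : star (upow n.+1) = star s22 ** star (upow n).
Proof. by rewrite upowSr starM. Qed.

Lemma laurent_mull x : laurent x -> laurent (s22 ** x) /\ laurent (star s22 ** x).
Proof.
move=> Lx; have h g : (forall n, laurent (g ** upow n)) ->
    (forall n, laurent (g ** star (upow n))) -> laurent (g ** x).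
  move=> h1 h2; apply: (@span_map _ _ _ _ _ (cmul g)) Lx.
  - exact: cmul0r.
  - by move=> c y z; rewrite cmulDr cmulZr.
  - by move=> y [n [->|->]]; [exact: h1|exact: h2].
split; apply: h => n.
- exact: (laurent_upow n.+1).
- case: n => [|n]; first by rewrite starP2 u_P2 -[s22]u_P2; exact: (laurent_upow 1).
  rewrite star_upowS cmulA -P2E (_ : p2 ** _ = star (upow n)).
    exact: laurent_star_upow.
  by rewrite -starP2 -starM upow_P2.
- case: n => [|n].
    rewrite (_ : _ ** _ = star (upow 1)); first exact: laurent_star_upow.
    by rewrite star_upowS starP2.
  by rewrite /upow iterS cmulA uu P2_upow; exact: laurent_upow.
- by rewrite -star_upowS; exact: laurent_star_upow.
Qed.

Lemma laurent_star x : laurent x -> laurent (star x).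
Proof.
elim=> [|c y z [n [->|->]] _ IH]; first by rewrite star0; exact: span0.
  by rewrite starD starZ; apply: spanD => //; exists n; right.
by rewrite starD starZ starK; apply: spanD => //; exists n; left.
Qed.

Definition laurent_entries : set A := [set x | forall i j, laurent (star (w i) ** x ** w j)].

Lemma laurent_entries_gen g :
  (forall i, star g ** w i = 0 \/ exists k, star g ** w i = w k) ->
  forall x, laurent_entries x -> laurent_entries (g ** x).
Proof.
move=> hg x Lx i j; rewrite !cmulA.
have -> : star (w i) ** g = star (star g ** w i) by rewrite starM starK.
by case: (hg i) => [->|[k ->]]; [rewrite star0 !cmul0l; exact: span0|exact: Lx].
Qed.

Lemma laurent_entries_gen22 g : (g = s22 \/ g = star s22) ->
  forall x, laurent_entries x -> laurent_entries (g ** x).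
Proof.
move=> hg x Lx [|i] j.
  have -> : star (w 0) ** (g ** x) ** w j = g ** (star (w 0) ** x ** w j).
    case: hg => ->; rewrite !w0E starP2 !cmulA.
      by rewrite P2_u u_P2.
    by rewrite P2_su (su_w0 : star s22 ** p2 = star s22).
  by case: hg => ->; have [] := laurent_mull (Lx 0%N j).
rewrite !cmulA.
have -> : star (w i.+1) ** g = star (star g ** w i.+1) by rewrite starM starK.
by case: hg => ->; rewrite ?starK ?u_wS ?su_wS star0 !cmul0l; exact: span0.
Qed.

(** Multipliers rather than elements with Laurent entries: entries of a product are infinite series,
    whereas multipliers compose. *)
Definition laurent_mult : set A := [set y | forall x, laurent_entries x ->
  laurent_entries (y ** x) /\ laurent_entries (star y ** x)].

Lemma laurent_mult_dense x : adherent laurent_mult x.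
Proof.
have lin c x0 y i j : star (w i) ** (c *: x0 + y) ** w j =
    c *: (star (w i) ** x0 ** w j) + star (w i) ** y ** w j.
  by rewrite cmulDr cmulDl cmulZr cmulZl.
apply: (generated_dense hA).
- by move=> y _; split=> i j; rewrite ?star0 cmul0l cmul0r cmul0l; exact: span0.
- move=> c y z hy hz v Lv; have [y1 y2] := hy v Lv; have [z1 z2] := hz v Lv.
  split=> i j; rewrite ?starD ?starZ cmulDl cmulZl lin.
    by apply: span_add; [apply: span_scale; exact: y1|exact: z1].
  by apply: span_add; [apply: span_scale; exact: y2|exact: z2].
- move=> y z hy hz v Lv; rewrite starM -!cmulA; split.
    by apply: (proj1 (hy _ _)); exact: (proj1 (hz v Lv)).
  by apply: (proj2 (hz _ _)); exact: (proj2 (hy v Lv)).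
- by move=> y hy v Lv; rewrite starK; have [] := hy v Lv.
- move=> v; suff h i : P v ** w i = 0 \/ exists k, P v ** w i = w k.
    have sv : star (P v) = P v by case: (ord2P v) => ->; rewrite ?starP1 ?starP2.
    by move=> x0 Lx; rewrite sv; split; apply: laurent_entries_gen => // i; rewrite sv.
  case: (ord2P v) => ->; case: i => [|i]; rewrite ?P1_w0 ?P1_wS ?P2_w0 ?P2_wS;
    by [left|right; eexists].
- move=> e v Lv; case: (edgeP e) => ->; last first.
  + by split; apply: laurent_entries_gen22 => //; [left|right].
  + split; apply: laurent_entries_gen => // -[|[|i]]; rewrite ?starK ?st_w0 ?st_w1 ?st_wS ?t_w0 ?t_wS;
    by [left|right; eexists].
  + split; apply: laurent_entries_gen => // -[|[|i]]; rewrite ?starK ?ss_w0 ?ss_w1 ?ss_w ?s_w0 ?s_w;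
    by [left|right; eexists].
Qed.

Lemma entry_laurent x i j : adherent laurent (star (w i) ** x ** w j).
Proof.
move=> e /(laurent_mult_dense x)[y hy xy]; exists (star (w i) ** y ** w j).
  (* A multiplier applied to the unit, whose entries are [p2] and [0], has Laurent entries
     itself. *)
  have Lone : laurent_entries one.
    move=> k l; rewrite (proj1 (cmul1 _)) ww; case: ifP => _; last exact: span0.
    exact: (laurent_upow 0).
  by rewrite -[y](proj1 (cmul1 y)); exact: (proj1 (hy _ Lone)).
rewrite -cmulBl -cmulBr; apply: le_trans xy.
by apply: nrm_compress; rewrite ?nrm_star nrm_w.
Qed.

(** Entries are limits of Laurent polynomials in [u], so the factor on [u] determines a rescaling
    there. A power of one lens generator can thus replace another on entries, though not on the
    whole algebra. *)
Lemma laurent_agree (phi psi : A -> A) (b : R[i]) :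
  star_hom phi -> star_hom psi ->
  (forall n, phi (upow n) = b ^+ n *: upow n) -> (forall n, psi (upow n) = b ^+ n *: upow n) ->
  forall x i j, phi (star (w i) ** x ** w j) = psi (star (w i) ** x ** w j).
Proof.
move=> hp hs up us x i j.
have [v Lv xv] := adherent_tends (@entry_laurent x i j).
apply: (tends_uniq (tends_star_hom hp xv)); apply: tends_eventually (tends_star_hom hs xv).
exists 0%N => n _; elim: (Lv n) => [|c y z [k hk] _ IH].
  by rewrite (star_hom0 hp) (star_hom0 hs).
rewrite (star_homD hp) (star_homD hs) (star_homZ hp) (star_homZ hs) IH.
case: hk => ->; first by rewrite up us.
by rewrite (star_hom_star hp) (star_hom_star hs) up us.
Qed.

(** * Gauge-invariant elements *)

Section GaugeInvariant.
Variable gamma : R[i] -> A -> A.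
Hypothesis hgamma : forall z : R[i], `|z| = 1 -> resc z z (gamma z).

(** Once [N] exceeds all exponents, averaging over the powers of [theta R N] kills every term except
    the constant one. *)
Lemma laurent_avg y : laurent y -> exists N0, forall N, (N0 < N)%N ->
  exists l : R[i], avg (gamma (theta R N)) N y = l *: p2.
Proof.
elim=> [|c x z xg _ [N0 IH]].
  exists 0%N => N N0; exists 0; rewrite scale0r.
  by rewrite avg0//; case: (hgamma (norm_theta R N)).
case: xg => n hn; exists (maxn n N0) => N; rewrite gtn_max => /andP[nN /IH[l hl]].
have hg := hgamma (norm_theta R N); have hs : star_hom (gamma (theta R N)) by case: hg.
have N0' : (0 < N)%N by exact: leq_ltn_trans nN.
suff [l' hl'] : exists l', avg (gamma (theta R N)) N x = l' *: p2.
  by exists (c * l' + l); rewrite avg_lin// hl hl' scalerA scalerDl.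
have tN : theta R N ^+ n ^+ N = 1 by rewrite exprAC theta_exp_order// expr1n.
have t1 : theta R N ^+ n = 1 -> n = 0%N by exact: theta_expn.
have px : gamma (theta R N) (upow n) = theta R N ^+ n *: upow n by exact: resc_upow hg _.
case: hn => ->.
  rewrite (avg_eigen hs N0' px tN); case: eqP => [/t1->|_].
    by exists 1; rewrite scale1r.
  by exists 0; rewrite scale0r.
have px' : gamma (theta R N) (star (upow n)) = (theta R N ^+ n)^-1 *: star (upow n).
  rewrite (star_hom_star hs) px starZ conj_unit// normrX.
  by rewrite norm_theta expr1n.
rewrite (avg_eigen hs N0' px'); last by rewrite exprVn tN invr1.
rewrite invr_eq1; case: eqP => [/t1->|_].
  by exists 1; rewrite scale1r starP2.
by exists 0; rewrite scale0r.
Qed.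

Lemma scalar_closed d : adherent [set x | exists l : R[i], x = l *: p2] d ->
  exists l : R[i], d = l *: p2.
Proof.
move=> /adherent_tends[v /choice[l hl] vd].
have lc : cauchy_seq l.
  move=> e /(tends_cauchy vd)[N HN]; exists N => m n Nm Nn.
  by have := HN m n Nm Nn; rewrite !hl -scalerBl nrmZ nrm_P2 mulr1.
have [l0 hl0] := Ccauchy_tends lc; exists l0; apply: tends_uniq vd _.
move=> e /hl0[N HN]; exists N => n /HN.
by rewrite hl -scalerBl nrmZ nrm_P2 mulr1.
Qed.

Lemma adherent_laurent_invariant d : adherent laurent d ->
  (forall z : R[i], `|z| = 1 -> gamma z d = d) -> exists l : R[i], d = l *: p2.
Proof.
move=> Ld gd; apply: scalar_closed => e /Ld[y /laurent_avg[N0 HN] dy].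
have [l hl] := HN N0.+1 (ltnSn _); exists (l *: p2); first by exists l.
have hs : star_hom (gamma (theta R N0.+1)) by case: (hgamma (norm_theta R N0.+1)).
rewrite -hl -(avg_fixed hs (ltn0Sn N0) (gd _ (norm_theta R N0.+1))) -avgB//.
exact: le_trans (nrm_avg hs _ _) dy.
Qed.

Lemma entry_invariant x i j : (forall z : R[i], `|z| = 1 -> gamma z x = x) ->
  exists l : R[i], star (w i) ** x ** w j = l *: (star (upow i) ** upow j).
Proof.
move=> gx; pose c := star (w i) ** x ** w j.
(* The entry [c] has gauge degree [j - i] up to sign convention: [gamma z c = z ^ (j - i) *: c]. The
   outer factors contribute [i] and [- j], so [d] is gauge-invariant. *)
pose d := upow i ** c ** star (upow j).
have [l hl] : exists l : R[i], d = l *: p2.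
  apply: adherent_laurent_invariant => [e /(entry_laurent x i j)[y Ly cy]|z z1].
    exists (upow i ** y ** star (upow j)); last first.
      rewrite -cmulBl -cmulBr; apply: le_trans cy.
      by apply: nrm_compress; rewrite ?nrm_star nrm_upow.
    have lm k v : laurent v -> laurent (upow k ** v).
      move=> Lv; elim: k => [|k IH]; last by rewrite /upow iterS -cmulA; have [] := laurent_mull IH.
      have -> : upow 0 ** v = v; last by [].
      elim: Lv => [|a g h [m [->|->]] _ IH]; first by rewrite cmul0r.
        by rewrite cmulDr cmulZr IH P2_upow.
      by rewrite cmulDr cmulZr IH -[upow 0 ** _]starK starM starK starP2 upow_P2.
    rewrite -[_ ** star (upow j)]starK starM starK; apply: laurent_star.
    exact: (lm _ _ (laurent_star (lm _ _ Ly))).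
  have hg := hgamma z1; have hs : star_hom (gamma z) by case: hg.
  rewrite /d (star_homM hs) (star_homM hs (upow i)) (star_hom_star hs) !(resc_upow hg).
  rewrite /c (resc_entry_w z1 hg) gx//.
  rewrite starZ !cmulZl !cmulZr !cmulZl !scalerA -[RHS]scale1r; congr (_ *: _).
  have z0 := unit_neq0 z1.
  rewrite conj_unit ?normrX ?z1 ?expr1n// exprz_sub//.
  by field; rewrite !expf_neq0.
exists l; rewrite -[LHS]/c -cmulZr.
have -> : l *: upow j = d ** upow j by rewrite hl cmulZl P2_upow.
rewrite /d !cmulA upow_star_mul -cmulA upow_star_mul.
by rewrite /c -!cmulA w_P2 !cmulA -starP2 -starM w_P2.
Qed.

End GaugeInvariant.

(** * Quantum lens spaces *)

Lemma rescales_uniq (c : edge L3 -> R[i]) phi psi : (forall e, `|c e| = 1) ->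
  rescales P S c phi -> rescales P S c psi -> forall x, phi x = psi x.
Proof.
move=> c1 h h' x; have [chi [_ chiU]] := rescales_exists hA c1.
by rewrite -(chiU _ h) -(chiU _ h').
Qed.

(** Both composites multiply each [S e] by [c e * d e], and universality leaves only one such
    endomorphism. *)
Lemma rescales_comm (c d : edge L3 -> R[i]) phi psi :
  (forall e, `|c e| = 1) -> (forall e, `|d e| = 1) ->
  rescales P S c phi -> rescales P S d psi -> forall x, phi (psi x) = psi (phi x).
Proof.
move=> c1 d1 [hf fP fS] [hg gP gS].
apply: (@rescales_uniq (fun e => c e * d e) (phi \o psi) (psi \o phi)).
- by move=> e; rewrite normrM c1 d1 mulr1.
- split=> [|v|e] /=; rewrite ?gP ?fP//.
    split=> [a x y _ _|x y _ _|x _] /=.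
    + by rewrite (star_homD hg) (star_homZ hg) (star_homD hf) (star_homZ hf).
    + by rewrite (star_homM hg) (star_homM hf).
    + by rewrite (star_hom_star hg) (star_hom_star hf).
  by rewrite gS (star_homZ hf) fS scalerA mulrC.
- split=> [|v|e] /=; rewrite ?fP ?gP//.
    split=> [a x y _ _|x y _ _|x _] /=.
    + by rewrite (star_homD hf) (star_homZ hf) (star_homD hg) (star_homZ hg).
    + by rewrite (star_homM hf) (star_homM hg).
    + by rewrite (star_hom_star hf) (star_hom_star hg).
  by rewrite fS (star_homZ hg) gS scalerA.
Qed.

Lemma lens_resc r m rho : is_lens_generator P S r m rho ->
  resc (theta R r ^ m ord0) (theta R r ^ m ord_max) rho.
Proof. by move=> [h hP hS]; split. Qed.

Lemma gauge_resc gamma (z : R[i]) : is_gauge_action P S gamma -> `|z| = 1 ->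
  resc z z (gamma z).
Proof. by move=> h /h[h1 h2 h3]; split. Qed.

(** [pi 0 = 0] is required because [S_(e_11)] annihilates [w 0] and no other [w k]. *)
Definition shift_system r (pi al : nat -> nat) :=
  [/\ injective pi, forall k, exists i, pi i = k, pi 0 = 0%N,
    forall i n, pi (i + r * n)%N = (pi i + r * n)%N &
    forall i n, al (i + r * n)%N = (al i + r * n)%N].

(** * The isomorphism from two systems *)

Section Isomorphism.
Variables (pi1 al1 pi2 al2 : nat -> nat).
Local Notation om1 := (om pi1 al1).
Local Notation om2 := (om pi2 al2).
Local Notation same12 := (same pi1 al1 pi2 al2).
Variable r : nat.
Hypotheses (sys1 : shift_system r pi1 al1) (sys2 : shift_system r pi2 al2).

Let inj1 : injective pi1. Proof. by case: sys1. Qed.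
Let inj2 : injective pi2. Proof. by case: sys2. Qed.
Let surj1 : forall k, exists i, pi1 i = k. Proof. by case: sys1. Qed.
Let surj2 : forall k, exists i, pi2 i = k. Proof. by case: sys2. Qed.

(** Averaging over [Z/r] brings approximants of finite degree into the fixed-point algebra: corners
    stay corners since every [en N] is fixed, and a power of [S_(e_11)] survives only if [r] divides
    its exponent, because [a] has order exactly [r]. Both kinds have a counterpart. *)
Lemma same_exists (a b : R[i]) rho x : (0 < r)%N -> `|a| = 1 -> resc a b rho ->
  a ^+ r = 1 -> (forall n, a ^+ n = 1 -> (r %| n)%N) -> rho x = x ->
  exists y, same12 x y.
Proof.
move=> r0 a1 hrho ar aord rx; have hs : star_hom rho by case: hrho.
apply: (same_closed inj1 inj2 surj1 surj2) => e e0.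
have [y [D [my _]] xy] := finite_deg_dense x e0.
exists (avg rho r y); last first.
  rewrite -{1}(avg_fixed hs r0 rx) -avgB//.
  exact: le_trans (nrm_avg hs _ _) xy.
elim: (mult_deg my) => [|c v z vG _ [z' hz']].
  by exists 0; rewrite avg0//; exact: same0.
suff [v' hv'] : exists v', same12 (avg rho r v) v'.
  by exists (c *: v' + z'); rewrite avg_lin//; exact: same_lin.
have spk n : exists v', same12 (avg rho r (sp n)) v'.
  rewrite (avg_eigen hs r0 (resc_sp hrho n)); last by rewrite exprAC ar expr1n.
  case: eqP => [/aord/dvdnP[k ->]|_]; last by exists 0; exact: same0.
  rewrite mulnC; exists (sp (r * k)).
  case: sys1 => _ _ pi10 pi1r al1r; case: sys2 => _ _ pi20 pi2r al2r.
  exact: same_sp.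
case: vG => [vD|[n _ ->]|[n _ ->]].
- apply: (same_corner al1 al2 inj1 inj2 surj1 (N := D.+1)).
  by rewrite -[in RHS]vD (avg_sandwich hs)// (resc_en a1 hrho).
- exact: spk.
- have [v' hv'] := spk n; exists (star v').
  rewrite [avg _ _ _](_ : _ = star (avg rho r (sp n))); first exact: same_star.
  rewrite /avg starZ star_sum fmorphV rmorph_nat; congr (_ *: _).
  by apply: eq_bigr => k _; rewrite (star_hom_star (star_hom_iter hs k)).
Qed.

(** On the entries, [rho'] and the iterate [q] of [rho] agree because [b' = b ^+ q]. The vectors of
    the two systems acquire equal factors under these maps, so the entries of [rho' y] are those of
    [x], and uniqueness applies. *)
Lemma same_fixed (a b a' b' : R[i]) rho rho' q x y :
  `|a| = 1 -> `|b| = 1 -> `|a'| = 1 -> `|b'| = 1 ->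
  resc a b rho -> resc a' b' rho' -> b' = b ^+ q ->
  (forall i, (a ^+ pi1 i * b ^+ al1 i) ^+ q = a' ^+ pi2 i * b' ^+ al2 i) ->
  same12 x y -> rho x = x -> rho' y = y.
Proof.
move=> a1 b1 a'1 b'1 hr hr' bq ph xy rx.
have hs' : star_hom rho' by case: hr'.
have hs := resc_iter q hr; have hqs : star_hom (iter q rho) by case: hs.
apply: (same_uniq inj1 inj2 surj1 surj2 (x := x)) => // i j.
have agree pi al c k l : rho' (star (om pi al k) ** c ** om pi al l) =
    iter q rho (star (om pi al k) ** c ** om pi al l).
  have -> : star (om pi al k) ** c ** om pi al l =
      star (upow (al k)) ** (star (w (pi k)) ** c ** w (pi l)) ** upow (al l).
    by rewrite !omE starM !cmulA.
  have uagree n : rho' (upow n) = iter q rho (upow n).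
    by rewrite (resc_upow hr') (resc_upow hs) bq.
  rewrite !(star_homM hs' _ (upow _)) !(star_homM hqs _ (upow _)).
  rewrite (star_homM hs' (star (upow _))) (star_homM hqs (star (upow _))).
  rewrite (star_hom_star hs') (star_hom_star hqs) !uagree; congr (_ ** _ ** _).
  apply: (laurent_agree (b := b')) => // n; first exact: (resc_upow hr').
  by rewrite (resc_upow hs) bq.
have := agree pi2 al2 y i j.
rewrite (resc_entry_om a'1 b'1 hr') -[in RHS]xy.
have aq1 : `|a ^+ q| = 1 by rewrite normrX a1 expr1n.
have bq1 : `|b ^+ q| = 1 by rewrite normrX b1 expr1n.
rewrite (resc_entry_om aq1 bq1 hs) iter_fixed// -!ph.
rewrite ![(a ^+ q) ^+ _]exprAC ![(b ^+ q) ^+ _]exprAC -!exprMn.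
have nz k : (a ^+ pi1 k * b ^+ al1 k) ^+ q != 0.
  by rewrite expf_neq0// mulf_neq0// expf_neq0// unit_neq0.
move/scalerI => E; apply/esym/E; apply: mulf_neq0; rewrite ?invr_eq0; exact: nz.
Qed.

Lemma same_equivariant (z : R[i]) g x y : `|z| = 1 -> resc z z g ->
  (forall i, (pi1 i + al1 i = pi2 i + al2 i)%N) -> same12 x y -> same12 (g x) (g y).
Proof.
move=> z1 hg e12 xy i j; have := congr1 g (xy i j).
rewrite !(resc_entry_om z1 z1 hg) -!exprD !e12.
move/scalerI; apply; rewrite mulf_neq0 ?invr_eq0 ?expf_neq0// unit_neq0//.
Qed.

End Isomorphism.

Lemma shift_systems_isomorphism gamma r pi1 al1 pi2 al2 (a b a' b' : R[i]) rho rho' q q' :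
  shift_system r pi1 al1 -> shift_system r pi2 al2 -> (0 < r)%N -> is_gauge_action P S gamma ->
  `|a| = 1 -> `|b| = 1 -> `|a'| = 1 -> `|b'| = 1 ->
  resc a b rho -> resc a' b' rho' ->
  a ^+ r = 1 -> (forall n, a ^+ n = 1 -> (r %| n)%N) ->
  a' ^+ r = 1 -> (forall n, a' ^+ n = 1 -> (r %| n)%N) ->
  b' = b ^+ q -> b = b' ^+ q' ->
  (forall i, (a ^+ pi1 i * b ^+ al1 i) ^+ q = a' ^+ pi2 i * b' ^+ al2 i) ->
  (forall i, (a' ^+ pi2 i * b' ^+ al2 i) ^+ q' = a ^+ pi1 i * b ^+ al1 i) ->
  (forall i, (pi1 i + al1 i = pi2 i + al2 i)%N) ->
  equivariantly_isomorphic gamma (fixed_points rho) (fixed_points rho').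
Proof.
move=> sys1 sys2 r0 hgamma a1 b1 a'1 b'1 hr hr' ar aord a'r a'ord bq bq' ph ph' e12.
have [inj1 surj1 _ _ _] := sys1; have [inj2 surj2 _ _ _] := sys2.
(* [f] picks the counterpart of [x] where there is one; [0] is a default for the other elements. *)
have /choice[f hf] x : exists y, (exists y', same pi1 al1 pi2 al2 x y') -> same pi1 al1 pi2 al2 x y.
  by have [[y' xy]|nx] := pselect (exists y', same pi1 al1 pi2 al2 x y'); [exists y'|exists 0].
have fX x : fixed_points rho x -> same pi1 al1 pi2 al2 x (f x).
  by move=> /fixed_pointsP rx; apply: hf; exact: (same_exists sys1 sys2 r0 a1 hr ar aord rx).
have fU x y : same pi1 al1 pi2 al2 x y -> f x = y.
  by move=> xy; apply: (same_uniq inj1 inj2 surj1 surj2 (hf x _) xy); exists y.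
exists f; split; first split.
- move=> x Xx; apply/fixed_pointsP; have /fixed_pointsP rx := Xx.
  exact: (same_fixed sys1 sys2 a1 b1 a'1 b'1 hr hr' bq ph (fX x Xx) rx).
- move=> x y /set_mem Xx /set_mem Xy fxy.
  apply: (same_uniq inj2 inj1 surj2 surj1 (same_sym (fX x Xx))).
  by rewrite fxy; exact: same_sym (fX y Xy).
- move=> y /fixed_pointsP ry.
  have [x yx] := same_exists sys2 sys1 r0 a'1 hr' a'r a'ord ry.
  exists x; last exact/fU/same_sym.
  apply/fixed_pointsP.
  exact: (same_fixed sys2 sys1 a'1 b'1 a1 b1 hr' hr bq' ph' yx ry).
- split=> [c x y Xx Xy|x y Xx Xy|x Xx]; apply: fU.
  + by apply: same_lin; exact: fX.
  + by apply: (same_mul inj1 inj2 surj1 surj2); exact: fX.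
  + by apply: same_star; exact: fX.
- move=> z x z1 Xx; apply: fU.
  exact: (same_equivariant z1 (gauge_resc hgamma z1) e12 (fX x Xx)).
Qed.

(** * Counting projections in the gauge-invariant part *)

Section Counting.
Variable gamma : R[i] -> A -> A.
Hypothesis hgamma : is_gauge_action P S gamma.
Variable r : nat.
Hypothesis r0 : (0 < r)%N.
Local Notation th := (theta R r).

Let hg (z : R[i]) : `|z| = 1 -> resc z z (gamma z). Proof. exact: gauge_resc. Qed.

Lemma lens_gauge_comm m rho (z : R[i]) x : is_lens_generator P S r m rho -> `|z| = 1 ->
  rho (gamma z x) = gamma z (rho x).
Proof.
move=> hr z1; apply: (rescales_comm _ _ hr (hgamma z1)) => e //.
exact/norm_exprz/norm_theta.
Qed.

(** The action on the entry is computed twice: invariance of [x] gives the exponent [m_0 (j - i)],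
    the form [l *: (star (upow i) ** upow j)] gives [m_1 (j - i)]. A nonzero entry forces both to
    agree modulo [r]. *)
Lemma lens_entry_eq0 m rho x i j : is_lens_generator P S r m rho -> rho x = x ->
  (forall z : R[i], `|z| = 1 -> gamma z x = x) ->
  ~~ (r %| (m ord_max - m ord0) * (i%:Z - j%:Z))%Z -> star (w i) ** x ** w j = 0.
Proof.
move=> /lens_resc hr rx gx ndiv.
have [l hl] := entry_invariant hg i j gx.
have n0 : `|th ^ m ord0| = 1 by exact/norm_exprz/norm_theta.
have n1 : `|th ^ m ord_max| = 1 by exact/norm_exprz/norm_theta.
have hs : star_hom rho by case: hr.
have e1 := resc_entry_w n0 hr x i j; rewrite rx in e1.
have e2 : rho (star (w i) ** x ** w j) =
    (th ^ m ord_max) ^ (j%:Z - i%:Z) *: (star (w i) ** x ** w j).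
  rewrite {1}hl (star_homZ hs) (star_homM hs) (star_hom_star hs) !(resc_upow hr).
  rewrite starZ cmulZl cmulZr !scalerA hl scalerA; congr (_ *: _).
  rewrite conj_unit ?normrX ?n1 ?expr1n// exprz_sub ?unit_neq0//; ring.
move: e1; rewrite e2 => /eqP; rewrite -subr_eq0 -scalerBl scaler_eq0 subr_eq0.
case/orP => [/eqP h|/eqP//]; exfalso; move/negP: ndiv; apply.
apply/(theta_exp_eq1 R _ r0).
rewrite (_ : _ * _ = m ord0 * (j%:Z - i%:Z) - m ord_max * (j%:Z - i%:Z)); last by ring.
rewrite -theta_add -theta_inv -!exprz_exp -h mulfV//.
by rewrite expfz_neq0// expfz_neq0// theta_neq0.
Qed.

(** A matrix unit twisted by powers of [u] so that its gauge degree [i + j - i - j] vanishes; its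
    lens weight is [(m_0 - m_1) (i - j)]. *)
Definition unitel i j : A := w i ** upow j ** star (upow i) ** star (w j).

Lemma resc_unitel (a b : R[i]) phi i j : `|a| = 1 -> `|b| = 1 -> resc a b phi ->
  phi (unitel i j) = (a ^+ i * b ^+ j * (b ^+ i)^-1 * (a ^+ j)^-1) *: unitel i j.
Proof.
move=> a1 b1 hp; have hs : star_hom phi by case: hp.
rewrite /unitel !(star_homM hs) !(star_hom_star hs) !(resc_w hp) !(resc_upow hp).
rewrite !starZ !cmulZl !cmulZr !cmulZl !scalerA.
by rewrite !conj_unit ?normrX ?a1 ?b1 ?expr1n//; congr (_ *: _); ring.
Qed.

Lemma unitel_gauge (z : R[i]) i j : `|z| = 1 -> gamma z (unitel i j) = unitel i j.
Proof.
move=> z1; rewrite (resc_unitel i j z1 z1 (hg z1)).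
have nz k : z ^+ k != 0 by rewrite expf_neq0// unit_neq0.
rewrite (_ : _ / _ = 1) ?scale1r//; field; by rewrite !nz.
Qed.

Lemma unitel_lens m rho i j : is_lens_generator P S r m rho ->
  (r %| (m ord_max - m ord0) * (i%:Z - j%:Z))%Z -> rho (unitel i j) = unitel i j.
Proof.
move=> /lens_resc hr rd; rewrite (resc_unitel i j _ _ hr); [|exact/norm_exprz/norm_theta..].
rewrite !theta_pow !theta_inv !theta_add (proj2 (theta_exp_eq1 R _ r0)) ?scale1r//.
rewrite (_ : _ + _ = - ((m ord_max - m ord0) * (i%:Z - j%:Z))); last by ring.
by rewrite rpredN.
Qed.

Lemma w_neq0 x : x <> 0 -> exists i, x ** w i <> 0.
Proof.
move=> x0; apply: contrapT => /forallNP h; apply: x0; apply: nrm0_eq0.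
apply/eqP; rewrite eq_le nrm_ge0 andbT; apply: nrm_le_corners => N.
rewrite {2}/en cmul_sumr big1 ?nrm0// => i _.
by rewrite cmulA -(cmulA (en N)) (contrapT (h i)) cmul0r cmul0l.
Qed.

(** Each image [f (p a)] meets some column [k a]. If [k a] and [k b] were congruent modulo [N],
    [unitel (k a) (k b)] would be invariant and link [f (p a)] to [f (p b)], whereas its preimage
    cannot link [p a] to [p b], the entry there being zero. *)
Lemma lens_count m n rho_m rho_n M N :
  is_lens_generator P S r m rho_m -> is_lens_generator P S r n rho_n ->
  equivariantly_isomorphic gamma (fixed_points rho_m) (fixed_points rho_n) ->
  (0 < N)%N ->
  (forall i j, (i < M)%N -> (j < M)%N -> i != j ->
    ~~ (r %| (m ord_max - m ord0) * (i%:Z - j%:Z))%Z) ->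
  (forall i j, i = j %[mod N] -> (r %| (n ord_max - n ord0) * (i%:Z - j%:Z))%Z) ->
  (M <= N)%N.
Proof.
move=> hm hn [f [[fXY finj fsurj] [flin fmul fstar] fg]] N0 hM hN.
have hms : star_hom rho_m by case: hm.
pose X0 x := rho_m x = x /\ forall z : R[i], `|z| = 1 -> gamma z x = x.
have X0X x : X0 x -> fixed_points rho_m x by case=> /fixed_pointsP.
have XM x y : fixed_points rho_m x -> fixed_points rho_m y -> fixed_points rho_m (x ** y).
  by move=> /fixed_pointsP hx /fixed_pointsP hy; apply/fixed_pointsP; rewrite (star_homM hms) hx hy.
have X00 : fixed_points rho_m 0 by apply/fixed_pointsP; exact: star_hom0.
have f0 : f 0 = 0.
  have := flin 1 0 0 X00 X00; rewrite !scale1r addr0 => /eqP.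
  by rewrite -subr_eq0 opprD addrA subrr sub0r oppr_eq0 => /eqP.
have fY x : X0 x -> rho_n (f x) = f x /\ forall z : R[i], `|z| = 1 -> gamma z (f x) = f x.
  move=> [rx gx]; have Xx : fixed_points rho_m x by exact/fixed_pointsP.
  split; first exact/fixed_pointsP/fXY.
  by move=> z z1; rewrite -fg// gx.
pose p (a : nat) := w a ** star (w a).
have pE a : p a = unitel a a by rewrite /unitel -(cmulA (w a)) upow_mul_star w_P2.
have p0 a : X0 (p a).
  rewrite pE; split=> [|z z1]; last exact: unitel_gauge.
  by apply: (unitel_lens hm); rewrite subrr mulr0 dvdz0.
have pp a : p a ** p a = p a.
  by rewrite /p cmulA -(cmulA (w a)) ww eqxx w_P2.
have qq a : f (p a) ** f (p a) = f (p a) by rewrite -fmul ?pp//; exact/X0X/p0.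
have sq a : star (f (p a)) = f (p a).
  by rewrite -fstar ?starM ?starK//; exact/X0X/p0.
have q0 a : f (p a) <> 0.
  rewrite -f0 => /finj; rewrite !inE => /(_ (X0X _ (p0 a)) X00) pa0.
  have := ww a a; rewrite eqxx => h; apply: (graph_cstar_P2_neq0 hA).
  have wa : p a ** w a = w a by rewrite /p -cmulA ww eqxx w_P2.
  by rewrite -h -wa pa0 cmul0l cmul0r.
(* A column that [f (p a)] does not kill; the diagonal entry there is a nonzero multiple of [p2],
   since [f (p a)] is a gauge-invariant projection. *)
have /choice[k hk] a := w_neq0 (q0 a).
have /choice[l hl] a : exists l : R[i], l != 0 /\
    star (w (k a)) ** f (p a) ** w (k a) = l *: p2.
  have [_ gq] := fY _ (p0 a).
  have [l hl] := entry_invariant hg (k a) (k a) gq.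
  rewrite upow_star_mul in hl; exists l; split=> //.
  apply/eqP => l0; apply: (hk a); apply: star_mul_eq0.
  have -> : star (f (p a) ** w (k a)) ** (f (p a) ** w (k a)) =
      star (w (k a)) ** (f (p a) ** f (p a)) ** w (k a) by rewrite starM sq !cmulA.
  by rewrite qq hl l0 scale0r.
pose h (a : 'I_M) : 'I_N := Ordinal (ltn_pmod (k a) N0).
rewrite -[M]card_ord -[N]card_ord; apply: (@leq_card _ _ h) => a b hab.
apply/eqP/negPn/negP => ab.
have kab : k a = k b %[mod N] by exact: (congr1 val hab).
pose v := unitel (k a) (k b).
have rv : rho_n v = v by apply: (unitel_lens hn); exact: hN.
have [x Xx fx] : exists2 x, fixed_points rho_m x & f x = v.
  by have [x Xx fx] := fsurj v (proj2 (fixed_pointsP _ _) rv); exists x.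
(* Gauge invariance passes back along [f], which is equivariant and injective on the fixed points;
   the two actions commute, so [gamma z x] is fixed again. *)
have X0x : X0 x.
  have /fixed_pointsP rx := Xx; split=> // z z1.
  apply: finj; rewrite ?inE//.
    by apply/fixed_pointsP; rewrite (lens_gauge_comm _ hm z1) rx.
  by rewrite fg// fx unitel_gauge.
have pxp : p a ** x ** p b = 0.
  have -> : p a ** x ** p b = w a ** (star (w a) ** x ** w b) ** star (w b).
    by rewrite /p !cmulA.
  by rewrite (lens_entry_eq0 hm (proj1 X0x) (proj2 X0x)) ?cmul0r ?cmul0l//; apply: hM.
have : f (p a) ** v ** f (p b) = 0.
  have pX c := X0X _ (p0 c).
  by rewrite -fx -fmul// -fmul ?pxp//; exact: XM.
move=> /(congr1 (fun y => star (w (k a)) ** y ** w (k b))); rewrite cmul0r cmul0l.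
have [la ha] := hl a; have [lb hb] := hl b.
have -> : star (w (k a)) ** (f (p a) ** v ** f (p b)) ** w (k b) =
    (l a * l b) *: (upow (k b) ** star (upow (k a))).
  have -> : star (w (k a)) ** (f (p a) ** v ** f (p b)) ** w (k b) =
      (star (w (k a)) ** f (p a) ** w (k a)) ** (upow (k b) ** star (upow (k a))) **
      (star (w (k b)) ** f (p b) ** w (k b)) by rewrite /v /unitel !cmulA.
  rewrite ha hb !cmulZl !cmulZr scalerA; congr (_ *: _).
  by rewrite cmulA P2_upow -cmulA -[in LHS]starP2 -starM P2_upow.
move=> /eqP; rewrite scaler_eq0 mulf_eq0 (negPf la) (negPf lb) /= => /eqP u0.
have E : star (upow (k b)) ** (upow (k b) ** star (upow (k a))) ** upow (k a) = p2.
  by rewrite cmulA upow_star_mul -cmulA upow_star_mul P2P2.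
by apply: (graph_cstar_P2_neq0 hA); rewrite -E u0 cmul0r cmul0l.
Qed.

End Counting.

End L3Structure.

Lemma quotient_mod (r : nat) (a b : int) : (0 < r)%N -> coprimez a r ->
  exists q : nat, (r %| a * q%:Z - b)%Z.
Proof.
move=> r0 /coprimez_inv[c hc]; exists (residue r0 (c * b)).
rewrite (_ : _ - _ = a * ((residue r0 (c * b) : nat)%:Z - c * b) + (a * c - 1) * b); last by ring.
by apply: rpredD; [exact/dvdz_mull/residueP|exact: dvdz_mulr].
Qed.

(** [f] is meaningful on [X] only, so its inverse is chosen pointwise; the closure properties of [X]
    keep the combinations of inverse images where [f] is injective. *)
Lemma equivariantly_isomorphic_sym (R : realType) (A : cstarAlgType R)
    (gamma : R[i] -> A -> A) (X Y : set A) :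
  X 0 -> (forall (c : R[i]) x y, X x -> X y -> X (c *: x + y)) ->
  (forall x y, X x -> X y -> X (x ** y)) -> (forall x, X x -> X (star x)) ->
  (forall (z : R[i]) x, `|z| = 1 -> X x -> X (gamma z x)) ->
  equivariantly_isomorphic gamma X Y -> equivariantly_isomorphic gamma Y X.
Proof.
move=> X0 XL XM XS XG [f [[fXY finj fsurj] [flin fmul fstar] fg]].
have /choice[g hg] y : exists x, Y y -> X x /\ f x = y.
  by have [/fsurj[x Xx <-]|nY] := pselect (Y y); [exists x|exists 0].
have gX y : Y y -> X (g y) by case/hg.
have fgK y : Y y -> f (g y) = y by case/hg.
have gfK x : X x -> g (f x) = x.
  by move=> Xx; have [Xg E] := hg _ (fXY _ Xx); apply: finj; rewrite ?inE.
exists g; split; first split.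
- exact: gX.
- by move=> x y /set_mem Yx /set_mem Yy E; rewrite -(fgK x Yx) E fgK.
- by move=> x Xx; exists (f x); [exact: fXY|exact: gfK].
- split=> [c x y Yx Yy|x y Yx Yy|x Yx].
  + by rewrite -{1}(fgK x Yx) -{1}(fgK y Yy) -flin ?gfK//; auto.
  + by rewrite -{1}(fgK x Yx) -{1}(fgK y Yy) -fmul ?gfK//; auto.
  + by rewrite -{1}(fgK x Yx) -fstar ?gfK//; auto.
- by move=> z x z1 Yx; rewrite -{1}(fgK x Yx) -fg ?gfK//; auto.
Qed.

Lemma divn_gcd_gt0 (r a : nat) : (0 < r)%N -> (0 < r %/ gcdn a r)%N.
Proof.
move=> r0; have g0 : (0 < gcdn a r)%N by rewrite gcdn_gt0 r0 orbT.
by rewrite divn_gt0// (dvdn_leq r0)// dvdn_gcdr.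
Qed.

Lemma divn_gcd_inj (r a b : nat) : (0 < r)%N ->
  (r %/ gcdn a r = r %/ gcdn b r)%N -> gcdn a r = gcdn b r.
Proof.
move=> r0 E; apply/eqP; rewrite -(eqn_pmul2l (divn_gcd_gt0 b r0)) -{1}E.
by rewrite !divnK// dvdn_gcdr.
Qed.

(** * The lens spaces of two weights *)

Section LensSpaces.
Variables (R : realType) (A : cstarAlgType R).
Variables (P : vertex L3 -> A) (S : edge L3 -> A).
Hypothesis hA : is_graph_cstar P S.
Variables (gamma : R[i] -> A -> A) (r : nat).
Hypotheses (hgamma : is_gauge_action P S gamma) (r0 : (0 < r)%N).
Variables (m n : 'I_2 -> int) (rho_m rho_n : A -> A).
Hypotheses (hrho_m : is_lens_generator P S r m rho_m)
  (hrho_n : is_lens_generator P S r n rho_n).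
Local Notation gcd_lens k := (gcdn `|k ord_max - k ord0| r).

Lemma lens_equivariant_sym :
  equivariantly_isomorphic gamma (fixed_points rho_m) (fixed_points rho_n) ->
  equivariantly_isomorphic gamma (fixed_points rho_n) (fixed_points rho_m).
Proof.
have hs : star_hom rho_m by case: hrho_m.
apply: equivariantly_isomorphic_sym.
- by apply/fixed_pointsP; exact: star_hom0.
- move=> c x y /fixed_pointsP hx /fixed_pointsP hy; apply/fixed_pointsP.
  by rewrite (star_homD hs) (star_homZ hs) hx hy.
- move=> x y /fixed_pointsP hx /fixed_pointsP hy; apply/fixed_pointsP.
  by rewrite (star_homM hs) hx hy.
- by move=> x /fixed_pointsP hx; apply/fixed_pointsP; rewrite (star_hom_star hs) hx.
- move=> z x z1 /fixed_pointsP hx; apply/fixed_pointsP.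
  by rewrite (lens_gauge_comm hA hgamma _ hrho_m z1) hx.
Qed.

(** [r] divides [(m_1 - m_0) (i - j)] exactly if [i] and [j] agree modulo [r / gcd (m_1 - m_0, r)],
    which supplies both congruence conditions of [lens_count]. *)
Lemma lens_index_le :
  equivariantly_isomorphic gamma (fixed_points rho_m) (fixed_points rho_n) ->
  (r %/ gcd_lens m <= r %/ gcd_lens n)%N.
Proof.
move=> h; apply: (lens_count hA hgamma r0 hrho_m hrho_n h (divn_gcd_gt0 _ r0)) => i j.
  move=> iM jM; apply: contraNN.
  by rewrite dvdz_mul_gcd// -eqz_mod_dvd !modz_nat !modn_small.
by move=> E; rewrite dvdz_mul_gcd// -eqz_mod_dvd !modz_nat E.
Qed.

Hypotheses (hm : forall i, coprimez (m i) r) (hn : forall i, coprimez (n i) r).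

Lemma lens_isomorphic : gcd_lens m = gcd_lens n ->
  equivariantly_isomorphic gamma (fixed_points rho_m) (fixed_points rho_n).
Proof.
move=> /(lens_unit r0 hm hn)[v [vr hv]].
have [v' vv'] := unit_inverse r0 vr.
have vK : cancel (block_perm r v) (block_perm r v') by exact: block_permK.
have v'K : cancel (block_perm r v') (block_perm r v).
  by apply: block_permK; rewrite // mulnC.
(* [q = n_1 / m_1] and [q' = m_1 / n_1] modulo [r]: on the powers of [u] each generator acts as the
   corresponding power of the other. *)
have [q hq] := quotient_mod (n ord_max) r0 (hm ord_max).
have [q' hq'] := quotient_mod (m ord_max) r0 (hn ord_max).
have sys1 : shift_system r id (block_perm r v).
  by split=> // [k|i k]; [exists k|exact: block_perm_shift].
have sys2 : shift_system r (block_perm r v) id.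
  split=> // [|k||i k]; [exact: can_inj vK|by exists (block_perm r v' k)|exact: block_perm0|].
  exact: block_perm_shift.
(* The congruence for [v], read at the index [i]; it measures the difference of the weights of [i]
   in the two systems, in both directions of the isomorphism. *)
have defect i : (r %| m ord_max * (n ord_max - n ord0) * (block_perm r v i)%:Z
    - n ord_max * (m ord_max - m ord0) * i%:Z)%Z.
  rewrite (_ : _ - _ = m ord_max * (n ord_max - n ord0) * ((block_perm r v i)%:Z - (v * i)%N%:Z) +
    (m ord_max * (n ord_max - n ord0) * v%:Z - n ord_max * (m ord_max - m ord0)) * i%:Z).
    apply: rpredD; last exact: dvdz_mulr.
    by apply: dvdz_mull; rewrite -eqz_mod_dvd !modz_nat block_perm_mod.
  by rewrite PoszM; ring.
have th1 (k : int) : `|theta R r ^ k| = 1 by exact/norm_exprz/norm_theta.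
have ord (k : int) d : coprimez k r -> (theta R r ^ k) ^+ d = 1 -> (r %| d)%N.
  move=> kr; rewrite theta_pow => /(theta_exp_eq1 _ _ r0).
  by rewrite dvdz_cancel// dvdzE.
have per (k : int) : (theta R r ^ k) ^+ r = 1.
  by rewrite theta_pow; apply/(theta_exp_eq1 _ _ r0)/dvdz_mull/dvdzz.
apply: (shift_systems_isomorphism hA sys1 sys2 r0 hgamma (th1 _) (th1 _) (th1 _) (th1 _)
  (lens_resc hrho_m) (lens_resc hrho_n) (per _) _ (per _) _ (q := q) (q' := q')).
- by move=> d; apply: ord.
- by move=> d; apply: ord.
- rewrite theta_pow; apply: theta_eq_mod => //.
  by rewrite -opprB rpredN.
- rewrite theta_pow; apply: theta_eq_mod => //.
  by rewrite -opprB rpredN.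
- move=> i; rewrite !theta_pow !theta_add !theta_pow; apply: theta_eq_mod => //.
  rewrite -(dvdz_cancel _ (hm ord_max)).
  rewrite (_ : _ * (_ - _) = (m ord0 * i%:Z + m ord_max * (block_perm r v i)%:Z) *
      (m ord_max * q%:Z - n ord_max) +
    (m ord_max * (n ord_max - n ord0) * (block_perm r v i)%:Z
      - n ord_max * (m ord_max - m ord0) * i%:Z)); last by ring.
  by apply: rpredD => //; exact: dvdz_mull.
- move=> i; rewrite !theta_pow !theta_add !theta_pow; apply: theta_eq_mod => //.
  rewrite -(dvdz_cancel _ (hn ord_max)).
  rewrite (_ : _ * (_ - _) = (n ord0 * (block_perm r v i)%:Z + n ord_max * i%:Z) *
      (n ord_max * q'%:Z - m ord_max) -
    (m ord_max * (n ord_max - n ord0) * (block_perm r v i)%:Z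
      - n ord_max * (m ord_max - m ord0) * i%:Z)); last by ring.
  by apply: rpredB => //; exact: dvdz_mull.
- by move=> i; rewrite addnC.
Qed.

End LensSpaces.

Theorem theorem3p7 (R : realType) (A : cstarAlgType R)
    (P : vertex L3 -> A) (S : edge L3 -> A)
    (hA : is_graph_cstar P S)
    (gamma : R[i] -> A -> A) (hgamma : is_gauge_action P S gamma)
    (r : nat) (hr : (0 < r)%N) (m n : 'I_2 -> int)
    (hm : forall i, coprimez (m i) r) (hn : forall i, coprimez (n i) r)
    (rho_m : A -> A) (hrho_m : is_lens_generator P S r m rho_m)
    (rho_n : A -> A) (hrho_n : is_lens_generator P S r n rho_n) :
  (equivariantly_isomorphic gamma (fixed_points rho_m) (fixed_points rho_n)
     <-> gcdz (m ord_max - m ord0) r = gcdz (n ord_max - n ord0) r) /\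
  (gcdz (m ord_max - m ord0) r = gcdz (n ord_max - n ord0) r
     <-> path_lengths r m = path_lengths r n).
Proof.
have gcdE : gcdz (m ord_max - m ord0) r = gcdz (n ord_max - n ord0) r <->
    gcdn `|m ord_max - m ord0| r = gcdn `|n ord_max - n ord0| r.
  by split=> [[]|E]; rewrite // /gcdz /= E.
rewrite gcdE; split; split.
- move=> h; apply: divn_gcd_inj => //; apply/eqP; rewrite eqn_leq.
  rewrite (lens_index_le hA hgamma hr hrho_m hrho_n h).
  exact: (lens_index_le hA hgamma hr hrho_n hrho_m (lens_equivariant_sym hA hgamma hrho_m h)).
- exact: (lens_isomorphic hA hgamma hr hrho_m hrho_n hm hn).
- exact: path_lengths_perm.
- move=> E; apply/eqP; rewrite eqn_dvd.
  by rewrite (path_lengths_gcd hr hn hm (esym E)) (path_lengths_gcd hr hm hn E).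
Qed.
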